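(* In the setting described in the context (infinite-factor discounted bond price model $d\tilde P_t=\sigma_t\,dW_t$), suppose that for almost all $(t,\omega)\in[0,T]\times\Omega$ we have $$\ker(\sigma_t^* )=\mathcal T_{[0,t]} .$$ If the hedging strategies $\{\varphi^1_t\}_{t\in[0,T]}$ and $\{\varphi^2_t\}_{t\in[0,T]}$ hedge the same claim $\xi$, then $\varphi^1_t=\varphi^2_t$ for almost all $(t,\omega)\in[0,T]\times\Omega$.
   Context: Function spaces. For a function $w:\mathbb R_+\to\mathbb R_+$ and $i=1,2$, $F^i_w$ is the space of functions $x:\mathbb R_+\to\mathbb R$ that are $i-1$ times differentiable with $x^{(i-1)}$ absolutely continuous, $x^{(j)}(\infty)=0$ for $j\le i-1$, and $\|x\|_{F^i_w}^2=\int_0^\infty x^{(i)}(u)^2w(u)\,du<\infty$. Fix positive weights $v,w$ with $\int_0^\infty v(s)^{-1}ds<\infty$, $\int_0^\infty(1+u^2)w(u)^{-1}du<\infty$ and $\int_0^\infty\int_0^s \frac{v(u)}{w(s)}\,du\,ds<\infty$; then $F^2_w\subset F^1_v$ continuously and the evaluations $\delta_s$, $\langle\delta_s,x\rangle=x(s)$, are continuous on both spaces. Put $F=F^1_v$. $\langle\cdot,\cdot\rangle_E:E^*\times E\to\mathbb R$ denotes the duality pairing. For a closed interval $A\subset\mathbb R_+$, $\mathcal T_A=\overline{\mathrm{span}\{\delta_s:s\in A\}}\subset F^*$ (closure in $F^*$). Probability. $(\Omega,\mathcal F,\mathbb Q)$ is a complete probability space carrying a cylindrical Wiener process $\{W_t\}_{t\ge0}$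 on a real separable Hilbert space $H$; $\mathcal F$ is generated by $W$ and $\{\mathcal F_t\}$ is its augmented filtration. $\mathcal L_{HS}(H,G)$ is the space of Hilbert–Schmidt operators from $H$ into $G$. Stochastic integrands are adapted, measurable and square-integrable. Model. The discounted bond price curve $\{\tilde P_t\}_{t\ge0}$ is $F^2_w$-valued with initial condition $\tilde P_0\in F^2_w$ and $d\tilde P_t=\sigma_t\,dW_t$, where $\{\sigma_t\}_{t\ge0}$ is an adapted $\mathcal L_{HS}(H,F^2_w)$-valued process with $\sigma_t^*\delta_s=0$ for all $t\ge s$. It is assumed that $\tilde P_t(s)>0$ for all $s\ge0$ and that $$\mathbb E\Big\{\int_0^t\Big(\frac{|\tilde P_s'(s)|\,\|\tilde P_s\|_{F^2_w}}{\tilde P_s(s)^2}+\Big(1+\frac1{\tilde P_s(s)^2}\Big)\|\sigma_s\|^2_{\mathcal L_{HS}(H,F^2_w)}\Big)ds\Big\}<\infty .$$ The adjoint $\sigma_t^*$ is regarded as an operator $F^*\to H^*$ (composing $\sigma_t$ with the inclusion $F^2_w\subset F$). The bank account is $B_t=\tilde P_t(t)^{-1}$ and the bond price curve is $P_t=\tilde P_t/\tilde P_t(t)$, with $dB_t=-\frac{\tilde P_t'(t)}{\tilde P_t(t)^2}dt$ and $dP_t=-\frac{\tilde P_t'(t)}{\tilde P_t(t)^2}\tilde P_t\,dt+\frac1{\tilde P_t(t)}\sigma_t\,dW_t$. A contingent claim with maturity $T$ is an $\mathcal F_T$-measurable real random variable $\xi$, and $\tilde\xi=B_T^{-1}\xi$.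 Strategies. A strategy is an adapted $F^*$-valued process $\{\phi_t\}$ such that $\phi_t\in\mathcal T_{[t,\infty)}$ for almost every $(t,\omega)$. It is self-financing if $d\langle\phi_t,P_t\rangle_F=\langle\phi_t,dP_t\rangle_F$. It is a pre-hedging strategy for $\xi$ if $\tilde\xi=\mathbb E\{\tilde\xi\}+\int_0^T\langle\phi_s,d\tilde P_s\rangle_F$, where $\langle\phi_s,d\tilde P_s\rangle_F=\langle\sigma_s^*\phi_s,dW_s\rangle_H$. A hedging strategy for $\xi$ is a self-financing pre-hedging strategy for $\xi$; such a strategy is said to hedge $\xi$.
   Formalization: A strategy that hedges ξ is additionally required to be worth ξ at maturity (⟨φ_T,P_T⟩=ξ a.s.); with only self-financing and pre-hedging, as literally defined, uniqueness fails: for ξ=0 both φ_t=0 and φ_t=B_tδ_t are hedging strategies. *)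

(* Defs.v *)
From HB Require Import structures.
From mathcomp Require Export all_boot all_order all_algebra.
From mathcomp Require Export all_classical all_reals all_analysis.
Export Order.TTheory GRing.Theory Num.Theory.
Export numFieldNormedType.Exports.

#[export] Set Implicit Arguments.
#[export] Unset Strict Implicit.
#[export] Unset Printing Implicit Defensive.

#[global] Open Scope classical_set_scope.
#[global] Open Scope ring_scope.

(* A normed space given as a linear subspace of an ambient lmodType together
   with a norm; both the subspace and the norm are only meaningful on
   [carrier].  F^i_w, F^*, L_HS(H, G) and the real line are all of this form. *)
Record nspace (R : realType) (G : lmodType R) := NSpace {
  carrier : set G ;
  nnorm : G -> R }.

Section NormedSpaces.
Variables (R : realType) (G : lmodType R) (E : nspace G).

Definition nopen (U : set G) : Prop :=
  forall x, carrier E x -> U x -> exists2 e : R, 0 < e &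
    forall y, carrier E y -> nnorm E (y - x) < e -> U y.

Definition nclosure (A : set G) : set G := [set x | carrier E x /\
  forall e : R, 0 < e -> exists2 y, A y & nnorm E (x - y) < e].

Definition nspan (A : set G) : set G := [set x |
  exists (n : nat) (c : 'I_n -> R) (a : 'I_n -> G),
    (forall i, A (a i)) /\ x = \sum_(i < n) c i *: a i].

(* Two elements of E^* are the same functional when they agree on
   [carrier E]; their values elsewhere play no role. *)
Definition dual : nspace (G -> R^o) := NSpace
  [set l | (forall (a : R) x y, carrier E x -> carrier E y ->
               l (a *: x + y) = a *: l x + l y) /\
           exists C : R, forall x, carrier E x -> `|l x| <= C * nnorm E x]
  (fun l => sup [set `|l x| | x in [set x | carrier E x /\ nnorm E x <= 1]]).

(* [f], restricted to D, is measurable from the family of sets S to the Borel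
   sets of E. *)
Definition borel_fun (X : Type) (S : set (set X)) (D : set X) (f : X -> G) :=
  forall U, nopen U -> S (D `&` f @^-1` U).

End NormedSpaces.

Definition scalars (R : realType) : nspace (R^o : lmodType R) :=
  NSpace setT (fun x : R^o => `|x|).

(** Function spaces.  Functions on R_+ are encoded as functions on R that
    vanish on the negative half-line. *)
Section FunctionSpaces.
Variable R : realType.
Local Notation mu := (@lebesgue_measure R).

(* Derivative of a function on R_+ (one-sided at 0). *)
Definition Rplus_quotient (x : R -> R^o) (u : R) : R -> R^o :=
  fun v => (x v - x u) / (v - u).

Definition Rplus_nbhs (u : R) : set_system R :=
  within [set v | 0 <= v] (dnbhs u).

Definition Rplus_derivable (x : R -> R^o) (u : R) : Prop :=
  cvg (Rplus_quotient x u v @[v --> Rplus_nbhs u]).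

Definition Rplus_D (x : R -> R^o) : R -> R^o :=
  fun u => lim (Rplus_quotient x u v @[v --> Rplus_nbhs u]).

Definition Rplus_AC (x : R -> R^o) : Prop :=
  forall e : R, 0 < e -> exists2 d : R, 0 < d &
    forall (n : nat) (a b : 'I_n -> R),
      (forall i, 0 <= a i <= b i) ->
      (forall i j, i != j -> b i <= a j \/ b j <= a i) ->
      \sum_(i < n) (b i - a i) < d ->
      \sum_(i < n) `|x (b i) - x (a i)| < e.

(* The space F^i_w, for i >= 1. *)
Definition wenergy (i : nat) (w : R -> R) (x : R -> R^o) : \bar R :=
  (\int[mu]_(u in `[0%R, +oo[) ((iter i Rplus_D x u) ^+ 2 * w u)%:E)%E.

Definition Fspace (i : nat) (w : R -> R) : nspace (R -> R^o) := NSpace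
  [set x |
    [/\ forall u, u < 0 -> x u = 0,
        forall j u, (j < i.-1)%N -> 0 <= u ->
          Rplus_derivable (iter j Rplus_D x) u,
        Rplus_AC (iter i.-1 Rplus_D x),
        forall j, (j <= i.-1)%N -> iter j Rplus_D x u @[u --> +oo] --> (0 : R)
      & (wenergy i w x < +oo)%E]]
  (fun x => Num.sqrt (fine (wenergy i w x))).

Definition weight_conditions (v w : R -> R) : Prop :=
  [/\ forall u, 0 <= u -> 0 < v u /\ 0 < w u,
      measurable_fun (`[0%R, +oo[ : set (measurableTypeR R)) v /\
      measurable_fun (`[0%R, +oo[ : set (measurableTypeR R)) w,
      (\int[mu]_(s in `[0%R, +oo[) ((v s)^-1)%:E < +oo)%E,
      (\int[mu]_(u in `[0%R, +oo[) ((1 + u ^+ 2) * (w u)^-1)%:E < +oo)%E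
    & (\int[mu]_(s in `[0%R, +oo[) \int[mu]_(u in `[0%R, s])
         (v u / w s)%:E < +oo)%E].

Definition delta (s : R) : (R -> R^o) -> R^o := fun x => x s.

Definition Tspace (v : R -> R) (A : set R) : set ((R -> R^o) -> R^o) :=
  nclosure (dual (Fspace 1 v)) (nspan [set delta s | s in A]).

End FunctionSpaces.

Section Hilbert.
Variables (R : realType) (H : completeNormedModType R).
Variable ip : {dot H for (@idfun R)}.

Definition separable_hilbert : Prop :=
  (forall x : H, ip x x = `|x| ^+ 2) /\
  exists2 D : set H, countable D & dense D.

Definition orthonormal_basis (B : set H) : Prop :=
  [/\ forall b, B b -> ip b b = 1,
      forall b c, B b -> B c -> b <> c -> ip b c = 0
    & closure (nspan B) = setT].

(* The sum does not depend on the orthonormal basis; one is chosen. *)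
Definition hs_sq (G : lmodType R) (E : nspace G) (S : H -> G) : \bar R :=
  (\esum_(b in xget set0 orthonormal_basis) ((nnorm E (S b)) ^+ 2)%:E)%E.

Definition hs_space (G : lmodType R) (E : nspace G) : nspace (H -> G) := NSpace
  [set S | [/\ forall h, carrier E (S h),
               forall (a : R) h k, S (a *: h + k) = a *: S h + S k,
               exists C : R, forall h, nnorm E (S h) <= C * `|h|
             & (hs_sq E S < +oo)%E]]
  (fun S => Num.sqrt (fine (hs_sq E S))).

Definition adjoint (G : lmodType R) (S : H -> G) (l : G -> R^o) : H -> R^o :=
  fun h => l (S h).

End Hilbert.

Section Probability.
Variables (R : realType) (d : measure_display) (Om : measurableType d).
Variable Q : probability Om R.
Variables (H : completeNormedModType R) (ip : {dot H for (@idfun R)}).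
(* W t h is the real random variable <h, W_t>. *)
Variable W : R -> H -> Om -> R.
Local Notation mu := (@lebesgue_measure R).

Definition wiener_events (I : set R) : set (set Om) :=
  [set A | exists t h (B : set (measurableTypeR R)),
     [/\ I t, measurable B & A = W t h @^-1` B]].

Definition past (t : R) : set (set Om) := <<s wiener_events `[0, t] >>.

Definition filtration (t : R) : set (set Om) :=
  <<s wiener_events `[0, t] `|` [set N | Q.-negligible N] >>.

Definition cylindrical_wiener : Prop :=
  [/\ (forall t h, 0 <= t -> measurable_fun setT (W t h)),
      (forall t a h k, 0 <= t -> {ae Q, forall om,
         W t (a *: h + k) om = a * W t h om + W t k om}),
      (forall h, {ae Q, forall om, W 0 h om = 0}),
      (forall h, {ae Q, forall om,
         {within `[0%R, +oo[, continuous (fun t => W t h om : R^o)}}) &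
      (forall s t h B, 0 <= s -> s < t -> h != 0 -> measurable B ->
         let inc := [set om | B (W t h om - W s h om)] in
         Q inc = normal_prob 0 (Num.sqrt (t - s) * `|h|) B /\
         forall A, past s A -> Q (A `&` inc) = (Q A * Q inc)%E)].

Definition wiener_basis : Prop :=
  [/\ measure_is_complete Q, cylindrical_wiener
    & (measurable : set (set Om)) =
        <<s wiener_events `[0%R, +oo[ `|` [set N | Q.-negligible N] >>].

(* Adapted, (jointly) measurable E-valued process with time set I. *)
Definition process (G : lmodType R) (E : nspace G) (I : set R)
    (X : R -> Om -> G) : Prop :=
  [/\ forall t om, I t -> carrier E (X t om),
      forall t, I t -> borel_fun E (filtration t) setT (X t)
    & borel_fun E (measurable : set (set (measurableTypeR R * Om)))
        (I `*` setT) (fun z : measurableTypeR R * Om => X z.1 z.2)].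

Section Ito.
Variables (G : lmodType R) (E : nspace G).

(* The elementary L_HS(H, G)-valued integrand
   1_{(a, b]}(t) 1_A(omega) <h, .> g. *)
Record step := Step {
  step_a : R ; step_b : R ; step_A : set Om ; step_h : H ; step_g : G }.

Definition step_valid (p : step) : Prop :=
  [/\ 0 <= step_a p, step_a p <= step_b p,
      filtration (step_a p) (step_A p) & carrier E (step_g p)].

Definition step_fun (p : step) (t : R) (om : Om) : H -> G := fun k =>
  (\1_`]step_a p, step_b p] t * \1_(step_A p) om * ip (step_h p) k)
    *: step_g p.

Definition step_int (p : step) (t : R) (om : Om) : G :=
  (\1_(step_A p) om * (W (Num.min (step_b p) t) (step_h p) om
                       - W (Num.min (step_a p) t) (step_h p) om))
    *: step_g p.

Definition simple_fun (n : nat) (p : 'I_n -> step) (t : R) (om : Om) : H -> G :=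
  \sum_(i < n) step_fun (p i) t om.

Definition simple_int (n : nat) (p : 'I_n -> step) (t : R) (om : Om) : G :=
  \sum_(i < n) step_int (p i) t om.

(* E int_0^t |Psi_s|^2_HS ds *)
Definition L2_integrand (Psi : R -> Om -> H -> G) (t : R) : \bar R :=
  (\int[Q]_om \int[mu]_(s in `[0%R, t])
     ((nnorm (hs_space ip E) (Psi s om)) ^+ 2)%:E)%E.

(* X is (a version of) the Ito integral int_0^t Psi_s dW_s of an adapted,
   measurable and square-integrable L_HS(H, G)-valued process Psi: the L^2
   limit of the integrals of simple processes approximating Psi. *)
Definition ito_integral (Psi : R -> Om -> H -> G) (t : R) (X : Om -> G) :=
  [/\ process (hs_space ip E) `[0, t] Psi,
      (L2_integrand Psi t < +oo)%E,
      (forall om, carrier E (X om)) /\ borel_fun E (filtration t) setT X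
    & exists (n : nat -> nat) (p : forall k, 'I_(n k) -> step),
      [/\ forall k i, step_valid (p k i),
          (fun k => L2_integrand
             (fun s om => simple_fun (p k) s om - Psi s om) t) @ \oo --> 0%E
        & (fun k => \int[Q]_om
             ((nnorm E (simple_int (p k) t om - X om)) ^+ 2)%:E)%E
            @ \oo --> 0%E]].

End Ito.

End Probability.

Section BondModel.
Variables (R : realType) (d : measure_display) (Om : measurableType d).
Variable Q : probability Om R.
Variables (H : completeNormedModType R) (ip : {dot H for (@idfun R)}).
Variable W : R -> H -> Om -> R.
Variables v w : R -> R.
(* Pd is the discounted price curve. *)
Variable Pd : R -> Om -> R -> R^o.
Variable sigma : R -> Om -> H -> R -> R^o.
Local Notation mu := (@lebesgue_measure R).
Local Notation F := (Fspace 1 v).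
Local Notation F2 := (Fspace 2 w).

Definition bond_model : Prop :=
  [/\ process Q W F2 `[0%R, +oo[ Pd /\
        (exists2 p0, carrier F2 p0 & forall om, Pd 0 om = p0),
      process Q W (hs_space ip F2) `[0%R, +oo[ sigma /\
        (forall s t om, 0 <= s -> s <= t ->
           adjoint (sigma t om) (@delta R s) = cst 0),
      (forall t s om, 0 <= t -> 0 <= s -> 0 < Pd t om s),
      (forall t, 0 <= t ->
        (\int[Q]_om \int[mu]_(s in `[0%R, t])
          (`|Rplus_D (Pd s om) s| * nnorm F2 (Pd s om) / (Pd s om s) ^+ 2
           + (1 + ((Pd s om s) ^+ 2)^-1)
             * (nnorm (hs_space ip F2) (sigma s om)) ^+ 2)%:E < +oo)%E)
    & forall t, 0 <= t -> exists2 X, ito_integral Q ip W F2 sigma t X &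
        {ae Q, forall om, Pd t om = Pd 0 om + X om}].

Definition bank (t : R) (om : Om) : R := (Pd t om t)^-1.

Definition bond_price (t : R) (om : Om) : R -> R^o :=
  (Pd t om t)^-1 *: Pd t om.

(* The coefficients of dP_t = bond_drift_t dt + bond_vol_t dW_t. *)
Definition bond_drift (t : R) (om : Om) : R -> R^o :=
  - (Rplus_D (Pd t om) t / (Pd t om t) ^+ 2) *: Pd t om.

Definition bond_vol (t : R) (om : Om) : H -> R -> R^o :=
  fun h => (Pd t om t)^-1 *: sigma t om h.

Definition sigma_adj_ker (t : R) (om : Om) : set ((R -> R^o) -> R^o) :=
  [set l | carrier (dual F) l /\ adjoint (sigma t om) l = cst 0].

Variable T : R.

Definition claim (xi : Om -> R) : Prop :=
  forall B : set (measurableTypeR R), measurable B ->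
    filtration Q W T (xi @^-1` B).

Definition discounted (xi : Om -> R) : Om -> R :=
  fun om => (bank T om)^-1 * xi om.

Variable phi : R -> Om -> (R -> R^o) -> R^o.

Definition strategy : Prop :=
  process Q W (dual F) `[0, T] phi /\
  {ae (mu \x Q)%E, forall z, 0 <= z.1 <= T ->
     Tspace v `[z.1, +oo[ (phi z.1 z.2)}.

Definition value (t : R) (om : Om) : R := phi t om (bond_price t om).

Definition self_financing : Prop :=
  {ae Q, forall om, mu.-integrable `[0, T]
     (fun s => (phi s om (bond_drift s om))%:E)} /\
  forall t, 0 <= t <= T -> exists2 X : Om -> R^o,
    ito_integral Q ip W (scalars R)
      (fun s om => adjoint (bond_vol s om) (phi s om)) t X &
    {ae Q, forall om, value t om - value 0 om =
       Rintegral mu `[0, t] (fun s => phi s om (bond_drift s om)) + X om}.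

Definition pre_hedging (xi : Om -> R) : Prop :=
  Q.-integrable setT (EFin \o discounted xi) /\
  exists2 X : Om -> R^o,
    ito_integral Q ip W (scalars R)
      (fun s om => adjoint (sigma s om) (phi s om)) T X &
    {ae Q, forall om,
       discounted xi om = fine ('E_Q[discounted xi])%E + X om}.

(* The dynamic conditions determine phi only up to c B_t delta_t, c a
   constant: holding c extra units of the bank account is self-financing and
   does not change the stochastic integral.  That the portfolio replicates
   the claim, i.e. is worth xi at maturity, is therefore part of hedging. *)
Definition hedges (xi : Om -> R) : Prop :=
  [/\ strategy, self_financing, pre_hedging xi
    & {ae Q, forall om, value T om = xi om}].

End BondModel.

(* Main.v *)
(* Let psi be the difference of the two strategies.  By the Itô isometry, equal
   stochastic integrals have almost everywhere equal integrands, so sigma* psi = 0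
   and psi_t lies in T_[0,t]; it also lies in T_[t,oo).  A function of F^1_v that
   vanishes at t is the sum of its restrictions to [0,t] and [t,oo), which lie in
   F^1_v again, so psi_t vanishes on it: psi_t = c_t delta_t for a scalar c_t.
   The volatility of the bonds is Ptilde_t(t)^-1 sigma_t, hence the two
   self-financing conditions have equal martingale parts, and their difference is
   the pathwise equation dc_t = r_t c_t dt with r_t = - Ptilde'_t(t) / Ptilde_t(t).
   As both portfolios are worth xi at T, c_T = 0, and Gronwall's inequality
   applied backwards from T gives c = 0.

   The norms of the model are not known to be measurable, so inequalities between
   integrals are proved for the integral of an arbitrary nonnegative function,
   the supremum of the integrals of the simple functions below it. *)
Require Import Defs.
From HB Require Import structures.
From mathcomp Require Import measurable_realfun lra ring.

(** The equation for [c] is obtained for each fixed [t], almost surely, whereas Gronwall's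
    inequality needs it on almost every path, at almost every time. Exchanging the two requires
    joint measurability of [c] and of its drift in (t, omega); the measurability lemmas on the
    curve, the short rate and the gap serve this purpose. For the same reason c_t is read off by
    testing psi_t on the initial curve Ptilde_0, which is deterministic and positive at every t: c_t
    = psi_t(Ptilde_0) / Ptilde_0(t). Gronwall also needs r to be integrable along paths. This
    follows from the moment condition of the model, because Ptilde_t(t) is at most a constant times
    the norm of Ptilde_t. The derivative [Rplus_D] is a limit with a default value where it does not
    exist, hence not evidently linear or measurable. Norms are therefore computed with a measurable
    density that agrees with it almost everywhere, which calls for the fundamental theorem of
    calculus for absolutely continuous functions. *)

Section AlmostEverywhere.
Context d (T : measurableType d) (R : realType) (m : {measure set T -> \bar R}).
Implicit Types P Q S : T -> Prop.

Lemma aeS P Q : (forall x, P x -> Q x) ->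
  {ae m, forall x, P x} -> {ae m, forall x, Q x}.
Proof. by move=> PQ; apply: (@filterS _ _ (ae_filter_ringOfSetsType m)). Qed.

Lemma aeS2 P Q S : (forall x, P x -> Q x -> S x) ->
  {ae m, forall x, P x} -> {ae m, forall x, Q x} -> {ae m, forall x, S x}.
Proof. by move=> PQ; apply: (@filterS2 _ _ (ae_filter_ringOfSetsType m)). Qed.

End AlmostEverywhere.


(** * Absolutely continuous functions *)

Section NonOverlapping.
Variable R : realType.
Implicit Types (f g : R -> R) (s J : seq (R * R)) (p q : R * R).

Definition nonoverlap p q := (q.2 <= p.1) || (p.2 <= q.1).

Definition itv_family s :=
  all (fun p => p.1 <= p.2) s && pairwise nonoverlap s.

Definition total_length s := \sum_(p <- s) (p.2 - p.1).

Definition total_increment f s := \sum_(p <- s) `|f p.2 - f p.1|.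

(** Lists of intervals replace the indexed families of [Rplus_AC], since the families below are
    concatenated, refined and filtered. *)
Definition AC_on (D : set R) f := forall e, 0 < e -> exists2 d, 0 < d &
  forall s, (forall p, p \in s -> D p.1 /\ D p.2) -> itv_family s ->
    total_length s < d -> total_increment f s < e.

Lemma Rplus_AC_on f : Rplus_AC f -> AC_on `[0, +oo[ f.
Proof.
move=> ACf e /ACf[d d0 fd]; exists d => // s s0 /andP[/allP s1 s2].
rewrite /total_length /total_increment !(big_nth (0, 0)) !big_mkord => sd.
apply: (fd _ (fun i => (nth (0, 0) s i).1) (fun i => (nth (0, 0) s i).2)) => //.
- move=> i; have /s0[+ _] : nth (0, 0) s i \in s by rewrite mem_nth.
  rewrite /= in_itv/= andbT => ->/=.
  by have /s1 : nth (0, 0) s i \in s by rewrite mem_nth.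
- move=> i j; rewrite neq_ltn => /orP[] ij.
  + by have /orP[] := (pairwiseP (0, 0) s2) i j (ltn_ord i) (ltn_ord j) ij; auto.
  + by have /orP[] := (pairwiseP (0, 0) s2) j i (ltn_ord j) (ltn_ord i) ij; auto.
Qed.

Lemma total_incrementD f g s :
  total_increment (fun x => f x + g x) s <= total_increment f s + total_increment g s.
Proof.
rewrite /total_increment -big_split/=; apply: ler_sum => p _.
by rewrite opprD addrACA ler_normD.
Qed.

Lemma nonoverlapC p q : nonoverlap p q = nonoverlap q p.
Proof. by rewrite /nonoverlap orbC. Qed.

Lemma nonoverlap_sub p p' q : p.1 <= p'.1 -> p'.2 <= p.2 ->
  nonoverlap p q -> nonoverlap p' q.
Proof.
move=> p1 p2 /orP[h|h]; apply/orP; [left|right].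
  exact: le_trans h p1.
exact: le_trans p2 h.
Qed.

Lemma partition_family f a l : path <%R a l ->
  let s := zip (belast a l) l in
  [/\ itv_family s, (forall p, p \in s -> a <= p.1 /\ p.2 <= last a l),
      total_length s = last a l - a
    & total_increment f s = variation a (last a l) f l].
Proof.
elim: l a => [|x l IH] a /=.
  by rewrite /total_length /total_increment /variation !big_nil subrr.
move=> /andP[ax xl]; have [/andP[s1 s2] s3 s4 s5] := IH x xl.
have xlast : x <= last x l.
  by move/order_path_min : xl => /(_ lt_trans)/allP; case: (l) => //= y l' /(_ (last y l'));
    rewrite mem_last => /(_ isT)/ltW.
split.
- rewrite /itv_family/= ltW//= s1 s2/= andbT; apply/allP => p /s3[px _].
  by rewrite /nonoverlap/= px orbT.
- move=> p; rewrite inE => /predU1P[->//|/s3[px pl]]; split => //.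
  exact: le_trans (ltW ax) px.
- by rewrite /total_length big_cons/= -/(total_length _) s4 addrC subrKA.
- rewrite /total_increment big_cons/= -/(total_increment _ _) s5.
  by rewrite /variation/= [in RHS]big_nat_recl.
Qed.

Lemma family_cat s J : itv_family (s ++ J) =
  [&& itv_family s, itv_family J & allrel nonoverlap s J].
Proof.
by rewrite /itv_family all_cat pairwise_cat; do ![case: all|case: pairwise|case: allrel].
Qed.

(** Replacing an interval by a subdivision keeps the total length of the family, so the [d] given by
    absolute continuity serves for all subdivisions at once, hence for the suprema. The strict bound
    becomes a weak one. *)
Lemma AC_total_variation D f : is_interval D -> AC_on D f ->
  forall e, 0 < e -> exists2 d, 0 < d &
  forall s, (forall p, p \in s -> D p.1 /\ D p.2) -> itv_family s ->
    total_length s < d ->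
    (\sum_(p <- s) total_variation p.1 p.2 f <= e%:E)%E.
Proof.
move=> itvD ACf e /ACf[d d0 fd]; exists d => // J.
(* [s] holds the intervals already subdivided, [J] those still counted by their total variation. *)
suff main : forall s, (forall p, p \in s ++ J -> D p.1 /\ D p.2) ->
    itv_family (s ++ J) -> total_length (s ++ J) < d ->
    ((total_increment f s)%:E + \sum_(p <- J) total_variation p.1 p.2 f <= e%:E)%E.
  move=> DJ fJ Jd; have := main [::] DJ fJ Jd.
  by rewrite /total_increment big_nil add0e.
elim: J => [|p J IH] s DJ fJ Jd.
  rewrite big_nil adde0 lee_fin ltW//; rewrite cats0 in DJ fJ Jd.
  exact: fd.
have p12 : p.1 <= p.2.
  move: fJ; rewrite family_cat => /and3P[_ /andP[/allP/(_ p)+ _] _].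
  by rewrite inE eqxx; apply.
pose S := (\sum_(q <- J) total_variation q.1 q.2 f)%E.
have S0 : (0 <= S)%E.
  rewrite /S big_seq sume_ge0// => q qJ; apply: total_variation_ge0.
  move: fJ; rewrite family_cat => /and3P[_ /andP[/allP/(_ q)+ _] _].
  by rewrite inE qJ orbT; apply.
suff H x : variations p.1 p.2 f x ->
    ((total_increment f s)%:E + x%:E + S <= e%:E)%E.
  rewrite big_cons -/S.
  have [l pl] : exists l, variations p.1 p.2 f l.
    move: p12; rewrite le_eqVlt => /predU1P[->|/(variations_neq0 f)//].
    by rewrite variationsxx; exists 0.
  (* [S] must be finite to be moved to the other side before the supremum over subdivisions of [p]
     is taken; [H] itself shows it. *)
  have Sfin : S \is a fin_num.
    rewrite ge0_fin_numE//; have := H _ pl.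
    by rewrite ltey => Sle; apply/eqP => Sy; move: Sle; rewrite Sy addey.
  rewrite addeA -leeBrDr// addeC -leeBrDr//; apply: ge_ereal_sup => _ [x /H Hx <-].
  by rewrite leeBrDr// addeC leeBrDr.
(* The pieces of [p] cut by [l] move from [J] to [s]: they stay inside [p], so the family is still
   nonoverlapping. *)
move=> -[l [lp /eqP ll] <-].
have [sl1 sl2 sl3 sl4] := partition_family f lp; rewrite ll in sl2 sl3 sl4.
set sl := zip _ _ in sl1 sl2 sl3 sl4.
have -> : ((total_increment f s)%:E + (variation p.1 p.2 f l)%:E)%E =
          (total_increment f (s ++ sl))%:E.
  by rewrite -sl4 -EFinD /total_increment big_cat.
have [Dp1 Dp2] : D p.1 /\ D p.2 by apply: DJ; rewrite mem_cat mem_head orbT.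
apply: IH.
- move=> q; rewrite -catA !mem_cat => /or3P[qs|/[dup] qsl /sl2[q1 q2]|qJ].
  + by apply: DJ; rewrite mem_cat qs.
  + have q12 : q.1 <= q.2 by move: sl1 => /andP[/allP/(_ _ qsl)].
    split; apply: (itvD _ _ Dp1 Dp2); apply/andP; split => //.
      exact: le_trans q12 q2.
    exact: le_trans q1 q12.
  + by apply: DJ; rewrite mem_cat inE qJ !orbT.
- move: fJ; rewrite -catA !family_cat allrel_consr allrel_catr.
  rewrite /itv_family/= => /and4P[-> /andP[/andP[_ ->]/andP[pJ ->]] sp ->].
  move: sl1 => /andP[-> ->]; rewrite /= !andbT; apply/andP; split.
    apply/allrelP => q r /sl2[q1 q2] rJ; apply: nonoverlap_sub q1 q2 _.
    by move/allP: pJ => /(_ _ rJ).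
  apply/allrelP => q r qs /sl2[r1 r2]; rewrite nonoverlapC.
  apply: nonoverlap_sub r1 r2 _; rewrite nonoverlapC.
  by move/allP : sp => /(_ _ qs).
- rewrite (le_lt_trans _ Jd)// /total_length -catA !big_cat big_cons/=.
  by rewrite -/(total_length sl) sl3.
Qed.

End NonOverlapping.

Section TotalVariationAC.
Variable R : realType.
Implicit Types (f g : R -> R) (s : seq (R * R)).
Local Notation TV := total_variation.

Lemma AC_total_variation_fin D f a b : is_interval D -> AC_on D f ->
  D a -> D b -> a <= b -> TV a b f \is a fin_num.
Proof.
move=> itvD ACf Da Db ab; have [d d0 fd] := AC_total_variation itvD ACf ltr01.
rewrite ge0_fin_numE; last exact: total_variation_ge0.
have step x y : D x -> D y -> x <= y -> y - x < d -> (TV x y f <= 1%:E)%E.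
  move=> Dx Dy xy yxd; have := fd [:: (x, y)].
  rewrite /total_length !big_seq1 /itv_family/= xy; apply => //.
  by move=> p; rewrite inE => /eqP ->.
(* Steps of length [d / 2], shorter than [d], each carry variation at most 1; the induction is on
   their number, with [b] varying. *)
have [k bk] : exists k : nat, b <= a + (d / 2) *+ k.
  exists (Num.truncn ((b - a) / (d / 2))).+1.
  rewrite -lerBlDl -mulr_natl -ler_pdivrMr ?divr_gt0//.
  exact/ltW/truncnS_gt.
elim: k b Db ab bk => [|k IH] b Db ab bk.
  rewrite mulr0n addr0 in bk.
  by rewrite (_ : b = a) ?total_variationxx ?ltry//; apply/le_anti; rewrite bk ab.
have [bak|akb] := leP b (a + (d / 2) *+ k); first exact: IH.
set c := a + (d / 2) *+ k in akb.
have ac : a <= c by rewrite lerDl mulrn_wge0// ltW// divr_gt0.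
have Dc : D c by apply: (itvD _ _ Da Db); rewrite ac ltW.
rewrite (total_variationD f ac (ltW akb)) lte_add_pinfty ?IH//.
rewrite (le_lt_trans (step c b Dc Db (ltW akb) _)) ?ltry//.
rewrite ltrBlDl (le_lt_trans bk)// /c mulrSr addrA ltrD2l.
by rewrite ltr_pdivrMr// ltr_pMr// ltr1n.
Qed.

Lemma AC_onW (D E : set R) f : E `<=` D -> AC_on D f -> AC_on E f.
Proof.
move=> ED ACf e /ACf[d d0 fd]; exists d => // s sE; apply: fd => p /sE[? ?].
by split; exact: ED.
Qed.

(** By additivity, the increment of the variation function over an interval is the total variation
    of [f] there. The halved [e] restores the strict inequality. *)
Lemma AC_on_total_variation D f a : is_interval D -> AC_on D f -> D a ->
  AC_on (D `&` `[a, +oo[) (fun x => fine (TV a x f)).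
Proof.
move=> itvD ACf Da e e0.
have [|d d0 fd] := AC_total_variation itvD ACf (e := e / 2); first exact: divr_gt0.
exists d => // s sD /[dup] fs /andP[/allP s1 _] sd.
apply: (@le_lt_trans _ _ (e / 2)); last by rewrite ltr_pdivrMr// ltr_pMr// ltr1n.
rewrite -lee_fin; apply: le_trans (fd s _ fs sd); last by move=> p /sD[[? _] [? _]].
rewrite /total_increment -sumEFin big_seq [leRHS]big_seq; apply: lee_sum => p ps.
have [[Dp1 /=]] := sD p ps; rewrite in_itv/= andbT => ap1 [Dp2 _].
have p12 := s1 p ps; have ap2 := le_trans ap1 p12.
have fin1 := AC_total_variation_fin itvD ACf Da Dp1 ap1.
have fin2 := AC_total_variation_fin itvD ACf Dp1 Dp2 p12.
rewrite (total_variationD f ap1 p12) fineD// addrC addKr ger0_norm.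
  by rewrite fineK.
by rewrite fine_ge0// total_variation_ge0.
Qed.

Lemma AC_onB D f g : AC_on D f -> AC_on D g -> AC_on D (fun x => f x - g x).
Proof.
move=> ACf ACg e e0.
have [d d0 fd] := ACf _ (divr_gt0 e0 (ltr0n _ 2)).
have [d' d'0 gd] := ACg _ (divr_gt0 e0 (ltr0n _ 2)).
exists (Num.min d d'); first by rewrite lt_min d0.
move=> s sD fs; rewrite lt_min => /andP[sd sd'].
rewrite (le_lt_trans (total_incrementD _ _ _))// (splitr e) ltrD ?fd//.
rewrite (_ : total_increment _ s = total_increment g s) ?gd//.
by rewrite /total_increment; apply: eq_bigr => p _; rewrite -opprD normrN.
Qed.

(** Meant for [c] the projection onto an interval, which is monotone and 1-Lipschitz: it extends a
    function given on the interval to the whole line. *)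
Lemma AC_comp D g (c : R -> R) : (forall x, D (c x)) ->
  {homo c : x y / x <= y} -> (forall x y, x <= y -> c y - c x <= y - x) ->
  AC_on D g -> AC_on setT (g \o c).
Proof.
move=> Dc c_le c1 ACg e /ACg[d d0 gd]; exists d => // s _ /andP[/allP s1 s2] sd.
pose s' := [seq (c p.1, c p.2) | p <- s].
have -> : total_increment (g \o c) s = total_increment g s'.
  by rewrite /total_increment big_map.
apply: gd.
- by move=> p /mapP[q _ ->]; split; exact: Dc.
- rewrite /itv_family all_map; apply/andP; split.
    by apply/allP => p ps /=; apply: c_le; exact: s1.
  rewrite pairwise_map; apply: sub_pairwise s2 => p q.
  by rewrite /nonoverlap/= => /orP[/c_le->//|/c_le->]; rewrite orbT.
- apply: le_lt_trans sd; rewrite /total_length big_map big_seq [leRHS]big_seq.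
  by apply: ler_sum => p ps /=; apply: c1; exact: s1.
Qed.

Lemma AC_clamp n g : 0 <= n -> AC_on `[0, n] g ->
  AC_on setT (fun x => g (Num.max 0 (Num.min x n))).
Proof.
move=> n0; apply: AC_comp => [x|x y xy|x y xy].
- by rewrite /= in_itv/= ge_max !le_max !ge_min !lexx !n0 !orbT.
- by rewrite ge_max !le_max lexx/=; apply/orP; right; rewrite le_min !ge_min xy lexx orbT.
- by move: xy; rewrite /Num.max /Num.min; do ![case: ifP => //]; rewrite ?ltNge; lra.
Qed.

Lemma AC_max0 g : AC_on `[0, +oo[ g -> AC_on setT (fun x => g (Num.max 0 x)).
Proof.
apply: AC_comp => [x|x y xy|x y xy].
- by rewrite /= in_itv/= le_max lexx.
- by rewrite ge_max !le_max lexx xy orbT.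
- by move: xy; rewrite /Num.max; do ![case: ifP => //]; rewrite ?ltNge; lra.
Qed.

Lemma AC_continuous g : AC_on setT g -> continuous g.
Proof.
move=> ACg x; apply/cvgrPdist_lt => e /ACg[d d0 gd]; near=> y.
have key a b : a <= b -> b - a < d -> `|g b - g a| < e.
  move=> ab abd; have := gd [:: (a, b)].
  by rewrite /total_increment /total_length !big_seq1 /itv_family/= ab; apply.
have yx : `|x - y| < d by near: y; exact: cvgr_dist_lt.
have [xy|/ltW yx'] := leP x y.
  by rewrite distrC; apply: key => //; rewrite -(ger0_norm (x := y - x)) ?subr_ge0// distrC.
by apply: key => //; rewrite -(ger0_norm (x := x - y))// subr_ge0.
Unshelve. all: by end_near.
Qed.

End TotalVariationAC.

(** * Densities of nondecreasing absolutely continuous functions *)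

Section Density.
Variable R : realType.
Local Notation mu := (@lebesgue_measure R).
Implicit Types (f g : R -> R).

(** Finite measure rules out unbounded intervals; openness puts points of [I] strictly on both sides
    of each of its points, so [I] misses its left end. The half-open hull is the shape on which a
    Stieltjes measure is computed. *)
Lemma open_itv_hull (I : set R) : open I -> is_interval I -> I !=set0 ->
  (mu I < +oo)%E ->
  exists a b, [/\ a < b, `]a, b[ `<=` I, I `<=` `]a, b] & mu I = (b - a)%:E].
Proof.
move=> oI itvI [x Ix]; have near_in y : I y -> exists2 e, 0 < e & I (y - e) /\ I (y + e).
  move=> Iy; have := open_nbhs_nbhs (conj oI Iy) => -[e /= e0 eI].
  by exists (e / 2); [exact: divr_gt0|split; apply: eI => /=;
    rewrite ?opprD ?opprB addrA subrr ?sub0r ?add0r ?normrN ?gtr0_norm ?divr_gt0// ?addrC ?subrK ?ltr_pdivrMr// ?ltr_pMr ?ltr1n//].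
move/is_intervalP : itvI => IE; move: (Rhull I) IE => i IE.
have [e e0 [xl xr]] := near_in x Ix.
rewrite IE lebesgue_measure_itv; rewrite IE/= in xl xr.
case: i IE xl xr => -[bl a|[]] [br b|[]] IE xl xr; rewrite /= ?ltNyy ?ltry ?ltNyr//=; last first.
  by move: xl; rewrite in_itv/= andbF.
have bnd y : y \in Interval (BSide bl a) (BSide br b) -> a <= y <= b.
  by rewrite in_itv/= => /andP[]; case: (bl); case: (br) => /= ay yb; rewrite ?(ltW ay) ?(ltW yb) ?ay ?yb.
have ab : a < b.
  by move: (bnd _ xl) (bnd _ xr) => /andP[+ _] /andP[_]; move: e0; lra.
rewrite lte_fin ab => _; exists a, b; split => //.
  move=> y; rewrite /= !in_itv/= => /andP[ay yb].
  by case: (bl); case: (br); rewrite /= ?ay ?yb ?ltW.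
move=> y yi; rewrite /= in_itv/=; have /andP[ay ->] := bnd _ yi; rewrite andbT.
rewrite lt_neqAle ay andbT; apply/eqP => ay'; rewrite -ay' in yi.
have : I a by rewrite IE.
move=> /near_in[e' e'0 []]; rewrite IE /= => /bnd/andP[+ _] _.
by move: e'0; lra.
Qed.

(** The Stieltjes measure of [g] is dominated by Lebesgue measure: a null set lies in an open set of
    small measure, whose components have small total length and hence, by absolute continuity, small
    total increment. Radon-Nikodym then gives the density. *)
Lemma nondecreasing_AC_density n g : 0 <= n ->
  {in `[0, n] &, {homo g : x y / x <= y}} -> AC_on `[0, n] g ->
  exists h : R -> R, mu.-integrable setT (EFin \o h) /\
    forall a b, 0 <= a -> a <= b -> b <= n ->
      ((g b - g a)%:E = \int[mu]_(x in `]a, b]) (h x)%:E)%E.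
Proof.
move=> n0 ndg ACg; pose c x := Num.max 0 (Num.min x n); pose G := g \o c.
have clin x : c x \in `[0, n].
  by rewrite in_itv/= /c ge_max le_max lexx ge_min lexx orbT n0.
have clid x : 0 <= x -> x <= n -> c x = x.
  by move=> x0 xn; rewrite /c (min_idPl xn) (max_idPr x0).
have ndG : nondecreasing G.
  move=> x y xy; apply: ndg => //.
  by rewrite /c ge_max !le_max lexx/=; apply/orP; right; rewrite le_min !ge_min xy lexx orbT.
have ACG : AC_on setT G := AC_clamp n0 ACg.
have cG : continuous G := AC_continuous ACG.
pose cumG : cumulative R R := HB.pack G (isCumulative.Build R _ R G ndG (right_continuousW cG)).
pose muG : {measure set (measurableTypeR R) -> \bar R} := lebesgue_stieltjes_measure cumG.
have muG_le (X Y : set (measurableTypeR R)) : measurable X -> measurable Y ->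
    X `<=` Y -> (muG X <= muG Y)%E.
  by move=> mX mY; apply: le_measure; rewrite inE.
have muGE a b : a <= b -> muG `]a, b]%classic = (G b - G a)%:E.
  move=> ab; rewrite /muG/= /lebesgue_stieltjes_measure /measure_extension.
  rewrite measurable_mu_extE/=; last exact: is_ocitv.
  by rewrite wlength_itv_bnd.
have mD : measurable (`]0, n] : set (measurableTypeR R)) by [].
have fD : (muG `]0%R, n]%classic < +oo)%E by rewrite muGE// ltry.
(* The restriction makes the measure finite, and only subintervals of []0, n]] are evaluated in the
   end. *)
pose nu : {finite_measure set (measurableTypeR R) -> \bar R} := mfrestr mD fD.
have dom : nu `<< mu.
  apply/null_content_dominatesP => A mA muA0.
  suff muGA : muG A = 0%E.
    apply/eqP; rewrite eq_le measure_ge0 andbT -[leRHS]muGA.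
    by rewrite /nu/= /mfrestr/= /mrestr le_measure ?inE//; exact: measurableI.
  apply/eqP; rewrite eq_le measure_ge0 andbT.
  apply/lee_addgt0Pr => e /ACG[d d0 Gd]; rewrite add0e.
  have [|U [oU AU UAd]] := @lebesgue_regularity_outer R A d mA _ d0.
    by rewrite muA0.
  have mU : measurable (U : set (measurableTypeR R)) by exact: measurable_realfun.open_measurable.
  have Ud : (mu U < d%:E)%E.
    rewrite -(setDUK AU) (le_lt_trans (measureU2 _ _ _))//; first exact: measurableD.
    by rewrite muA0 add0e.
  pose I := open_disjoint_itv oU.
  have mI q : measurable (I q : set (measurableTypeR R)).
    by apply: measurable_realfun.open_measurable; exact: open_disjoint_itv_open.
  apply: (@le_trans _ _ (muG U)); first exact: muG_le.
  have UE : U = \bigcup_q I q by exact: open_disjoint_itv_bigcup.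
  apply: (@le_trans _ _ (\sum_(0 <= q <oo) muG (I q))%E).
    by apply: (measure_sigma_subadditive muG mI mU); rewrite {1}UE.
  apply: lime_le; first by apply: is_cvg_nneseries => *; exact: measure_ge0.
  apply: nearW => k.
  have IU q : I q `<=` U.
    by rewrite UE; exact: bigcup_sup.
  (* Empty components get the dummy endpoints [(0, 0)]; the family [s] filters them out. *)
  have hull q : {p : R * R | I q !=set0 -> [/\ p.1 < p.2, `]p.1, p.2[ `<=` I q,
      I q `<=` `]p.1, p.2] & mu (I q) = (p.2 - p.1)%:E]}.
    apply: cid; have [Iq0|/nonemptyPn Iq0] := pselect (I q !=set0); last first.
      by exists (0, 0); rewrite Iq0 => -[].
    have [|a [b abI]] := open_itv_hull (@open_disjoint_itv_open _ _ oU q) (@open_disjoint_itv_is_interval _ _ oU q) Iq0.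
      apply: (@le_lt_trans _ _ (mu U)); last exact: lt_trans Ud (ltry _).
      by apply: le_measure; rewrite ?inE//; exact: IU.
    by exists (a, b).
  pose s := [seq sval (hull q) | q <- [seq q <- iota 0 k | `[< I q !=set0 >]]].
  have IqP q : q \in [seq q <- iota 0 k | `[< I q !=set0 >]] -> I q !=set0.
    by rewrite mem_filter => /andP[/asboolP].
  have sE : (\sum_(0 <= q < k) muG (I q) <= (total_increment G s)%:E)%E.
    rewrite /total_increment big_map -sumEFin big_filter/=.
    rewrite (bigID (fun q => `[< I q !=set0 >]))/= [X in (_ + X)%E]big1 ?adde0; last first.
      by move=> q /asboolPn /nonemptyPn ->; rewrite measure0.
    rewrite /index_iota subn0; apply: lee_sum => q /asboolP Iq0.
    case: (svalP (hull q) Iq0) => p12 _ Isub _.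
    apply: (@le_trans _ _ (muG `](sval (hull q)).1, (sval (hull q)).2]%classic)).
      exact: muG_le.
    by rewrite (muGE _ _ (ltW p12)) lee_fin ler_norm.
  apply: le_trans sE _; rewrite lee_fin ltW//; apply: Gd => //.
    apply/andP; split.
      apply/allP => _ /mapP[q /IqP Iq0 ->].
      by case: (svalP (hull q) Iq0) => /ltW.
    rewrite pairwise_map; apply/(pairwiseP 0%N) => i j ik jk ij.
    set q := nth _ _ i; set q' := nth _ _ j.
    have Iq : I q !=set0 by apply: IqP; exact: mem_nth.
    have Iq' : I q' !=set0 by apply: IqP; exact: mem_nth.
    have qq' : q != q'.
      by rewrite nth_uniq ?filter_uniq ?iota_uniq// ltn_eqF.
    rewrite /= /nonoverlap.
    case: (svalP (hull q) Iq) => p12 pI _ _; case: (svalP (hull q') Iq') => r12 rI _ _.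
    move: (sval _) (sval _) p12 r12 pI rI => -[a b] [a' b']/= ab ab' pI rI.
    rewrite -[_ || _]negbK negb_or -!ltNge; apply/negP => /andP[ab1 ab2].
    (* If two hulls overlapped, the midpoint of the overlap would lie in two disjoint components. *)
    pose l := Num.max a a'; pose r := Num.min b b'.
    have lr : l < r by rewrite /l /r gt_max !lt_min ab ab1 ab2 ab'.
    have m : l < (l + r) / 2 < r by move: lr; lra.
    have : (I q `&` I q') ((l + r) / 2).
      move: m; rewrite /l /r gt_max lt_min => /andP[/andP[m1 m2] /andP[m3 m4]].
      by split; [apply: pI|apply: rI]; rewrite /= in_itv/= ?m1 ?m2.
    have /trivIsetP/(_ q q' Logic.I Logic.I qq') := @open_disjoint_itv_trivIset _ _ oU.
    by rewrite -/I => ->.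
  rewrite -lte_fin; apply: le_lt_trans Ud.
  rewrite /total_length big_map -sumEFin big_filter/=.
  apply: (@le_trans _ _ (\sum_(0 <= q < k) mu (I q))%E).
    rewrite /index_iota subn0 [leRHS](bigID (fun q => `[< I q !=set0 >]))/=.
    rewrite -[leLHS]adde0; apply: leeD; last by apply: sume_ge0.
    by apply: lee_sum => q /asboolP Iq0; case: (svalP (hull q) Iq0) => _ _ _ <-.
  rewrite big_mkord -(measure_bigsetU mu); [|by []|exact: open_disjoint_itv_trivIset].
  rewrite le_measure ?inE//; first exact: bigsetU_measurable.
  by rewrite -bigcup_mkord; apply: bigcup_sub => q _; exact: IU.
have [h [h0 hfin hint hE]] := radon_nikodym_sigma_finite dom.
exists (fine \o h); split.
  by apply: eq_integrable hint => // x _; rewrite /= fineK.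
move=> a b a0 ab bn.
under eq_integral do rewrite /= fineK//.
rewrite -hE// /nu/= /mfrestr/= /mrestr (_ : _ `&` _ = `]a, b]%classic).
  by rewrite muGE// /G/= !clid// ?(le_trans a0)// ?(le_trans ab)//.
apply/seteqP; split => x /=; rewrite !in_itv/=; first by case.
by move=> /andP[ax xb]; rewrite ax xb (le_lt_trans a0 ax) (le_trans xb bn).
Qed.

End Density.

Section RplusDerivative.
Variable R : realType.
Local Notation mu := (@lebesgue_measure R).
Implicit Types (f x : R -> R^o) (u : R).

Lemma right_sub_Rplus_nbhs u : 0 <= u -> Rplus_nbhs u `<=` u^'+.
Proof.
move=> u0 P uP; change (\forall v \near nbhs u, u < v -> P v).
have {uP} : \forall v \near nbhs u, v != u -> 0 <= v -> P v by exact: uP.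
apply: filterS => v vP uv; apply: vP; first by rewrite gt_eqF.
exact: le_trans u0 (ltW uv).
Qed.

Lemma Rplus_nbhs_proper u : 0 <= u -> ProperFilter (Rplus_nbhs u).
Proof.
move=> u0; apply: Build_ProperFilter_ex => P /(right_sub_Rplus_nbhs u0).
exact: filter_ex.
Qed.

Lemma Rplus_nbhs_gt0 u : 0 < u -> Rplus_nbhs u = u^'.
Proof.
move=> u0; apply/seteqP; split=> P uP.
  change (\forall v \near nbhs u, v != u -> P v).
  have {uP} : \forall v \near nbhs u, v != u -> 0 <= v -> P v by exact: uP.
  by apply: filterS2 (lt_nbhsr u0) => v v0 + vu; apply => //; exact: ltW.
change (\forall v \near nbhs u, v != u -> 0 <= v -> P v).
have {uP} : \forall v \near nbhs u, v != u -> P v by exact: uP.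
by apply: filterS => v + vu _; apply.
Qed.

Lemma Rplus_D_cvg x u (l : R) : 0 <= u ->
  Rplus_quotient x u v @[v --> Rplus_nbhs u] --> l ->
  Rplus_derivable x u /\ Rplus_D x u = l.
Proof.
move=> u0 xl; have ? := Rplus_nbhs_proper u0.
by split; [apply/cvg_ex; exists l|exact/cvg_lim].
Qed.

Lemma dnbhs_shift (a b : R) : (fun v => v + (b - a)) @ a^' --> b^'.
Proof.
move=> P [e /= e0 eP]; exists e => //= y /= ay ya; apply: eP => /=.
  by have -> : b - (y + (b - a)) = a - y by ring.
rewrite -subr_eq0; have -> : y + (b - a) - b = y - a by ring.
by rewrite subr_eq0.
Qed.

Lemma Rplus_quotient_cvgP x u (l : R) : 0 < u ->
  Rplus_quotient x u v @[v --> Rplus_nbhs u] --> l <-> is_derive u 1 (x : R -> R) l.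
Proof.
move=> u0; rewrite Rplus_nbhs_gt0//.
have E v : Rplus_quotient x u v =
    (v - u)^-1 *: ((x \o shift u) ((v - u) *: 1) - x u).
  by rewrite /Rplus_quotient /= [_%:A]mulr1 subrK mulrC.
split=> [xl|[dx <-]].
  have xl' : h^-1 *: ((x \o shift u) (h *: 1) - x u) @[h --> 0^'] --> (l : R^o).
    have := cvg_comp _ _ (@dnbhs_shift 0 u) xl.
    apply: cvg_trans; apply: near_eq_cvg; near=> h => /=.
    by rewrite E subr0 addrK.
  by split; [apply/cvg_ex; exists l|exact/cvg_lim].
have := cvg_comp _ _ (@dnbhs_shift u 0) dx.
apply: cvg_trans; apply: near_eq_cvg; near=> h => /=.
by rewrite E sub0r.
Unshelve. all: by end_near.
Qed.

(** Presents the derivative as the limit of a sequence, for measurability in [u]. Steps to the right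
    stay in R_+ even at [u = 0]. *)
Lemma lim_right_quotient x u l : 0 <= u ->
  Rplus_quotient x u v @[v --> Rplus_nbhs u] --> (l : R) ->
  (x (u + n.+1%:R^-1) - x u) * n.+1%:R @[n --> \oo] --> l.
Proof.
move=> u0 xl; have {}xl : Rplus_quotient x u v @[v --> u^'+] --> l.
  apply: cvg_trans xl => P; exact: right_sub_Rplus_nbhs.
have /cvg_at_rightP := xl.
move=> /(_ (fun n => u + n.+1%:R^-1)) H.
have {H} : Rplus_quotient x u (u + n.+1%:R^-1) @[n --> \oo] --> l.
  apply: H; split => [n|]; first by rewrite ltrDl invr_gt0.
  by rewrite -[X in _ --> X]addr0; apply: cvgD; [exact: cvg_cst|exact: cvg_harmonic].
apply: cvg_trans; apply: near_eq_cvg; near=> n.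
by rewrite /Rplus_quotient addrAC subrr add0r invrK.
Unshelve. all: by end_near.
Qed.

End RplusDerivative.

(** * Fundamental theorem of calculus on R_+ *)

Section AbsolutelyContinuousFTC.
Variable R : realType.
Local Notation mu := (@lebesgue_measure R).
Implicit Types (f : R -> R^o) (u : R).

Lemma integrable_itv (i : interval R) (h : R -> \bar R) :
  mu.-integrable setT h -> mu.-integrable [set` i] h.
Proof. by move=> ih; apply: integrableS ih. Qed.

(** Jordan decomposition: the variation function [V] and [V - f] are both nondecreasing and
    absolutely continuous, and [f] is their difference. *)
Lemma AC_density f (n : R) : 0 <= n -> Rplus_AC f ->
  exists h : R -> R, mu.-integrable setT (EFin \o h) /\
    forall a b, 0 <= a -> a <= b -> b <= n ->
      ((f b - f a)%:E = \int[mu]_(x in `]a, b]) (h x)%:E)%E.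
Proof.
move=> n0 /Rplus_AC_on ACf; pose V x := fine (total_variation 0 x f).
have itvD : is_interval (`[0, +oo[%classic : set R) by move=> x y; exact: interval_is_interval.
have D0 : `[0%R, +oo[%classic (0 : R) by rewrite /= in_itv/= lexx.
have in0 x : x \in `[0, n] -> 0 <= x by rewrite in_itv/= => /andP[].
have inD x : x \in `[0, n] -> `[0%R, +oo[%classic x by rewrite /= !in_itv/= andbT => /in0.
have sub : `[0, n]%classic `<=` `[0%R, +oo[%classic `&` `[0%R, +oo[%classic.
  by move=> x xn; split; exact: inD.
have ACV : AC_on `[0, n] V := AC_onW sub (AC_on_total_variation itvD ACf D0).
have ACVf : AC_on `[0, n] (fun x => V x - f x).
  by apply: AC_onB => //; apply: AC_onW ACf => x /inD.
have VE x y : x \in `[0, n] -> y \in `[0, n] -> x <= y ->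
    V y - V x = fine (total_variation x y f).
  move=> xn yn xy; rewrite /V (total_variationD f (in0 _ xn) xy).
  have fin1 := AC_total_variation_fin itvD ACf D0 (inD _ xn) (in0 _ xn).
  have fin2 := AC_total_variation_fin itvD ACf (inD _ xn) (inD _ yn) xy.
  by rewrite fineD// addrC addKr.
have ndV : {in `[0, n] &, {homo V : x y / x <= y}}.
  by move=> x y xn yn xy; rewrite -subr_ge0 VE// fine_ge0// total_variation_ge0.
have ndVf : {in `[0, n] &, {homo (fun x => V x - f x) : x y / x <= y}}.
  move=> x y xn yn xy; rewrite -subr_ge0.
  have -> : V y - f y - (V x - f x) = V y - V x - (f y - f x) by ring.
  rewrite VE// subr_ge0 (le_trans (ler_norm _))// -lee_fin.
  have finxy := AC_total_variation_fin itvD ACf (inD _ xn) (inD _ yn) xy.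
  by rewrite fineK// total_variation_ge.
have [h1 [ih1 h1E]] := nondecreasing_AC_density n0 ndV ACV.
have [h2 [ih2 h2E]] := nondecreasing_AC_density n0 ndVf ACVf.
exists (fun x => h1 x - h2 x); split.
  have -> : EFin \o (fun x => h1 x - h2 x) = ((EFin \o h1) \- (EFin \o h2))%E by [].
  exact: integrableB.
move=> a b a0 ab bn.
have -> : f b - f a = (V b - V a) - ((V b - f b) - (V a - f a)) by ring.
rewrite EFinB h1E// h2E//.
under [RHS]eq_integral do rewrite EFinB.
have i1 := integrable_itv `]a, b] ih1.
have i2 := integrable_itv `]a, b] ih2.
by apply/esym; apply: integralB i1 i2.
Qed.

Lemma AC_density_derive f (h : R -> R) (n : R) : 0 < n ->
  mu.-integrable setT (EFin \o h) ->
  (forall a b, 0 <= a -> a <= b -> b <= n ->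
      ((f b - f a)%:E = \int[mu]_(x in `]a, b]) (h x)%:E)%E) ->
  {ae mu, forall u, 0 < u < n ->
    Rplus_quotient f u v @[v --> Rplus_nbhs u] --> h u}.
Proof.
move=> n0 ih hE.
have loch : locally_integrable [set: R] h.
  by have := integrable_locally measurableT ih; rewrite patch_setT.
have ihx y : mu.-integrable `]-oo, y] (EFin \o h).
  exact: integrable_itv.
apply: aeS (FTC1Ny ihx loch) => u /= [dF Fu] /andP[u0 un].
set F := fun x : R => _ in dF Fu.
apply/(Rplus_quotient_cvgP _ _ u0).
(* Lebesgue differentiation applies to the primitive [F] of [h] on the whole line; on [[0, n]] it
   differs from [f] by a constant. *)
have FE v : 0 <= v <= n -> F v = f v + (F 0 - f 0).
  move=> /andP[v0 vn].
  suff -> : F v = F 0 + (f v - f 0) by ring.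
  rewrite -[F v](subrK (F 0)) addrC; congr (_ + _).
  rewrite /F Rintegral_itvB ?bnd_simp//.
  by rewrite /Rintegral -hE.
have Fd : is_derive u 1 F (h u) by rewrite -Fu derive1E; exact/derivableP.
have : is_derive u 1 (fun v => F v - (F 0 - f 0)) (h u).
  rewrite -[h u]subr0; apply: is_deriveB.
apply: near_eq_is_derive; near=> v.
have /FE -> : 0 <= v <= n.
  by apply/andP; split; apply: ltW; near: v; [exact: lt_nbhsr|exact: lt_nbhsl].
by rewrite addrK.
Unshelve. all: by end_near.
Qed.

(** The densities on the intervals [[0, n]] are unrelated functions. They are glued by taking for
    [h] the upper limit of difference quotients, which is measurable by construction and equals the
    derivative wherever that exists, hence each density almost everywhere. *)
Theorem Rplus_AC_FTC f : Rplus_AC f -> exists h : R -> R,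
  [/\ measurable_fun (setT : set (measurableTypeR R)) h,
      (forall a b, 0 <= a -> a <= b -> mu.-integrable `[a, b] (EFin \o h) /\
        ((f b - f a)%:E = \int[mu]_(x in `[a, b]) (h x)%:E)%E)
    & {ae mu, forall u, 0 <= u ->
        Rplus_quotient f u v @[v --> Rplus_nbhs u] --> h u}].
Proof.
move=> ACf; pose g x : R := f (Num.max 0 x).
(* Freezing [f] at its value at 0 on the negative half-line makes all the quotients [q m] measurable
   on R. *)
have cg : continuous g := AC_continuous (AC_max0 (Rplus_AC_on ACf)).
pose q m u : R := (g (u + m.+1%:R^-1) - g u) * m.+1%:R.
pose h u := fine (limn_esup (fun m => (q m u)%:E)).
have mh : measurable_fun (setT : set (measurableTypeR R)) h.
  rewrite /h; apply: (measurableT_comp (fine_measurable measurableT)); apply: measurable_fun_limn_esup => m.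
  apply/measurable_EFinP/measurable_funM => //; apply: measurable_funB.
    apply: (measurableT_comp (continuous_measurable_fun cg)).
    exact: measurable_funD.
  exact: continuous_measurable_fun.
have hP u (l : R) : 0 <= u -> Rplus_quotient f u v @[v --> Rplus_nbhs u] --> l ->
    h u = l.
  move=> u0 /(lim_right_quotient u0) fl.
  have ql : (q m u)%:E @[m --> \oo] --> l%:E.
    apply/cvg_EFin; first exact: nearW.
    apply: cvg_trans fl; apply: near_eq_cvg; near=> m => /=.
    by rewrite /q /g !max_r// addr_ge0.
  by rewrite /h; have [_ ->] := cvg_limn_einf_sup ql.
have /choice[k kP] : forall n : nat, exists k : R -> R,
    mu.-integrable setT (EFin \o k) /\
    forall a b, 0 <= a -> a <= b -> b <= n%:R ->
      ((f b - f a)%:E = \int[mu]_(x in `]a, b]) (k x)%:E)%E.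
  by move=> n; exact: AC_density.
have aek : {ae mu, forall u n, 0 < u < n.+1%:R ->
    Rplus_quotient f u v @[v --> Rplus_nbhs u] --> k n.+1 u}.
  apply: ae_foralln => n; have [k1 k2] := kP n.+1.
  exact: AC_density_derive k2.
have ae0 : {ae mu, forall u : R, u != 0}.
  exists [set 0]; split => //; first exact: lebesgue_measure_set1.
  by move=> u /= /negP; rewrite negbK => /eqP.
have cvgh : {ae mu, forall u, 0 <= u ->
        Rplus_quotient f u v @[v --> Rplus_nbhs u] --> h u}.
  apply: aeS2 aek ae0 => u uk u0 u0'.
  (* The density used at [u] is that of the first integer interval that contains [u] in its
     interior; [u = 0] is discarded as a null set. *)
  have un : 0 < u < (Num.truncn u).+1%:R by rewrite lt_neqAle eq_sym u0 u0' truncnS_gt.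
  have := uk _ un; by move=> /[dup] /(hP _ _ u0') ->.
exists h; split => // a b a0 ab.
pose n := Num.truncn b.
have [k1 k2] := kP n.+1.
have bn : b < n.+1%:R by exact: truncnS_gt.
have aehk : {ae mu, forall u, `]a, b]%classic u -> (h u)%:E = (k n.+1 u)%:E}.
  apply: aeS aek => u uk; rewrite /= in_itv/= => /andP[au ub].
  have u0 := le_lt_trans a0 au.
  by congr EFin; apply: hP; rewrite ?ltW//; apply: uk; rewrite u0 (le_lt_trans ub).
have mhE (D : set (measurableTypeR R)) : measurable_fun D (EFin \o h).
  by apply: (@measurable_funTS _ _ _ _ _ (EFin \o h)); exact/measurable_EFinP.
have ih : mu.-integrable `]a, b] (EFin \o h).
  apply/integrableP; split => //.
  have /integrableP[mk kfin] := integrable_itv `]a, b] k1.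
  apply: le_lt_trans kfin; rewrite le_eqVlt; apply/orP; left; apply/eqP.
  apply: ae_eq_integral => //; [exact: measurableT_comp|exact: measurableT_comp|].
  by apply: aeS aehk => u uhk /uhk [/= ->].
have ih' : mu.-integrable `[a, b] (EFin \o h).
  apply/integrableP; split => //.
  have /integrableP[_] := ih.
  rewrite (integral_itv_obnd_cbnd (f := fun x => `|(EFin \o h) x|%E))//.
  by apply: measurableT_comp => //; exact: mhE.
split => //.
rewrite -integral_itv_obnd_cbnd//; last by have /integrableP[] := ih.
rewrite (k2 _ _ a0 ab (ltW bn)); apply/esym/ae_eq_integral => //.
by have /integrableP[] := integrable_itv `]a, b] k1.
Unshelve. all: by end_near.
Qed.

End AbsolutelyContinuousFTC.

(** * Integral inequalities without measurability, weighted Cauchy-Schwarz *)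

Section LowerIntegral.
Context d (T : measurableType d) (R : realType).
Variable m : {measure set T -> \bar R}.
Implicit Types (D : set T) (f g : T -> \bar R).

Import HBNNSimple.

(* No measurability: the integral of a nonnegative function is the supremum
   of the integrals of the simple functions below it. *)
Lemma ge0_le_integral_ae D f g :
  (forall x, D x -> (0 <= f x)%E) -> (forall x, D x -> (0 <= g x)%E) ->
  {ae m, forall x, D x -> (f x <= g x)%E} ->
  (\int[m]_(x in D) f x <= \int[m]_(x in D) g x)%E.
Proof.
move=> f0 g0 [N [mN N0 fgN]].
rewrite !ge0_integralE//; apply: ge_ereal_sup => _ [h /= hf <-].
have mNC : measurable (~` N) by exact: measurableC.
(* The simple function is set to zero on the exceptional set: its integral is unchanged and it now
   lies below [g] everywhere. *)
pose h' : {nnsfun T >-> R} := proj_nnsfun h mNC.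
apply: ereal_sup_ubound; exists h' => /=.
  move=> x; rewrite /mindic indicE.
  have [xN|xN] := boolP (x \in ~` N); rewrite ?mulr1 ?mulr0.
    apply: le_trans (hf x) _; rewrite /patch; case: ifPn => // xD.
    by move: xN; rewrite inE => xN; apply: contra_notP xN => fg; apply: fgN => /(_ (set_mem xD)).
  by apply: erestrict_ge0.
rewrite -!integralT_nnsfun; apply: ge0_ae_eq_integral => //.
- exact/measurable_EFinP.
- exact/measurable_EFinP.
- by move=> x _; rewrite lee_fin.
- by move=> x _; rewrite lee_fin.
exists N; split => // x /= xN; apply: contra_notP xN => Nx _.
by rewrite /mindic indicE mem_set// mulr1.
Qed.

Lemma ge0_le_integral_lower D f g : (forall x, D x -> (0 <= f x)%E) ->
  (forall x, D x -> (f x <= g x)%E) ->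
  (\int[m]_(x in D) f x <= \int[m]_(x in D) g x)%E.
Proof.
move=> f0 fg; apply: ge0_le_integral_ae => //.
- by move=> x Dx; exact: le_trans (f0 x Dx) (fg x Dx).
- by exists set0; split => // x /= /not_implyP[/fg].
Qed.

Lemma ge0_eq_integral_ae D f g :
  (forall x, D x -> (0 <= f x)%E) -> (forall x, D x -> (0 <= g x)%E) ->
  {ae m, forall x, D x -> f x = g x} ->
  (\int[m]_(x in D) f x = \int[m]_(x in D) g x)%E.
Proof.
move=> f0 g0 fg; apply/eqP; rewrite eq_le.
by apply/andP; split; apply: ge0_le_integral_ae => //; apply: aeS fg => x fg /fg ->.
Qed.

Lemma measurable_fun_inv D (w : T -> R) : measurable_fun D w ->
  (forall x, D x -> 0 <= w x) -> measurable_fun D (fun x => (w x)^-1).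
Proof.
move=> mw w0; apply: (eq_measurable_fun (fun x => w x `^ (-1))).
  by move=> x /set_mem /w0; exact: powR_inv1.
exact: (measurableT_comp (measurable_powR (-1))).
Qed.

(* AM-GM: [2 |h p| <= l h^2 w + p^2 / (l w)], optimised over [l > 0]. *)
Lemma sqr_le_of_amgm (a E K : R) : 0 <= a -> 0 <= E -> 0 <= K ->
  (forall l, 0 < l -> 2 * a <= l * E + l^-1 * K) -> a ^+ 2 <= E * K.
Proof.
move=> a0 E0 K0 H.
have {}H l : 0 < l -> 2 * (l * a) <= l ^+ 2 * E + K.
  move=> l0; have -> : 2 * (l * a) = l * (2 * a) by ring.
  have -> : l ^+ 2 * E + K = l * (l * E + l^-1 * K) by field; rewrite gt_eqF.
  by rewrite ler_pM2l// H.
have [E1|E1] := eqVneq E 0.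
  have [->|a1] := eqVneq a 0; first by rewrite expr0n/= mulr_ge0.
  have a2 : 0 < a by rewrite lt_neqAle eq_sym a1.
  have l0 : 0 < (K + 1) / a by rewrite divr_gt0// ltr_pwDr.
  have := H _ l0; rewrite E1 mulr0 add0r divfK//.
  by move: K0; lra.
have E2 : 0 < E by rewrite lt_neqAle eq_sym E1.
have [->|a1] := eqVneq a 0; first by rewrite expr0n/= mulr_ge0.
have a2 : 0 < a by rewrite lt_neqAle eq_sym a1.
have l0 : 0 < a / E by rewrite divr_gt0.
have := H _ l0.
have -> : 2 * (a / E * a) = 2 * (a ^+ 2 / E) by field.
have -> : (a / E) ^+ 2 * E = a ^+ 2 / E by field.
have -> : E * K = K * E by rewrite mulrC.
rewrite -ler_pdivrMr//; lra.
Qed.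

Lemma cauchy_schwarz_weight D (h p w : T -> R) : measurable D ->
  measurable_fun D h -> measurable_fun D p -> measurable_fun D w ->
  (forall x, D x -> 0 < w x) ->
  (\int[m]_(x in D) (h x ^+ 2 * w x)%:E < +oo)%E ->
  (\int[m]_(x in D) (p x ^+ 2 / w x)%:E < +oo)%E ->
  (\int[m]_(x in D) (`|h x * p x|)%:E < +oo)%E /\
  (fine (\int[m]_(x in D) (`|h x * p x|)%:E)) ^+ 2 <=
    fine (\int[m]_(x in D) (h x ^+ 2 * w x)%:E) *
    fine (\int[m]_(x in D) (p x ^+ 2 / w x)%:E).
Proof.
move=> mD mh mp mw w0.
set E := (\int[m]_(x in D) (h x ^+ 2 * w x)%:E)%E.
set K := (\int[m]_(x in D) (p x ^+ 2 / w x)%:E)%E.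
set A := (\int[m]_(x in D) (`|h x * p x|)%:E)%E.
move=> Efin Kfin.
have E0 x : D x -> 0 <= h x ^+ 2 * w x by move=> Dx; rewrite mulr_ge0 ?sqr_ge0// ltW// w0.
have K0 x : D x -> 0 <= p x ^+ 2 / w x by move=> Dx; rewrite divr_ge0 ?sqr_ge0// ltW// w0.
have mE : measurable_fun D (fun x => (h x ^+ 2 * w x)%:E).
  by apply/measurable_EFinP/measurable_funM => //; exact: measurable_funX.
have mK : measurable_fun D (fun x => (p x ^+ 2 / w x)%:E).
  apply/measurable_EFinP/measurable_funM => //; first exact: measurable_funX.
  by apply: measurable_fun_inv => // x /w0 /ltW.
have mA : measurable_fun D (fun x => (`|h x * p x|)%:E).
  by apply/measurable_EFinP/measurableT_comp => //; exact: measurable_funM.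
have A0 : (0 <= A)%E by exact: integral_ge0.
have Ege0 : (0 <= E)%E by apply: integral_ge0 => x /E0; rewrite lee_fin.
have Kge0 : (0 <= K)%E by apply: integral_ge0 => x /K0; rewrite lee_fin.
have bound l : 0 < l -> (2%:E * A <= l%:E * E + (l^-1)%:E * K)%E.
  move=> l0; have l1 : 0 <= l^-1 by rewrite invr_ge0 ltW.
  rewrite /A /E /K -!ge0_integralZl_EFin ?(ltW l0)// -ge0_integralD//; last 4 first.
  - by move=> x /E0 ?; rewrite lee_fin mulr_ge0// ltW.
  - exact: measurable_funeM.
  - by move=> x /K0 ?; rewrite lee_fin mulr_ge0.
  - exact: measurable_funeM.
  apply: ge0_le_integral => //.
  - exact: measurable_funeM.
  - by apply: emeasurable_funD; exact: measurable_funeM.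
  move=> x Dx; rewrite -!EFinM -EFinD lee_fin.
  have wx := w0 x Dx; have lw : 0 < l * w x by rewrite mulr_gt0.
  have -> : l * (h x ^+ 2 * w x) + l^-1 * (p x ^+ 2 / w x) =
            (l * w x) * `|h x| ^+ 2 + (l * w x)^-1 * `|p x| ^+ 2.
    by rewrite !real_normK ?num_real//; field; rewrite !gt_eqF.
  rewrite normrM; move: (l * w x) lw `|h x| `|p x| => k k0 a b.
  rewrite -subr_ge0; have -> : k * a ^+ 2 + k^-1 * b ^+ 2 - 2 * (a * b) =
    (k * a - b) ^+ 2 / k by field; rewrite gt_eqF.
  by rewrite divr_ge0 ?sqr_ge0// ltW.
have Efn : E \is a fin_num by rewrite ge0_fin_numE.
have Kfn : K \is a fin_num by rewrite ge0_fin_numE.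
(* Finiteness of the left-hand side is the bound with [l = 1]; only then can [bound] be read among
   reals and optimised over [l]. *)
have Afin : (A < +oo)%E.
  rewrite ltey; apply/eqP => Ay; have := bound 1 ltr01.
  by rewrite invr1 Ay gt0_muley ?lte_fin// !mul1e leye_eq -(fineK Efn) -(fineK Kfn).
have Afn : A \is a fin_num by rewrite ge0_fin_numE.
split => //; apply: sqr_le_of_amgm; rewrite ?fine_ge0// => l /bound.
by rewrite -(fineK Afn) -(fineK Efn) -(fineK Kfn) -!EFinM -EFinD lee_fin.
Qed.

End LowerIntegral.

Section Triangle.
Variable R : realType.
Local Notation mu := (@lebesgue_measure R).

Lemma measurable_le_graph : measurable
  [set z : measurableTypeR R * measurableTypeR R | (z.1 : R) <= (z.2 : R)].
Proof.
have mf : measurable_fun setT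
    (fun z : measurableTypeR R * measurableTypeR R => (z.1 : R) <= (z.2 : R)).
  by apply: measurable_fun_ler; [exact: measurable_fst|exact: measurable_snd].
have := mf measurableT [set true] Logic.I.
by rewrite setTI preimage_true.
Qed.

(** Tonelli for the indicator of the region [u <= r], with [a] and [b] extended by zero so that the
    integrand is measurable on the whole plane. *)
Lemma tonelli_triangle (a b : R -> R) :
  measurable_fun (`[0, +oo[ : set (measurableTypeR R)) a ->
  measurable_fun (`[0, +oo[ : set (measurableTypeR R)) b ->
  (forall u, 0 <= u -> 0 <= a u) -> (forall u, 0 <= u -> 0 <= b u) ->
  (\int[mu]_(u in `[0%R, +oo[) \int[mu]_(r in `[u, +oo[) (a u * b r)%:E =
   \int[mu]_(r in `[0%R, +oo[) \int[mu]_(u in `[0%R, r]) (a u * b r)%:E)%E.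
Proof.
move=> ma mb a0 b0.
pose A := a \_ `[0, +oo[; pose B := b \_ `[0, +oo[.
have AE u : A u = if 0 <= u then a u else 0.
  by rewrite /A patchE mem_setE in_itv/= andbT.
have BE u : B u = if 0 <= u then b u else 0.
  by rewrite /B patchE mem_setE in_itv/= andbT.
pose S := [set z : measurableTypeR R * measurableTypeR R | (z.1 : R) <= (z.2 : R)].
pose f (z : measurableTypeR R * measurableTypeR R) : \bar R :=
  (A z.1 * B z.2 * \1_S z)%:E.
have fE u r : f (u, r) = (if (0 <= u) && (u <= r) then a u * b r else 0)%:E.
  rewrite /f /= AE BE indicE; congr EFin.
  have -> : ((u, r) \in S) = (u <= r) by apply/idP/idP => [/set_mem//|]; rewrite inE.
  have [u0|u0] := leP 0 u; last by rewrite !mul0r.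
  have [ur|ur] := leP u r; last by rewrite mulr0.
  by rewrite (le_trans u0 ur) mulr1.
have f0 z : (0 <= f z)%E.
  case: z => u r; rewrite fE lee_fin; case: ifP => // /andP[u0 ur].
  by rewrite mulr_ge0 ?a0 ?b0// (le_trans u0 ur).
have mA : measurable_fun (setT : set (measurableTypeR R)) A.
  exact/(measurable_restrictT _ _).1.
have mB : measurable_fun (setT : set (measurableTypeR R)) B.
  exact/(measurable_restrictT _ _).1.
have mf : measurable_fun setT f.
  apply/measurable_EFinP; apply: measurable_funM; last first.
    exact: measurable_indic measurable_le_graph.
  apply: measurable_funM.
    by apply: measurableT_comp mA _; exact: measurable_fst.
  by apply: measurableT_comp mB _; exact: measurable_snd.
have fub := fubini_tonelli (m1 := mu) (m2 := mu) f mf f0.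
rewrite integral_mkcond [RHS]integral_mkcond.
transitivity (\int[mu]_u \int[mu]_r f (u, r))%E.
  apply: eq_integral => u _; rewrite patchE mem_setE in_itv/= andbT; case: ifPn => u0.
    rewrite integral_mkcond; apply: eq_integral => r _.
    by rewrite patchE mem_setE in_itv/= andbT fE u0/=; case: ifP.
  by apply/esym/integral0_eq => r _; rewrite fE (negbTE u0).
rewrite fub; apply: eq_integral => r _; rewrite patchE mem_setE in_itv/= andbT; case: ifPn => r0.
  rewrite [RHS]integral_mkcond; apply: eq_integral => u _.
  by rewrite patchE mem_setE in_itv/= fE; case: ifP.
apply: integral0_eq => u _; rewrite fE; case: ifP => // /andP[u0 ur].
by rewrite (le_trans u0 ur) in r0.
Qed.

End Triangle.

(** * The spaces F^1_v and F^2_w *)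

Section RplusFunctions.
Variable R : realType.
Local Notation mu := (@lebesgue_measure R).
Implicit Types (x y f g : R -> R^o) (u : R) (h : R -> R).

Lemma lin_funE f g (a v : R) : (a *: f + g) v = a * f v + g v.
Proof. by []. Qed.

(** A substitute [h] for [Rplus_D f] that is measurable, and whose linear combinations are again of
    this kind. *)
Definition Rplus_density f h :=
  [/\ measurable_fun (setT : set (measurableTypeR R)) h,
      (forall a b, 0 <= a -> a <= b -> mu.-integrable `[a, b] (EFin \o h) /\
        ((f b - f a)%:E = \int[mu]_(x in `[a, b]) (h x)%:E)%E)
    & {ae mu, forall u, 0 <= u ->
        Rplus_quotient f u v @[v --> Rplus_nbhs u] --> h u}].

Lemma Rplus_near_eq u f g : {in `[0, +oo[, f =1 g} -> 0 <= u ->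
  \forall v \near Rplus_nbhs u, Rplus_quotient f u v = Rplus_quotient g u v.
Proof.
move=> fg u0; rewrite /Rplus_nbhs; apply: filterS (withinT _ (dnbhs_filter u)) => v v0.
by rewrite /Rplus_quotient !fg// in_itv/= ?u0 ?andbT.
Qed.

Lemma Rplus_cvg_eq u f g (l : R) : {in `[0, +oo[, f =1 g} -> 0 <= u ->
  Rplus_quotient f u v @[v --> Rplus_nbhs u] --> l ->
  Rplus_quotient g u v @[v --> Rplus_nbhs u] --> l.
Proof.
move=> fg u0; apply: cvg_trans; apply: near_eq_cvg.
by have := Rplus_near_eq fg u0.
Qed.

Lemma Rplus_cvg_lin u f g (a l k : R) : 0 <= u ->
  Rplus_quotient f u v @[v --> Rplus_nbhs u] --> l ->
  Rplus_quotient g u v @[v --> Rplus_nbhs u] --> k ->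
  Rplus_quotient (a *: f + g) u v @[v --> Rplus_nbhs u] --> a * l + k.
Proof.
move=> u0 fl gk.
have -> : Rplus_quotient (a *: f + g) u =
    (fun v => a * Rplus_quotient f u v + Rplus_quotient g u v).
  by apply/funext => v; rewrite /Rplus_quotient !lin_funE; ring.
by apply: cvgD gk; apply: cvgMr.
Qed.

Lemma Rplus_AC_lin f g (a : R) : Rplus_AC f -> Rplus_AC g -> Rplus_AC (a *: f + g).
Proof.
move=> ACf ACg e e0.
have a0 : 0 < `|a| + 1 by rewrite ltr_wpDl.
have [d d0 fd] := ACf (e / 2 / (`|a| + 1)) (divr_gt0 (divr_gt0 e0 (ltr0n _ 2)) a0).
have [d' d'0 gd] := ACg (e / 2) (divr_gt0 e0 (ltr0n _ 2)).
exists (Num.min d d'); first by rewrite lt_min d0.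
move=> n p q pq ov; rewrite lt_min => /andP[sd sd'].
have {}fd := fd n p q pq ov sd; have {}gd := gd n p q pq ov sd'.
apply: (@le_lt_trans _ _ (\sum_(i < n) ((`|a| + 1) * `|f (q i) - f (p i)| + `|g (q i) - g (p i)|))).
  apply: ler_sum => i _.
  have -> : (a *: f + g) (q i) - (a *: f + g) (p i) = a * (f (q i) - f (p i)) + (g (q i) - g (p i)).
    by rewrite !lin_funE; ring.
  rewrite (le_trans (ler_normD _ _))// lerD2r normrM ler_wpM2r//.
  by rewrite lerDl.
rewrite big_split/= -mulr_sumr (splitr e) ltrD//.
by rewrite mulrC -ltr_pdivlMr.
Qed.

Lemma Rplus_AC_eq f g : {in `[0, +oo[, f =1 g} -> Rplus_AC f -> Rplus_AC g.
Proof.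
move=> fg ACf e /ACf[d d0 fd]; exists d => // n p q pq ov sd.
apply: le_lt_trans (fd n p q pq ov sd).
apply: ler_sum => i _; have /andP[p0 pqi] := pq i.
by rewrite !fg// in_itv/= andbT// (le_trans p0 pqi).
Qed.

(** Equality almost everywhere suffices although [Rplus_D] is not known to be measurable, because
    both integrands are nonnegative. *)
Lemma wenergyE k w x h : (forall u, 0 <= u -> 0 <= w u) ->
  {ae mu, forall u, 0 <= u ->
        Rplus_quotient (iter k (@Rplus_D R) x) u v @[v --> Rplus_nbhs u] --> h u} ->
  wenergy k.+1 w x = (\int[mu]_(u in `[0%R, +oo[) (h u ^+ 2 * w u)%:E)%E.
Proof.
move=> w0 xh; apply: ge0_eq_integral_ae.
- by move=> u; rewrite /= in_itv/= andbT => u0; rewrite lee_fin mulr_ge0 ?sqr_ge0 ?w0.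
- by move=> u; rewrite /= in_itv/= andbT => u0; rewrite lee_fin mulr_ge0 ?sqr_ge0 ?w0.
apply: aeS xh => u xh; rewrite /= in_itv/= andbT => u0.
by have [_ ->] := Rplus_D_cvg u0 (xh u0).
Qed.

(** Since [f] vanishes at infinity, [f u] is up to sign the integral of [h] over [[u, +oo[].
    Stopping at a point [b] where [f] is below [e] avoids asking [h] to be integrable there. *)
Lemma density_tail f h u : Rplus_density f h -> f b @[b --> +oo] --> (0 : R) -> 0 <= u ->
  (`|f u|%:E <= \int[mu]_(r in `[u, +oo[) `|h r|%:E)%E.
Proof.
move=> [mh fh _] f0 u0; apply/lee_addgt0Pr => e e0.
have [b [ub fb]] : exists b, u <= b /\ `|f b| < e.
  have : \forall b \near +oo, u <= b /\ `|f b| < e.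
    apply: filterI; first by apply: nbhs_pinfty_ge; rewrite num_real.
    by move/cvgr0Pnorm_lt : f0 => /(_ e e0).
  by move=> /filter_ex[b]; exists b.
have [ih fE] := fh _ _ u0 ub.
have mh' (D : set (measurableTypeR R)) : measurable_fun D (fun r => (`|h r|)%:E).
  apply/measurable_EFinP/measurableT_comp => //.
  exact: measurable_funTS.
apply: (@le_trans _ _ ((\int[mu]_(r in `[u, b]) `|h r|%:E) + e%:E)%E); last first.
  rewrite leeD2r//; apply: ge0_subset_integral => //.
  by apply: subset_itvl; rewrite bnd_simp.
apply: (@le_trans _ _ (`|(f b - f u)%:E| + e%:E)%E).
  rewrite -EFinD lee_fin; have := ler_normB (f b) (f b - f u); rewrite subKr.
  by move=> /le_trans; apply; rewrite addrC lerD2l ltW.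
rewrite leeD2r// fE; apply: le_abse_integral => //.
by have /integrableP[] := ih.
Qed.

End RplusFunctions.

Section LowerScaling.
Context d (T : measurableType d) (R : realType).
Variable m : {measure set T -> \bar R}.

Import HBNNSimple.

(** A simple function below [c f] is [c] times a simple function below [f], so no measurability of
    [f] enters. *)
Lemma ge0_integralZl_lower (D : set T) (f : T -> \bar R) (c : R) : 0 < c ->
  (forall x, D x -> (0 <= f x)%E) ->
  (\int[m]_(x in D) (c%:E * f x) <= c%:E * \int[m]_(x in D) f x)%E.
Proof.
move=> c0 f0; have cf0 x : D x -> (0 <= c%:E * f x)%E.
  by move=> Dx; rewrite mule_ge0 ?f0// lee_fin ltW.
rewrite !ge0_integralE//; apply: ge_ereal_sup => _ [h /= hf <-].
have c0' : 0 <= c^-1 by rewrite invr_ge0 ltW.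
pose h' : {nnsfun T >-> R} := scale_nnsfun h c0'.
have -> : sintegral m h = (c%:E * sintegral m h')%E.
  rewrite -!integralT_nnsfun -ge0_integralZl_EFin ?(ltW c0)//; last 2 first.
  - by move=> x _; rewrite lee_fin fun_ge0.
  - exact/measurable_EFinP.
  apply: eq_integral => x _; rewrite -EFinM; congr EFin => /=.
  by rewrite mulrA divff ?gt_eqF// mul1r.
rewrite lee_wpmul2l ?lee_fin ?(ltW c0)//; apply: ereal_sup_ubound; exists h' => //= x.
have := hf x; rewrite /patch; case: ifPn => xD hx.
  by rewrite EFinM lee_pdivrMl.
have -> : h x = 0 by apply/eqP; rewrite eq_le -lee_fin hx fun_ge0.
by rewrite mulr0.
Qed.

End LowerScaling.

Section FunctionSpaceFacts.
Variables (R : realType) (v w : R -> R).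
Hypothesis hvw : weight_conditions v w.
Local Notation mu := (@lebesgue_measure R).
Implicit Types (x y f g : R -> R^o) (u : R) (h : R -> R).
Local Notation F1 := (Fspace 1 v).
Local Notation F2 := (Fspace 2 w).

Let v0 u : 0 <= u -> 0 < v u. Proof. by case: hvw => H _ _ _ _ /H[]. Qed.
Let w0 u : 0 <= u -> 0 < w u. Proof. by case: hvw => H _ _ _ _ /H[]. Qed.
Let mv : measurable_fun (`[0, +oo[ : set (measurableTypeR R)) v.
Proof. by case: hvw => _ []. Qed.
Let mw : measurable_fun (`[0, +oo[ : set (measurableTypeR R)) w.
Proof. by case: hvw => _ []. Qed.

Let mw' : measurable_fun (`[0, +oo[ : set (measurableTypeR R)) (fun u => (w u)^-1).
Proof.
apply: measurable_fun_inv => // u; rewrite /= in_itv/= andbT => /w0; exact: ltW.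
Qed.

Let sub_Rplus u : 0 <= u -> `[u, +oo[ `<=` (`[0, +oo[ : set R).
Proof. by move=> u0; apply: subset_itvr; rewrite bnd_simp. Qed.

(** Used with [p = 1], for bounds on x', and with [p r = r], for bounds on x; the single moment
    condition on [w] covers both. *)
Let w_moment (p : R -> R) : measurable_fun (`[0, +oo[ : set (measurableTypeR R)) p ->
  (forall r, 0 <= r -> (p r) ^+ 2 <= 1 + r ^+ 2) ->
  forall u, 0 <= u -> (\int[mu]_(r in `[u, +oo[) (p r ^+ 2 / w r)%:E < +oo)%E.
Proof.
move=> mp p1 u u0; case: hvw => _ _ _ + _; apply: le_lt_trans.
apply: (@le_trans _ _ (\int[mu]_(r in `[0%R, +oo[) (p r ^+ 2 / w r)%:E)%E).
  apply: ge0_subset_integral => //; last exact: sub_Rplus.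
    by apply/measurable_EFinP/measurable_funM => //; exact: measurable_funX.
  move=> r; rewrite /= in_itv/= andbT => /w0 wr.
  by rewrite lee_fin divr_ge0 ?sqr_ge0// ltW.
apply: ge0_le_integral_lower => r; rewrite /= in_itv/= andbT => r0; rewrite lee_fin.
  by rewrite divr_ge0 ?sqr_ge0// ltW// w0.
by rewrite ler_wpM2r ?p1// invr_ge0 ltW// w0.
Qed.

Lemma Rplus_derivable_continuous x : (forall u, 0 <= u -> Rplus_derivable x u) ->
  continuous (fun u => x (Num.max 0 u) : R).
Proof.
move=> dx; have cw u : 0 <= u -> x r @[r --> within [set r | 0 <= r] (nbhs u)] --> x u.
  move=> u0; have ? := Rplus_nbhs_proper u0.
  have /cvg_ex[l xl] := dx u u0.
  have : x u + Rplus_quotient x u r * (r - u) @[r --> Rplus_nbhs u] --> x u + l * (u - u).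
    apply: cvgD; first exact: cvg_cst.
    apply: cvgM => //; apply: cvgB; last exact: cvg_cst.
    by apply: cvg_trans (@cvg_id _ (nbhs u)); move=> P uP; apply: cvg_within; exact: cvg_within.
  rewrite subrr mulr0 addr0 => {}xl P xP.
  have : \forall r \near nbhs u, r != u -> 0 <= r ->
      P (x u + Rplus_quotient x u r * (r - u)) by exact: xl xP.
  rewrite /within/=; apply: filterS => r H r0.
  have [->|ru] := eqVneq r u; first exact: (nbhs_singleton xP).
  by have := H ru r0; rewrite /Rplus_quotient divfK ?subr_eq0// subrKC.
move=> u; have m0 : 0 <= Num.max 0 u by rewrite le_max lexx.
apply: cvg_comp (cw _ m0) => P /= mP.
have : \forall r \near nbhs u, 0 <= Num.max 0 r -> P (Num.max 0 r).
  have cmax : {for u, continuous (fun r : R => Num.max 0 r)}.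
    by apply: continuous_max; [exact: cvg_cst|exact: cvg_id].
  exact: cmax mP.
by apply: filterS => r; apply; rewrite le_max lexx.
Qed.

Let Rp_itv u : `[0, +oo[%classic u = (0 <= u) :> Prop.
Proof. by rewrite /= in_itv/= andbT. Qed.

Lemma F2_density x : carrier F2 x -> exists2 h, Rplus_density (Rplus_D x) h &
  wenergy 2 w x = (\int[mu]_(u in `[0%R, +oo[) (h u ^+ 2 * w u)%:E)%E.
Proof.
case=> _ _ /= ACx _ _; have [h hP] := Rplus_AC_FTC ACx; exists h => //.
by apply: wenergyE => [u /w0/ltW//|]; case: hP.
Qed.

Lemma F2_D_cvg x u : carrier F2 x -> 0 <= u ->
  Rplus_quotient x u r @[r --> Rplus_nbhs u] --> Rplus_D x u.
Proof. by case=> _ dx _ _ _ u0; exact: (dx 0%N u). Qed.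

Let cauchy_schwarz_tail h (p : R -> R) u :
  measurable_fun (setT : set (measurableTypeR R)) h ->
  measurable_fun (setT : set (measurableTypeR R)) p ->
  (forall r, 0 <= r -> (p r) ^+ 2 <= 1 + r ^+ 2) ->
  0 <= u ->
  (\int[mu]_(r in `[0%R, +oo[) (h r ^+ 2 * w r)%:E < +oo)%E ->
  (\int[mu]_(r in `[u, +oo[) (`|h r * p r|)%:E < +oo)%E /\
  fine (\int[mu]_(r in `[u, +oo[) (`|h r * p r|)%:E) ^+ 2 <=
    fine (\int[mu]_(r in `[0%R, +oo[) (h r ^+ 2 * w r)%:E) *
    fine (\int[mu]_(r in `[u, +oo[) (p r ^+ 2 / w r)%:E).
Proof.
move=> mh mp p1 u0 Efin.
have sub := sub_Rplus u0.
have mfS (f : R -> R) : measurable_fun (setT : set (measurableTypeR R)) f ->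
    measurable_fun (`[u, +oo[ : set (measurableTypeR R)) f by exact: measurable_funTS.
have Ele : (\int[mu]_(r in `[u, +oo[) (h r ^+ 2 * w r)%:E <=
            \int[mu]_(r in `[0%R, +oo[) (h r ^+ 2 * w r)%:E)%E.
  apply: ge0_subset_integral => //.
    apply/measurable_EFinP/measurable_funM => //.
    by apply: measurable_funTS; exact: measurable_funX.
  by move=> r; rewrite Rp_itv => /w0 wr; rewrite lee_fin mulr_ge0 ?sqr_ge0// ltW.
have [|||||||A1 A2] := @cauchy_schwarz_weight _ _ _ mu `[u, +oo[ h p w.
- by [].
- exact: mfS.
- exact: mfS.
- exact: measurable_funS mw.
- by move=> r /sub; rewrite Rp_itv => /w0.
- exact: le_lt_trans Ele Efin.
- by apply: w_moment => //; exact: measurable_funTS.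
split => //; apply: le_trans A2 _; apply: ler_wpM2r.
  apply: fine_ge0; apply: integral_ge0 => r /sub; rewrite Rp_itv => /w0 wr.
  by rewrite lee_fin divr_ge0 ?sqr_ge0// ltW.
have Ege0 : (0 <= \int[mu]_(r in `[u, +oo[) (h r ^+ 2 * w r)%:E)%E.
  apply: integral_ge0 => r /sub; rewrite Rp_itv => /w0 wr.
  by rewrite lee_fin mulr_ge0 ?sqr_ge0// ltW.
apply: fine_le => //; rewrite ge0_fin_numE//; first exact: le_lt_trans Ele Efin.
exact: le_trans Ele.
Qed.

Lemma F2_deriv_bound x u : carrier F2 x -> 0 <= u ->
  Rplus_D x u ^+ 2 <= fine (wenergy 2 w x) *
    fine (\int[mu]_(r in `[u, +oo[) (1 ^+ 2 / w r)%:E).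
Proof.
move=> xF u0; have [h hP E] := F2_density xF.
have Efin : (\int[mu]_(u in `[0%R, +oo[) (h u ^+ 2 * w u)%:E < +oo)%E.
  by rewrite -E; case: xF.
have mh : measurable_fun (setT : set (measurableTypeR R)) h by case: hP.
have [|A1 A2] := cauchy_schwarz_tail (p := cst 1) mh (@measurable_cst _ _ _ _ _ _) _ u0 Efin.
  by move=> r r0; rewrite expr1n lerDl sqr_ge0.
rewrite E; apply: le_trans A2.
have tail : (`|Rplus_D x u|%:E <= \int[mu]_(r in `[u, +oo[) (`|h r * cst 1 r|)%:E)%E.
  under eq_integral do rewrite mulr1.
  by apply: density_tail => //; case: xF => _ _ _ /(_ 1%N (leqnn _)).
rewrite -[leLHS]real_normK ?num_real// lerXn2r ?nnegrE ?fine_ge0//.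
  exact: integral_ge0.
by rewrite -lee_fin fineK// ge0_fin_numE//; exact: integral_ge0.
Qed.

Lemma Rplus_lipschitz_AC x (C : R) : 0 <= C ->
  (forall a b, 0 <= a -> a <= b -> `|x b - x a| <= C * (b - a)) -> Rplus_AC x.
Proof.
move=> C0 xC e e0; have C1 : 0 < C + 1 by rewrite ltr_wpDl.
exists (e / (C + 1)); first exact: divr_gt0.
move=> n a b ab _; rewrite ltr_pdivlMr// mulrC => sd; apply: le_lt_trans sd.
rewrite mulr_sumr; apply: ler_sum => i _; have /andP[a0 abi] := ab i.
by rewrite (le_trans (xC _ _ a0 abi))// ler_wpM2r ?subr_ge0// lerDl.
Qed.

Lemma Rplus_mean_value x (C : R) : (forall u, 0 <= u -> Rplus_derivable x u) ->
  (forall u, 0 <= u -> `|Rplus_D x u| <= C) ->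
  forall a b, 0 <= a -> a <= b -> `|x b - x a| <= C * (b - a).
Proof.
move=> dx DC a b a0; rewrite le_eqVlt => /predU1P[->|ab]; first by rewrite !subrr normr0 mulr0.
pose g (u : R) : R := x (Num.max 0 u).
have cg := Rplus_derivable_continuous dx.
have dg r : r \in `]a, b[ -> is_derive r 1 g (Rplus_D x r).
  rewrite in_itv/= => /andP[ar rb]; have r0 : 0 < r by exact: le_lt_trans a0 ar.
  have : is_derive r 1 (x : R -> R) (Rplus_D x r).
    by apply/Rplus_quotient_cvgP => //; exact: dx (ltW r0).
  apply: near_eq_is_derive; near=> s; rewrite /g max_r//; apply: ltW.
  by near: s; exact: lt_nbhsr.
have [c cab] := MVT ab dg (continuous_subspaceT cg).
have b0 : 0 <= b by rewrite (le_trans a0)// ltW.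
rewrite /g !max_r// => ->; rewrite normrM (gtr0_norm (x := b - a)) ?subr_gt0//.
rewrite ler_wpM2r ?subr_ge0 ?(ltW ab)// DC//.
by move: cab; rewrite in_itv/= => /andP[/ltW/(le_trans a0)].
Unshelve. all: by end_near.
Qed.

(** Membership in F^2_w asks for absolute continuity of x' only. But x' is bounded, by its tail
    bound at 0, so x is Lipschitz. *)
Lemma F2_AC x : carrier F2 x -> Rplus_AC x.
Proof.
move=> xF; have [_ dx _ _ _] := xF.
set E := fine (wenergy 2 w x).
set K := fine (\int[mu]_(r in `[0%R, +oo[) (1 ^+ 2 / w r)%:E).
have Kfin u : 0 <= u -> (\int[mu]_(r in `[u, +oo[) (1 ^+ 2 / w r)%:E < +oo)%E.
  move=> u0; apply: (w_moment (p := cst 1)) => // r r0.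
  by rewrite expr1n lerDl sqr_ge0.
have pos u r : 0 <= u -> `[u, +oo[%classic r -> (0 <= (1 ^+ 2 / w r)%:E)%E.
  move=> u0 /(sub_Rplus u0); rewrite Rp_itv => /w0 wr.
  by rewrite lee_fin divr_ge0 ?sqr_ge0// ltW.
apply: (@Rplus_lipschitz_AC _ (Num.sqrt (E * K))) => //.
apply: Rplus_mean_value => [u u0|u u0]; first exact: (dx 0%N).
rewrite -(sqrtr_sqr (Rplus_D x u)) ler_sqrt; last first.
  by rewrite mulr_ge0// fine_ge0 ?integral_ge0// => r; [rewrite Rp_itv => /w0/ltW wr; rewrite lee_fin mulr_ge0 ?sqr_ge0|exact: pos].
apply: le_trans (F2_deriv_bound xF u0) _; apply: ler_wpM2l.
  by rewrite fine_ge0 ?integral_ge0// => r; rewrite Rp_itv => /w0/ltW wr; rewrite lee_fin mulr_ge0 ?sqr_ge0.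
have le0 : (\int[mu]_(r in `[u, +oo[) (1 ^+ 2 / w r)%:E <=
            \int[mu]_(r in `[0%R, +oo[) (1 ^+ 2 / w r)%:E)%E.
  apply: ge0_subset_integral => //; last exact: sub_Rplus.
    by apply/measurable_EFinP/measurable_funM => //; exact: measurable_cst.
  by move=> r; exact: pos.
apply: fine_le => //; rewrite ge0_fin_numE ?Kfin ?integral_ge0// => r; exact: pos.
Qed.

(** By the tail bound, x'(u)^2 v(u) is at most the energy of x times the integral of v(u) / w over
    [[u, +oo[]; Tonelli turns the integral in u into the third weight condition. *)
Lemma F2_sub_F1 x : carrier F2 x -> carrier F1 x.
Proof.
move=> xF; have [x1 x2 x3 x4 x5] := xF; split => //.
- exact: F2_AC.
- by move=> j; rewrite leqn0 => /eqP ->; exact: (x4 0%N).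
rewrite (wenergyE (h := Rplus_D x)).
(* The added 1 makes the factor positive, as [ge0_integralZl_lower] requires. *)
- pose E := fine (wenergy 2 w x) + 1.
  have E0 : 0 < E.
    rewrite /E ltr_wpDl// fine_ge0// integral_ge0// => r; rewrite Rp_itv => /w0/ltW wr.
    by rewrite lee_fin mulr_ge0 ?sqr_ge0.
  have vge u : 0 <= u -> 0 <= v u by move=> /v0/ltW.
  have wge u : 0 <= u -> 0 <= (w u)^-1 by move=> /w0/ltW; rewrite invr_ge0.
  have tri := tonelli_triangle mv mw' vge wge.
  apply: (@le_lt_trans _ _ (\int[mu]_(u in `[0%R, +oo[)
      (E%:E * \int[mu]_(r in `[u, +oo[) (v u * (w r)^-1)%:E))%E).
    apply: ge0_le_integral_lower => u; rewrite Rp_itv => u0.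
      by rewrite lee_fin mulr_ge0 ?sqr_ge0// vge.
    have Ku0 r : `[u, +oo[%classic r -> 0 <= (w r)^-1.
      by move=> /(sub_Rplus u0); rewrite Rp_itv => /w0/ltW; rewrite invr_ge0.
    under [X in (_ <= _ * X)%E]eq_integral do rewrite EFinM.
    rewrite ge0_integralZl_EFin ?vge//; last first.
      by apply/measurable_EFinP; apply: measurable_funS mw' => //; exact: sub_Rplus.
    have Kfin : (\int[mu]_(r in `[u, +oo[) ((w r)^-1)%:E \is a fin_num)%E.
      rewrite ge0_fin_numE; last by apply: integral_ge0 => r /Ku0; rewrite lee_fin.
      have := w_moment (p := cst 1) _ _ u0; under eq_integral do rewrite /= expr1n div1r.
      by apply => // r r0; rewrite expr1n lerDl sqr_ge0.
    rewrite -(fineK Kfin) -!EFinM lee_fin mulrCA [leLHS]mulrC.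
    apply: ler_wpM2l; first exact/ltW/v0.
    have := F2_deriv_bound xF u0.
    have -> : (\int[mu]_(r in `[u, +oo[) (1 ^+ 2 / w r)%:E =
              \int[mu]_(r in `[u, +oo[) ((w r)^-1)%:E)%E.
      by apply: eq_integral => r _; rewrite expr1n div1r.
    move=> /le_trans; apply; apply: ler_wpM2r; last by rewrite /E lerDl.
    by apply: fine_ge0; apply: integral_ge0 => r /Ku0; rewrite lee_fin.
  apply: le_lt_trans (ge0_integralZl_lower _ E0 _) _.
    move=> u; rewrite Rp_itv => u0; apply: integral_ge0 => r /(sub_Rplus u0).
    by rewrite Rp_itv => /w0/ltW wr; rewrite lee_fin divr_ge0// ltW// v0.
  rewrite tri.
  have [_ _ _ _ fin] := hvw.
  by apply: lte_mul_pinfty => //; rewrite lee_fin ltW.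
- by move=> u /v0/ltW.
- by apply: aeW => u u0; exact: F2_D_cvg.
Qed.

Lemma F2_eval_bound : exists2 C : R, 0 <= C &
  forall x s, carrier F2 x -> 0 <= s -> `|x s| <= C * nnorm F2 x.
Proof.
set K := fine (\int[mu]_(r in `[0%R, +oo[) (r ^+ 2 / w r)%:E).
exists (Num.sqrt K) => // x s xF s0.
have [h hP E] := F2_density xF.
have Efin : (\int[mu]_(u in `[0%R, +oo[) (h u ^+ 2 * w u)%:E < +oo)%E.
  by rewrite -E; case: xF.
have mh : measurable_fun (setT : set (measurableTypeR R)) h by case: hP.
have [|A1 A2] := cauchy_schwarz_tail (p := idfun) mh (@measurable_id _ _ _) _ (lexx 0) Efin.
  by move=> r r0; rewrite lerDr.
have [k kP] := Rplus_AC_FTC (F2_AC xF).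
have lim0 : x b @[b --> +oo] --> (0 : R) by case: xF => _ _ _ /(_ 0%N isT).
have limD : Rplus_D x b @[b --> +oo] --> (0 : R) by case: xF => _ _ _ /(_ 1%N (leqnn _)).
have mk : measurable_fun (setT : set (measurableTypeR R)) (fun r => `|k r|).
  by apply: measurableT_comp => //; case: kP.
have mhn : measurable_fun (setT : set (measurableTypeR R)) (fun r => `|h r|).
  exact: measurableT_comp.
(* Two tail bounds, for x and for x', give an iterated integral of |x''|; exchanging the order
   produces the factor [r], whose moment against 1/w is finite. *)
have tail : (`|x s|%:E <= \int[mu]_(r in `[0%R, +oo[) (`|h r * r|)%:E)%E.
  apply: le_trans (density_tail kP lim0 s0) _.
  apply: (@le_trans _ _ (\int[mu]_(u in `[0%R, +oo[) `|k u|%:E)%E).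
    apply: ge0_subset_integral => //; last exact: sub_Rplus.
    exact/measurable_EFinP/measurable_funTS.
  apply: (@le_trans _ _ (\int[mu]_(u in `[0%R, +oo[) \int[mu]_(r in `[u, +oo[) (1 * `|h r|)%:E)%E).
    apply: ge0_le_integral_ae => //.
      by move=> u _; apply: integral_ge0 => r _; rewrite lee_fin mul1r.
    case: kP => _ _; apply: aeS => u ku; rewrite Rp_itv => u0.
    have ? := Rplus_nbhs_proper u0.
    have -> : k u = Rplus_D x u by apply: cvg_unique (ku u0) (F2_D_cvg xF u0).
    under eq_integral do rewrite mul1r.
    exact: density_tail.
  rewrite (tonelli_triangle (a := cst 1) (b := fun r => `|h r|))//; last exact: measurable_funTS.
  apply: ge0_le_integral_lower => r; rewrite Rp_itv => r0.
      by apply: integral_ge0 => u _; rewrite lee_fin mul1r.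
    under eq_integral do rewrite mul1r.
    have -> : (\int[mu]_(_ in `[0%R, r]) `|h r|%:E = `|h r|%:E * mu `[0%R, r])%E.
      by apply: integral_cst.
    rewrite lebesgue_measure_itv/= lte_fin.
    rewrite normrM (ger0_norm r0); case: ifPn => [_|_].
      by rewrite sube0 -EFinM.
    by rewrite mule0 lee_fin mulr_ge0.
have : `|x s| ^+ 2 <= fine (wenergy 2 w x) * K.
  rewrite E; apply: le_trans A2; rewrite lerXn2r ?nnegrE ?fine_ge0//.
    exact: integral_ge0.
  by rewrite -lee_fin fineK// ge0_fin_numE//; exact: integral_ge0.
move=> H; rewrite /= -sqrtrM; last first.
  apply: fine_ge0; apply: integral_ge0 => r; rewrite Rp_itv => /w0/ltW wr.
  by rewrite lee_fin divr_ge0 ?sqr_ge0.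
by rewrite -[leLHS]normr_id -sqrtr_sqr ler_sqrt 1?mulrC// (le_trans _ H)// sqr_ge0.
Qed.

Let v0' u : 0 <= u -> 0 <= v u. Proof. by move=> /v0/ltW. Qed.
Let w0' u : 0 <= u -> 0 <= w u. Proof. by move=> /w0/ltW. Qed.

Lemma F1_density x : carrier F1 x -> exists2 h, Rplus_density x h &
  wenergy 1 v x = (\int[mu]_(u in `[0%R, +oo[) (h u ^+ 2 * v u)%:E)%E.
Proof.
case=> _ _ /= ACx _ _; have [h hP] := Rplus_AC_FTC ACx; exists h => //.
by apply: wenergyE => [u /v0/ltW//|]; case: hP.
Qed.

Lemma F1_energy_fin x : carrier F1 x -> wenergy 1 v x \is a fin_num.
Proof.
case=> _ _ _ _ Efin; rewrite ge0_fin_numE//; apply: integral_ge0 => u.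
by rewrite Rp_itv => /v0 vu; rewrite lee_fin mulr_ge0 ?sqr_ge0// ltW.
Qed.

(** From (a h + k)^2 <= 2 a^2 h^2 + 2 k^2. *)
Let energy_lin_fin (p h k : R -> R) (a : R) :
  measurable_fun (`[0, +oo[ : set (measurableTypeR R)) p ->
  (forall u, 0 <= u -> 0 <= p u) ->
  measurable_fun (setT : set (measurableTypeR R)) h ->
  measurable_fun (setT : set (measurableTypeR R)) k ->
  (\int[mu]_(u in `[0%R, +oo[) (h u ^+ 2 * p u)%:E < +oo)%E ->
  (\int[mu]_(u in `[0%R, +oo[) (k u ^+ 2 * p u)%:E < +oo)%E ->
  (\int[mu]_(u in `[0%R, +oo[) ((a * h u + k u) ^+ 2 * p u)%:E < +oo)%E.
Proof.
move=> mp p0 mh mk hfin kfin.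
have pos (g : R -> R) u : `[0, +oo[%classic u -> (0 <= (g u ^+ 2 * p u)%:E)%E.
  by rewrite Rp_itv => /p0 pu; rewrite lee_fin mulr_ge0 ?sqr_ge0.
have mE (g : R -> R) : measurable_fun (setT : set (measurableTypeR R)) g ->
    measurable_fun (`[0, +oo[ : set (measurableTypeR R)) (fun u => (g u ^+ 2 * p u)%:E).
  move=> mg; apply/measurable_EFinP/measurable_funM => //.
  by apply: measurable_funTS; exact: measurable_funX.
have c0 : 0 <= 2 * a ^+ 2 by rewrite mulr_ge0// sqr_ge0.
apply: (@le_lt_trans _ _ (\int[mu]_(u in `[0%R, +oo[)
  ((2 * a ^+ 2)%:E * (h u ^+ 2 * p u)%:E + 2%:E * (k u ^+ 2 * p u)%:E))%E).
  apply: ge0_le_integral_lower => u u0; first exact: (pos (fun u => a * h u + k u)).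
  rewrite -!EFinM -EFinD lee_fin -subr_ge0.
  have -> : 2 * a ^+ 2 * (h u ^+ 2 * p u) + 2 * (k u ^+ 2 * p u) -
    (a * h u + k u) ^+ 2 * p u = (a * h u - k u) ^+ 2 * p u by ring.
  by rewrite mulr_ge0 ?sqr_ge0// p0// -Rp_itv.
rewrite ge0_integralD//; last 4 first.
- by move=> u u0; rewrite mule_ge0 ?pos// lee_fin.
- by apply: measurable_funeM; exact: mE.
- by move=> u u0; rewrite mule_ge0 ?pos.
- by apply: measurable_funeM; exact: mE.
rewrite !ge0_integralZl_EFin//; [|by move=> u; exact: pos|exact: mE|by move=> u; exact: pos|exact: mE].
rewrite lte_add_pinfty// lte_mul_pinfty// ?lee_fin//.
Qed.

Let cvg_lin (a : R) x y : x u @[u --> +oo] --> (0 : R) -> y u @[u --> +oo] --> (0 : R) ->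
  (a *: x + y) u @[u --> +oo] --> (0 : R).
Proof.
move=> x0 y0; rewrite -[X in _ --> X](addr0 (0 : R)) -[X in _ --> X + _](mulr0 a).
by apply: cvgD y0; apply: cvgMr.
Qed.

Lemma F1_lin (a : R) x y : carrier F1 x -> carrier F1 y -> carrier F1 (a *: x + y).
Proof.
move=> xF yF; have [h [mh h1 h2] hE] := F1_density xF.
have [k [mk k1 k2] kE] := F1_density yF.
have [xn _ xAC xl xe] := xF; have [yn _ yAC yl ye] := yF; split; [|by []| | |].
- by move=> u u0; rewrite lin_funE xn ?yn// mulr0 addr0.
- exact: Rplus_AC_lin _ xAC yAC.
- by move=> j; rewrite leqn0 => /eqP ->; apply: cvg_lin; [exact: (xl 0%N)|exact: (yl 0%N)].
rewrite (wenergyE (h := fun u => a * h u + k u)).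
- by rewrite hE in xe; rewrite kE in ye; exact: energy_lin_fin mv v0' mh mk xe ye.
- exact: v0'.
- by apply: aeS2 h2 k2 => u hu ku u0; exact: Rplus_cvg_lin u0 (hu u0) (ku u0).
Qed.

Lemma F2_D_lin (a : R) x y : carrier F2 x -> carrier F2 y ->
  forall u, 0 <= u ->
    Rplus_derivable (a *: x + y) u /\
    Rplus_D (a *: x + y) u = (a *: Rplus_D x + Rplus_D y) u.
Proof.
move=> xF yF u u0; apply: Rplus_D_cvg => //.
by apply: Rplus_cvg_lin => //; exact: F2_D_cvg.
Qed.

Lemma F2_lin (a : R) x y : carrier F2 x -> carrier F2 y -> carrier F2 (a *: x + y).
Proof.
move=> xF yF; have [h [mh h1 h2] hE] := F2_density xF.
have [k [mk k1 k2] kE] := F2_density yF.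
have [xn _ xAC xl xe] := xF; have [yn _ yAC yl ye] := yF.
have DE := F2_D_lin a xF yF.
have DE' : {in `[0, +oo[, (a *: Rplus_D x + Rplus_D y) =1 Rplus_D (a *: x + y)}.
  by move=> u; rewrite in_itv/= andbT => /DE[_ ->].
split.
- by move=> u u0; rewrite lin_funE xn ?yn// mulr0 addr0.
- by move=> [|//] u _ /DE[].
- exact: Rplus_AC_eq DE' (Rplus_AC_lin _ xAC yAC).
- move=> [|[|//]] _; first by apply: cvg_lin; [exact: (xl 0%N)|exact: (yl 0%N)].
  have : (a *: Rplus_D x + Rplus_D y) u @[u --> +oo] --> (0 : R).
    by apply: cvg_lin; [exact: (xl 1%N)|exact: (yl 1%N)].
  apply: cvg_trans; apply: near_eq_cvg; near=> u; apply: DE'.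
  by rewrite in_itv/= andbT; near: u; apply: nbhs_pinfty_ge; rewrite num_real.
rewrite (wenergyE (h := fun u => a * h u + k u)).
- by rewrite hE in xe; rewrite kE in ye; exact: energy_lin_fin mw w0' mh mk xe ye.
- exact: w0'.
- apply: aeS2 h2 k2 => u hu ku u0.
  have lin := Rplus_cvg_lin (a := a) u0 (hu u0) (ku u0).
  exact: (Rplus_cvg_eq DE' u0 lin).
Unshelve. all: by end_near.
Qed.

Lemma F1_scale (c : R) x : carrier F1 x -> carrier F1 (c *: x) /\
  wenergy 1 v (c *: x) = ((c ^+ 2)%:E * wenergy 1 v x)%E.
Proof.
move=> xF; split.
  (* Closure under [a *: x + y] is what is available, so a multiple is written in this form without
     assuming that 0 belongs to the space. *)
  have -> : c *: x = (c - 1) *: x + x by rewrite scalerBl scale1r subrK.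
  exact: F1_lin.
have [h [mh h1 h2] hE] := F1_density xF.
rewrite (wenergyE (h := fun u => c * h u)).
- rewrite hE -ge0_integralZl_EFin//.
  + by apply: eq_integral => u _; rewrite -EFinM; congr EFin; ring.
  + by move=> u; rewrite Rp_itv => /v0/ltW vu; rewrite lee_fin mulr_ge0 ?sqr_ge0.
  + apply/measurable_EFinP/measurable_funM => //.
    by apply: measurable_funTS; exact: measurable_funX.
  + exact: sqr_ge0.
- exact: v0'.
apply: aeS h2 => u hu u0.
have -> : Rplus_quotient (c *: x) u = (fun r => c * Rplus_quotient x u r).
  apply/funext => r; rewrite /Rplus_quotient.
  have sE s : (c *: x) s = c * x s by [].
  by rewrite !sE -mulrBr mulrA.
by apply: cvgMr; exact: hu.
Qed.

(** The dual norm only sees the unit ball. With [E] the squared norm, [(E + 1)^-1] is a valid factor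
    even when the norm vanishes, because E <= (E + 1)^2. *)
Lemma F1_unit_ball x : carrier F1 x -> exists2 c : R, 0 < c &
  carrier F1 (c *: x) /\ nnorm F1 (c *: x) <= 1.
Proof.
move=> xF; set E := fine (wenergy 1 v x).
have E0 : 0 <= E.
  rewrite fine_ge0// integral_ge0// => u.
  by rewrite Rp_itv => /v0/ltW vu; rewrite lee_fin mulr_ge0 ?sqr_ge0.
exists (E + 1)^-1; first by rewrite invr_gt0 ltr_wpDl.
have [cF cE] := F1_scale (E + 1)^-1 xF; split => //=.
rewrite cE -(fineK (F1_energy_fin xF)) -EFinM /= -/E -[leRHS]sqrtr1 ler_sqrt//.
rewrite exprVn mulrC ler_pdivrMr ?exprn_gt0// ?ltr_wpDl// mul1r.
by rewrite sqrrD expr1n mulr1 mulr2n; move: (sqr_ge0 E) E0; lra.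
Qed.

Lemma F1_eval_bound : exists2 C : R, 0 <= C &
  forall x s, carrier F1 x -> `|x s| <= C * nnorm F1 x.
Proof.
set K := fine (\int[mu]_(r in `[0%R, +oo[) (1 ^+ 2 / v r)%:E).
exists (Num.sqrt K) => // x s xF.
have [xn _ _ /(_ 0%N isT) xl xe] := xF.
have [s0|s0] := ltP s 0; first by rewrite xn// normr0 /= mulr_ge0 ?sqrtr_ge0.
have [h hP E] := F1_density xF.
have mh : measurable_fun (setT : set (measurableTypeR R)) h by case: hP.
have [|||||||A1 A2] := @cauchy_schwarz_weight _ _ _ mu `[0, +oo[ h (cst 1) v.
- by [].
- exact: measurable_funTS.
- exact: measurable_cst.
- exact: mv.
- by move=> r; rewrite Rp_itv => /v0.
- by rewrite -E.
- under eq_integral do rewrite expr1n div1r.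
  by case: hvw.
have tail : (`|x s|%:E <= \int[mu]_(r in `[0%R, +oo[) (`|h r * cst 1 r|)%:E)%E.
  under eq_integral do rewrite mulr1.
  apply: le_trans (density_tail hP xl s0) _.
  apply: ge0_subset_integral => //; last exact: sub_Rplus.
  by apply/measurable_EFinP/measurable_funTS; exact: measurableT_comp.
have H : `|x s| ^+ 2 <= fine (wenergy 1 v x) * K.
  rewrite E; apply: le_trans A2; rewrite lerXn2r ?nnegrE ?fine_ge0//.
    exact: integral_ge0.
  by rewrite -lee_fin fineK// ge0_fin_numE//; exact: integral_ge0.
rewrite /= -sqrtrM; last first.
  apply: fine_ge0; apply: integral_ge0 => r; rewrite Rp_itv => /v0/ltW vr.
  by rewrite lee_fin divr_ge0 ?sqr_ge0.
by rewrite -[leLHS]normr_id -sqrtr_sqr ler_sqrt 1?mulrC// (le_trans _ H)// sqr_ge0.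
Qed.

(** [y1] is [x] stopped at [t], where its value is 0; stopping is a 1-Lipschitz change of variable
    and cuts the density off at [t]. The other piece is [x - y1]. *)
Lemma F1_split x t : 0 <= t -> carrier F1 x -> x t = 0 ->
  exists y1 y2, [/\ carrier F1 y1 /\ carrier F1 y2, x = 1 *: y1 + y2,
    forall s, t <= s -> y1 s = 0 & forall s, s <= t -> y2 s = 0].
Proof.
move=> t0 xF xt; pose y1 : R -> R^o := fun u => x (Num.min u t).
have [xn _ xAC xl xe] := xF.
have y1F : carrier F1 y1; last first.
  exists y1, ((-1) *: y1 + x); split.
  - by split; [exact: y1F|exact: F1_lin y1F xF].
  - by rewrite scale1r scaleN1r addrA subrr add0r.
  - by move=> s ts; rewrite /y1 min_r.
  - by move=> s st; rewrite lin_funE /y1 min_l// mulN1r addNr.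
split; [|by []| | |].
- by move=> u u0; rewrite /y1 min_l ?xn// ltW// (lt_le_trans u0).
- move=> e /xAC[d d0 fd]; exists d => // n a b ab ov sd.
  apply: (fd n (fun i => Num.min (a i) t) (fun i => Num.min (b i) t)).
  + move=> i; have /andP[a0 abi] := ab i.
    by rewrite le_min a0 t0/= le_min !ge_min abi lexx orbT.
  + move=> i j /ov[h|h]; [left|right]; by rewrite le_min !ge_min h lexx orbT.
  + apply: le_lt_trans sd; apply: ler_sum => i _; have /andP[_ abi] := ab i.
    by rewrite /Num.min; do ![case: ifP => //]; rewrite ?ltNge; move: abi; lra.
- move=> j; rewrite leqn0 => /eqP -> /=.
  apply: cvg_near_cst; near=> u.
  by rewrite /y1 min_r ?xt//; near: u; apply: nbhs_pinfty_ge; rewrite num_real.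
have [h [mh h1 h2] hE] := F1_density xF.
rewrite (wenergyE (h := fun u => if u < t then h u else 0)).
- apply: le_lt_trans xe; rewrite hE; apply: ge0_le_integral_lower => u; rewrite Rp_itv => /v0/ltW vu.
    by rewrite lee_fin mulr_ge0 ?sqr_ge0.
  rewrite lee_fin; case: ifP => // _.
  by rewrite expr0n/= mul0r mulr_ge0// sqr_ge0.
- exact: v0'.
(* At [t] itself the stopped function may have a kink. *)
have aet : {ae mu, forall u : R, u != t}.
  exists [set t]; split => //; first exact: lebesgue_measure_set1.
  by move=> u /= /negP; rewrite negbK => /eqP.
apply: aeS2 h2 aet => u hu ut u0.
have nbhsR (P : set R) : (\forall r \near nbhs u, P r) -> (\forall r \near Rplus_nbhs u, P r).
  by move=> uP; apply: cvg_within; exact: cvg_within.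
have [lut|tu] := ltP u t.
  apply: cvg_trans (hu u0); apply: near_eq_cvg.
  have : \forall r \near Rplus_nbhs u, r < t by apply: nbhsR; exact: lt_nbhsl.
  apply: (@filterS _ _ (within_filter _ _)) => r rt.
  by rewrite /Rplus_quotient /= /y1 !min_l ?ltW.
have ltu : t < u by rewrite lt_neqAle eq_sym ut.
apply: cvg_near_cst.
have : \forall r \near Rplus_nbhs u, t < r by apply: nbhsR; exact: lt_nbhsr.
apply: (@filterS _ _ (within_filter _ _)) => r rt.
by rewrite /Rplus_quotient /= /y1 !min_r ?(ltW rt)// subrr mul0r.
Unshelve. all: by end_near.
Qed.

Lemma dual_scale l (c : R) x : carrier (dual F1) l -> carrier F1 x ->
  l (c *: x) = c * l x.
Proof.
move=> [lin _] xF; have -> : c *: x = (c - 1) *: x + x by rewrite scalerBl scale1r subrK.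
rewrite lin//; have -> : (c - 1) *: l x = (c - 1) * l x by [].
by ring.
Qed.

Lemma dual_add l x y : carrier (dual F1) l -> carrier F1 x -> carrier F1 y ->
  l (1 *: x + y) = l x + l y.
Proof. by move=> [lin _] xF yF; rewrite lin// scale1r. Qed.

Lemma dualB l m : carrier (dual F1) l -> carrier (dual F1) m -> carrier (dual F1) (l - m).
Proof.
move=> [l1 [C lC]] [m1 [C' mC]]; split.
  move=> a x y xF yF.
  have BE z : (l - m) z = l z - m z by [].
  by rewrite !BE l1// m1// scalerBr opprD addrACA.
exists (C + C') => x xF; have -> : (l - m) x = l x - m x by [].
by rewrite mulrDl (le_trans (ler_normB _ _))// lerD ?lC ?mC.
Qed.

(* [sup] is only meaningful on bounded sets, hence the hypothesis. *)
Lemma dual_norm_ge (l : (R -> R^o) -> R^o) (C : R) :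
  (forall x, carrier F1 x -> `|l x| <= C * nnorm F1 x) ->
  forall x, carrier F1 x -> nnorm F1 x <= 1 -> `|l x| <= nnorm (dual F1) l.
Proof.
move=> lC x xF x1; apply: ub_le_sup; last by exists x.
exists `|C| => _ [y [yF y1] <-]; apply: le_trans (lC y yF) _.
apply: (@le_trans _ _ (`|C| * nnorm F1 y)); last by rewrite ler_piMr.
by rewrite ler_wpM2r ?ler_norm// sqrtr_ge0.
Qed.

(** Needed to make the dual norm of the distance to an approximating combination a genuine
    supremum. *)
Lemma nspan_delta_bounded A l : nspan [set @delta R s | s in A] l ->
  exists C : R, forall x, carrier F1 x -> `|l x| <= C * nnorm F1 x.
Proof.
move=> [n [c [a [aA ->]]]]; have [C C0 evC] := F1_eval_bound.
exists (\sum_(i < n) `|c i| * C) => x xF.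
have -> : (\sum_(i < n) c i *: a i) x = \sum_(i < n) c i * a i x by rewrite fct_sumE.
rewrite (le_trans (ler_norm_sum _ _ _))// mulr_suml; apply: ler_sum => i _.
rewrite normrM -mulrA ler_wpM2l//; have [s _ <-] := aA i.
exact: evC.
Qed.

Lemma nspan_delta_zero A l x : nspan [set @delta R s | s in A] l ->
  (forall s, A s -> x s = 0) -> l x = 0.
Proof.
move=> [n [c [a [aA ->]]]] x0.
have -> : (\sum_(i < n) c i *: a i) x = \sum_(i < n) c i * a i x by rewrite fct_sumE.
by rewrite big1// => i _; have [s As <-] := aA i; rewrite /delta x0// mulr0.
Qed.

(** The combinations of evaluations that approximate [l] vanish at [x]. Dual-norm distance controls
    values on the unit ball, so [x] is first scaled into it. *)
Lemma Tspace_zero A l x : Tspace v A l -> carrier F1 x ->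
  (forall s, A s -> x s = 0) -> l x = 0.
Proof.
move=> [lD lA] xF x0; have [c c0 [cF c1]] := F1_unit_ball xF.
suff : l (c *: x) = 0.
  by rewrite dual_scale// => /eqP; rewrite mulf_eq0 gt_eqF//= => /eqP.
apply/eqP; rewrite -normr_le0; apply/ler_addgt0Pr => e /lA[m mA lm].
rewrite add0r; apply: le_trans (ltW lm).
have [C mC] := nspan_delta_bounded mA; have [_ [C' lC]] := lD.
have := @dual_norm_ge (l - m) (C' + C) _ _ cF c1.
have -> : (l - m) (c *: x) = l (c *: x) - m (c *: x) by [].
rewrite (nspan_delta_zero mA) ?subr0; last first.
  by move=> s As; have -> : (c *: x) s = c * x s by []; rewrite x0// mulr0.
apply => y yF; have -> : (l - m) y = l y - m y by [].
by rewrite mulrDl (le_trans (ler_normB _ _))// lerD ?mC ?lC.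
Qed.

(* A function vanishing at t splits at t into two functions, one of them
   annihilated by T_[t,oo) and the other by T_[0,t]. *)
Lemma Tspace_difference_zero t l m y : 0 <= t ->
  Tspace v `[t, +oo[ l -> Tspace v `[t, +oo[ m -> Tspace v `[0, t] (l - m) ->
  carrier F1 y -> y t = 0 -> l y = m y.
Proof.
move=> t0 lT mT lmT yF yt; have [y1 [y2 [[y1F y2F] -> y10 y20]]] := F1_split t0 yF yt.
have [lD _] := lT; have [mD _] := mT.
rewrite !dual_add// (Tspace_zero lT y1F) ?(Tspace_zero mT y1F).
- apply/eqP; rewrite !add0r -subr_eq0; apply/eqP.
  apply: (Tspace_zero lmT y2F) => s; rewrite /= in_itv/= => /andP[_].
  exact: y20.
- by move=> s; rewrite /= in_itv/= andbT; exact: y10.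
- by move=> s; rewrite /= in_itv/= andbT; exact: y10.
Qed.

(** Makes the value of a strategy on a fixed curve a measurable function of (t, omega). The radius
    carries the factor [k] that brings [x] into the unit ball. *)
Lemma dual_eval_nopen x (c : R) : carrier F1 x -> nopen (dual F1) [set l | l x < c].
Proof.
move=> xF l lD /= lc; have [k k0 [kF k1]] := F1_unit_ball xF.
exists (k * (c - l x)); first by rewrite mulr_gt0// subr_gt0.
move=> m mD ml; have mlD := dualB mD lD; have [_ [C mlC]] := mlD.
have := le_lt_trans (dual_norm_ge mlC kF k1) ml.
have -> : (m - l) (k *: x) = m (k *: x) - l (k *: x) by [].
rewrite !dual_scale// -mulrBr normrM gtr0_norm// ltr_pM2l// => /(le_lt_trans (ler_norm _)).
by rewrite ltrBlDr subrK.
Qed.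

Lemma F2_eval_nopen u (c : R) : 0 <= u -> nopen F2 [set x | x u < c].
Proof.
move=> u0 x xF /= xc; have [C C0 evC] := F2_eval_bound.
have C1 : 0 < C + 1 by rewrite ltr_wpDl.
exists ((c - x u) / (C + 1)); first by rewrite divr_gt0// subr_gt0.
move=> y yF; rewrite ltr_pdivlMr// => yx.
have yxF : carrier F2 (y - x) by rewrite addrC -scaleN1r; exact: F2_lin.
have := evC _ _ yxF u0; have -> : (y - x) u = y u - x u by [].
move=> /(le_trans (ler_norm _)) H; rewrite -(ltrD2r (- x u)); apply: le_lt_trans H _.
apply: le_lt_trans yx; rewrite mulrC ler_wpM2l ?lerDl//.
exact: sqrtr_ge0.
Qed.

End FunctionSpaceFacts.

(** * Hilbert-Schmidt functionals *)

Section InnerProduct.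
Variables (R : realType) (H : completeNormedModType R).
Variable ip : {dot H for (@idfun R)}.
Hypothesis ipE : forall x : H, ip x x = `|x| ^+ 2.
Implicit Types (x y z : H) (s : seq H).

Lemma ipC x y : ip x y = ip y x.
Proof. by rewrite hermC expr0 mul1r. Qed.

Lemma ipDl x y z : ip (x + y) z = ip x z + ip y z.
Proof. by rewrite linearDl. Qed.

Lemma ipZl a x y : ip (a *: x) y = a * ip x y.
Proof. by rewrite linearZl. Qed.

Lemma ipDr x y z : ip x (y + z) = ip x y + ip x z.
Proof. by rewrite ipC ipDl !(ipC x). Qed.

Lemma ipZr a x y : ip x (a *: y) = a * ip x y.
Proof. by rewrite ipC ipZl ipC. Qed.

Lemma ip0l x : ip 0 x = 0. Proof. by rewrite -(scale0r x) ipZl mul0r. Qed.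
Lemma ip0r x : ip x 0 = 0. Proof. by rewrite ipC ip0l. Qed.
Lemma ipNl x y : ip (- x) y = - ip x y.
Proof. by rewrite -scaleN1r ipZl mulN1r. Qed.
Lemma ipNr x y : ip x (- y) = - ip x y.
Proof. by rewrite ipC ipNl ipC. Qed.

Lemma ip_suml (I : Type) (r : seq I) (f : I -> H) y :
  ip (\sum_(i <- r) f i) y = \sum_(i <- r) ip (f i) y.
Proof.
by elim: r => [|i r IH]; rewrite ?big_nil ?ip0l// !big_cons ipDl IH.
Qed.

Definition orthonormal_seq s := [/\ uniq s, forall b, b \in s -> ip b b = 1 &
  forall b c, b \in s -> c \in s -> b != c -> ip b c = 0].

Definition proj_seq s x := \sum_(b <- s) ip x b *: b.

Lemma proj_seq_ortho s x b : orthonormal_seq s -> b \in s -> ip (x - proj_seq s x) b = 0.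
Proof.
move=> [us s1 s2] bs; rewrite ipDl ipNl /proj_seq ip_suml.
rewrite (bigD1_seq b)//= ipZl s1// mulr1 big_seq_cond big1 ?addr0 ?subrr// => c /andP[cs cb].
by rewrite ipZl (s2 c b)// mulr0.
Qed.

Lemma norm_sub_proj s x : orthonormal_seq s ->
  `|x - proj_seq s x| ^+ 2 = `|x| ^+ 2 - \sum_(b <- s) ip x b ^+ 2.
Proof.
move=> os; rewrite -!ipE ipDr ipNr.
have -> : ip (x - proj_seq s x) (proj_seq s x) = 0.
  rewrite ipC {1}/proj_seq ip_suml big_seq big1// => b bs.
  by rewrite ipZl [ip _ (x - _)]ipC (proj_seq_ortho x os bs) mulr0.
rewrite subr0 ipDl ipNl /proj_seq ip_suml; congr (_ - _).
by apply: eq_bigr => b _; rewrite ipZl ipC expr2 [ip b x]ipC.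
Qed.

Lemma bessel_seq s x : orthonormal_seq s -> \sum_(b <- s) ip x b ^+ 2 <= `|x| ^+ 2.
Proof.
by move=> os; have := sqr_ge0 `|x - proj_seq s x|; rewrite norm_sub_proj// subr_ge0.
Qed.

(** Pythagoras: the residual of the projection is orthogonal to the span of [s]. *)
Lemma proj_seq_best s x (n : nat) (c : 'I_n -> R) (a : 'I_n -> H) :
  orthonormal_seq s -> (forall i, a i \in s) ->
  `|x - proj_seq s x| ^+ 2 <= `|x - \sum_(i < n) c i *: a i| ^+ 2.
Proof.
move=> os aS; set p := proj_seq s x; set y := \sum_(i < n) c i *: a i.
have orth : ip (x - p) (p - y) = 0.
  rewrite ipDr ipNr [ip _ p]ipC [ip _ y]ipC /y /p {1}/proj_seq !ip_suml.
  rewrite big_seq big1 => [|b bs]; last by rewrite ipZl [ip _ (x - _)]ipC (proj_seq_ortho x os bs) mulr0.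
  by rewrite big1 ?subr0// => i _; rewrite ipZl [ip _ (x - _)]ipC (proj_seq_ortho x os (aS i)) mulr0.
have -> : x - y = (x - p) + (p - y) by rewrite addrA subrK.
move: (x - p) (p - y) orth => u v orth.
rewrite -[X in _ <= X]ipE ipDl !ipDr orth (ipC v) orth addr0 add0r !ipE.
by rewrite lerDl sqr_ge0.
Qed.

Section GramSchmidt.
Variable d : nat -> H.

(** Vectors are only ever appended, and zero residuals skipped, so the lists increase with [n] and
    their union is orthonormal. *)
Fixpoint gram_schmidt (n : nat) : seq H :=
  if n is m.+1 then
    let r := d m - proj_seq (gram_schmidt m) (d m) in
    if r == 0 then gram_schmidt m else rcons (gram_schmidt m) (`|r|^-1 *: r)
  else [::].

Lemma gram_schmidt_orthonormal n : orthonormal_seq (gram_schmidt n).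
Proof.
elim: n => [|n IH] /=; first by split.
set r := d n - _; case: ifPn => // r0.
have nr0 : `|r| != 0 by rewrite normr_eq0.
have e1 : ip (`|r|^-1 *: r) (`|r|^-1 *: r) = 1.
  by rewrite ipZl ipZr ipE; field.
have e2 b : b \in gram_schmidt n -> ip (`|r|^-1 *: r) b = 0.
  by move=> bs; rewrite ipZl proj_seq_ortho// mulr0.
have [us s1 s2] := IH; split.
- rewrite rcons_uniq us andbT; apply/negP => /e2; rewrite e1 => /eqP.
  by rewrite oner_eq0.
- by move=> b; rewrite mem_rcons inE => /predU1P[->//|/s1].
- move=> b c; rewrite !mem_rcons !inE => /predU1P[->|bs] /predU1P[->|cs].
  + by rewrite eqxx.
  + by move=> _; exact: e2.
  + by move=> _; rewrite ipC e2.
  + exact: s2.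
Qed.

Lemma gram_schmidt_mono m n b : (m <= n)%N -> b \in gram_schmidt m -> b \in gram_schmidt n.
Proof.
move=> /subnK <-; elim: (n - m)%N => [//|k IH] /IH bk.
by rewrite addSn /=; case: ifP => // _; rewrite mem_rcons inE bk orbT.
Qed.

Lemma gram_schmidt_span n : nspan [set b | exists m, b \in gram_schmidt m] (d n).
Proof.
have [s [sm [c dE]]] : exists s, (forall b, b \in s -> exists m, b \in gram_schmidt m) /\
    exists c : H -> R, d n = \sum_(b <- s) c b *: b.
  (* Either [d n] is its own projection, or it is the projection plus [|r|] times the vector
     appended at stage [n.+1]. *)
  set r := d n - proj_seq (gram_schmidt n) (d n).
  have [r0|r0] := eqVneq r 0.
    exists (gram_schmidt n); split; first by move=> b bs; exists n.
    by exists (ip (d n)); apply/eqP; rewrite -subr_eq0 -/(proj_seq _ _) -/r r0.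
  have e1 : `|r|^-1 *: r \in gram_schmidt n.+1.
    by rewrite /= -/r (negbTE r0) mem_rcons inE eqxx.
  have [u _ _] := gram_schmidt_orthonormal n.+1.
  exists (gram_schmidt n.+1); split; first by move=> b bs; exists n.+1.
  exists (fun b => if b == `|r|^-1 *: r then `|r| else ip (d n) b).
  move: u; rewrite /= -/r (negbTE r0) rcons_uniq => /andP[rn _].
  rewrite big_rcons/= eqxx scalerA divff ?normr_eq0// scale1r.
  rewrite -[LHS](subrK (proj_seq (gram_schmidt n) (d n))) -/r addrC; congr (_ + _).
  rewrite /proj_seq big_seq [RHS]big_seq; apply: eq_bigr => b bs.
  by case: eqP => // bE; rewrite -bE bs in rn.
exists (size s), (fun i => c (nth 0 s i)), (fun i => nth 0 s i); split.
  by move=> i; apply: sm; exact: mem_nth.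
by rewrite dE (big_nth 0) big_mkord.
Qed.

End GramSchmidt.

(** Guarantees that the basis chosen in [hs_sq] is a true basis rather than the default [set0], for
    which every Hilbert-Schmidt norm would vanish. *)
Lemma orthonormal_basis_exists : (exists2 D : set H, countable D & dense D) ->
  exists B, orthonormal_basis ip B.
Proof.
move=> [D cD dD].
have D0 : D !=set0.
  have [x [_ Dx]] := dD setT (ex_intro _ 0 Logic.I) openT.
  by exists x.
have [d dDE] : exists d : nat -> H, D `<=` range d.
  have /pfcard_geP[D00|[d]] := cD; first by have := D0; rewrite D00 => -[].
  by exists d => x /(@surj _ _ _ _ d).
exists [set b | exists n, b \in gram_schmidt d n]; split.
- by move=> b [n bn]; have [_ H1 _] := gram_schmidt_orthonormal d n; exact: H1.
- move=> b c [n bn] [m cm] /eqP bc.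
  have [_ _ H2] := gram_schmidt_orthonormal d (maxn n m); apply: H2 => //.
    by apply: gram_schmidt_mono bn; exact: leq_maxl.
  by apply: gram_schmidt_mono cm; exact: leq_maxr.
apply/seteqP; split => // x _ U xU.
have := dD U^°; rewrite setIC.
have Ux : U^° x by exact: xU.
move=> /(_ (ex_intro _ x Ux) (open_interior _)) [y [Dy Uy]].
exists y; split; last exact: interior_subset.
by have [n _ <-] := dDE _ Dy; exact: gram_schmidt_span.
Qed.

End InnerProduct.

Section HilbertBasis.
Variables (R : realType) (H : completeNormedModType R).
Variable ip : {dot H for (@idfun R)}.
Hypothesis hH : separable_hilbert ip.
Implicit Types (x y h : H).

Let ipE x : ip x x = `|x| ^+ 2. Proof. by case: hH. Qed.

Definition hbasis : set H := xget set0 (orthonormal_basis ip).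

Lemma hbasisP : orthonormal_basis ip hbasis.
Proof.
have [_ sep] := hH; have [B oB] := orthonormal_basis_exists ipE sep.
exact: (xgetPex set0 (ex_intro _ B oB)).
Qed.

Lemma hbasis_orthonormal_seq (s : seq H) : uniq s -> (forall b, b \in s -> hbasis b) ->
  orthonormal_seq ip s.
Proof.
have [b1 b2 _] := hbasisP; move=> us sB; split => // [b /sB/b1//|b c /sB Bb /sB Bc /eqP bc].
exact: b2.
Qed.

Lemma ip_norm_le x y : `|ip x y| <= `|x| * `|y|.
Proof.
have [->|y0] := eqVneq y 0; first by rewrite ip0r !normr0 mulr0.
have ny : 0 < `|y| by rewrite normr_gt0.
pose b := `|y|^-1 *: y.
have os : orthonormal_seq ip [:: b].
  split => //; last first.
    by move=> ? ?; rewrite !inE => /eqP -> /eqP ->; rewrite eqxx.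
  move=> ?; rewrite inE => /eqP ->; rewrite /b ipZl ipZr ipE.
  by field; rewrite gt_eqF.
have := bessel_seq ipE x os; rewrite big_seq1 => xb.
have -> : ip x y = `|y| * ip x b.
  by rewrite /b ipZr mulrA divff ?gt_eqF// mul1r.
rewrite normrM normr_id mulrC ler_wpM2r//.
by rewrite -(ler_pXn2r (n := 2)) ?nnegrE// real_normK ?num_real.
Qed.

(** Distinct basis vectors are at distance at least 1, so choosing a point of the dense set within
    1/2 of each is injective. *)
Lemma hbasis_countable : countable hbasis.
Proof.
have [b1 b2 _] := hbasisP; have [_ [D cD dD]] := hH.
have /choice[g gP] : forall b, exists d, D d /\ `|b - d| < 1 / 2.
  move=> b; have [||d [bd Dd]] := dD (ball b (1 / 2)).
  - by exists b; apply: ballxx; rewrite divr_gt0.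
  - exact: ball_open.
  by exists d; split => //; move: bd; rewrite -ball_normE.
have /countable_injP[k kinj] := cD.
apply/countable_injP; exists (k \o g) => b c /set_mem Bb /set_mem Bc /= kgbc.
have gbc : g b = g c by apply: kinj kgbc; apply/mem_set; case: (gP b); case: (gP c).
apply: contrapT => bc.
have : `|b - c| < 1.
  rewrite -(subrKA (g b)) (le_lt_trans (ler_normD _ _))// (splitr 1) ltrD//.
    by case: (gP b).
  by rewrite gbc distrC; case: (gP c).
apply/negP; rewrite -leNgt -(ler_pXn2r (n := 2)) ?nnegrE// expr1n -ipE.
rewrite ipDl !ipDr !ipNl !ipNr b1// b1// (b2 _ _ Bb Bc bc) (b2 _ _ Bc Bb) ?oppr0 ?opprK; last by move=> /esym.
by rewrite addr0 add0r lerDl.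
Qed.

(** One inequality is Bessel's. For the other, a finite combination of basis vectors approximates
    [x], and the projection on the vectors it involves does at least as well. *)
Lemma esum_hbasis x : (\esum_(b in hbasis) (ip x b ^+ 2)%:E = (`|x| ^+ 2)%:E)%E.
Proof.
apply/eqP; rewrite eq_le; apply/andP; split.
  apply: ge_ereal_sup => _ [A [fA AB] <-].
  rewrite fsbig_finite//= sumEFin lee_fin; apply: bessel_seq => //.
  apply: hbasis_orthonormal_seq; first exact: finmap.fset_uniq.
  by move=> b; rewrite in_fset_set// inE; exact: AB.
apply/lee_addgt0Pr => e e0.
have [b1 b2 dB] := hbasisP.
have [y [[n [c [a [aB ->]]]] ya]] : exists y, nspan hbasis y /\ `|x - y| < Num.sqrt e.
  have xc : closure (nspan hbasis) x by rewrite dB.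
  have e1 : 0 < Num.sqrt e by rewrite sqrtr_gt0.
  have [y [yB xy]] := xc _ (nbhsx_ballx x _ e1).
  by exists y; split => //; move: xy; rewrite -ball_normE.
pose s := undup [seq a i | i <- enum 'I_n].
have as_ i : a i \in s by rewrite mem_undup map_f ?mem_enum.
have sB b : b \in s -> hbasis b by rewrite mem_undup => /mapP[i _ ->].
have os : orthonormal_seq ip s by apply: hbasis_orthonormal_seq => //; exact: undup_uniq.
have best := proj_seq_best ipE x c os as_.
apply: (@le_trans _ _ ((\sum_(b <- s) ip x b ^+ 2)%:E + e%:E)%E).
  rewrite -EFinD lee_fin -lerBlDl -norm_sub_proj// (le_trans best)//.
  by rewrite -[leRHS]sqr_sqrtr ?(ltW e0)// ltW// ltrXn2r ?nnegrE// ?sqrtr_ge0.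
rewrite leeD2r//; apply: ereal_sup_ubound; exists [set` s].
  by split; [exact: finite_seq|move=> b /sB].
by rewrite -fsbig_seq ?undup_uniq// sumEFin.
Qed.

(** The basis may be finite, so its enumeration is padded with the zero vector; hence the condition
    [a 0 = 0]. *)
Lemma hbasis_enum : exists e : nat -> H, (forall b, hbasis b -> exists n, e n = b) /\
  forall a : H -> \bar R, (forall h, (0 <= a h)%E) -> a 0 = 0%E ->
  (\esum_(b in hbasis) a b = \sum_(0 <= n <oo) a (e n))%E.
Proof.
have /countable_injP[g ginj] := hbasis_countable.
have /choice[e eP] : forall n, exists b, (hbasis b /\ g b = n) \/
    (b = 0 /\ forall c, hbasis c -> g c <> n).
  move=> n; have [[b Bb]|nB] := pselect (exists b, hbasis b /\ g b = n).
    by exists b; left.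
  by exists 0; right; split => // c Bc gc; apply: nB; exists c.
have eg b : hbasis b -> e (g b) = b.
  move=> Bb; have [[Be ge]|[_ /(_ _ Bb)//]] := eP (g b).
  by apply: ginj => //; apply/mem_set.
exists e; split=> [b /eg|a a0 a00]; first by exists (g b).
rewrite nneseries_esum//; apply/esym.
transitivity (\esum_(n in g @` hbasis) a (e n))%E.
  rewrite (_ : [set _ | _] = setT); last by apply/seteqP.
  rewrite [RHS]esum_mkcond; apply: eq_esum => n _.
  case: ifPn => // /negP nB; have [[Be ge]|[-> _]] := eP n; last by rewrite a00.
  by exfalso; apply: nB; apply/mem_set; exists (e n).
rewrite (reindex_esum hbasis _ g).
  by apply: eq_esum => b Bb; rewrite eg.
by split.
Qed.

Definition hseq : nat -> H := sval (cid hbasis_enum).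

Lemma hseq_surj b : hbasis b -> exists n, hseq n = b.
Proof. have [+ _] := svalP (cid hbasis_enum); exact. Qed.

Lemma esum_hseq (a : H -> \bar R) : (forall h, (0 <= a h)%E) -> a 0 = 0%E ->
  (\esum_(b in hbasis) a b = \sum_(0 <= n <oo) a (hseq n))%E.
Proof. have [_ +] := svalP (cid hbasis_enum); exact. Qed.

Lemma parseval x : (\sum_(0 <= n <oo) (ip x (hseq n) ^+ 2)%:E = (`|x| ^+ 2)%:E)%E.
Proof.
rewrite -esum_hbasis (esum_hseq (a := fun h => (ip x h ^+ 2)%:E))//.
  by move=> h; rewrite lee_fin sqr_ge0.
by rewrite ip0r expr0n.
Qed.

Lemma hs_sq_scalars (S : H -> R^o) : S 0 = 0 ->
  hs_sq ip (scalars R) S = (\sum_(0 <= n <oo) (S (hseq n) ^+ 2)%:E)%E.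
Proof.
move=> S0; rewrite -(esum_hseq (a := fun h => (S h ^+ 2)%:E)).
- by apply: eq_esum => b _; rewrite real_normK ?num_real.
- by move=> h; rewrite lee_fin sqr_ge0.
- by rewrite S0 expr0n.
Qed.

Lemma functional_eq0 (S : H -> R) (C : R) :
  (forall a x y, S (a *: x + y) = a * S x + S y) -> (forall x, `|S x| <= C * `|x|) ->
  (forall n, S (hseq n) = 0) -> forall x, S x = 0.
Proof.
move=> lin SC S0 x; have [_ _ dB] := hbasisP.
have s0 : S 0 = 0.
  by have := lin (-1) 0 0; rewrite scaler0 addr0 mulN1r addNr.
have span0 y : nspan hbasis y -> S y = 0.
  move=> [n [c [a [aB ->]]]]; elim: n c a aB => [|n IH] c a aB; first by rewrite big_ord0.
  rewrite big_ord_recl lin IH ?addr0//.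
  by have [m <-] := hseq_surj (aB ord0); rewrite S0 mulr0.
apply/eqP; rewrite -normr_le0; apply/ler_addgt0Pr => e e0; rewrite add0r.
have C1 : 0 < `|C| + 1 by rewrite ltr_wpDl.
have xc : closure (nspan hbasis) x by rewrite dB.
have [y [yB xy]] := xc _ (nbhsx_ballx x _ (divr_gt0 e0 C1)).
have SE : S x = S (x - y).
  by rewrite addrC -scaleN1r lin (span0 y yB) mulr0 add0r.
rewrite SE (le_trans (SC _))//.
apply: (@le_trans _ _ ((`|C| + 1) * `|x - y|)).
  by rewrite ler_wpM2r// (le_trans (ler_norm C))// lerDl.
rewrite mulrC -ler_pdivlMr// ltW//; move: xy; rewrite -ball_normE.
exact.
Qed.

Lemma hs_linear0 (S : H -> R^o) : carrier (hs_space ip (scalars R)) S -> S 0 = 0.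
Proof.
move=> [_ lin _ _]; have := lin (-1) 0 0.
by rewrite scaler0 addr0 scaleN1r addNr.
Qed.

Lemma hs_sq_scalars_ge0 (S : H -> R^o) : (0 <= hs_sq ip (scalars R) S)%E.
Proof. by apply: esum_ge0 => b _; rewrite lee_fin sqr_ge0. Qed.

Lemma hs_sq_scalarsB (S S' : H -> R^o) : S 0 = 0 -> S' 0 = 0 ->
  (hs_sq ip (scalars R) (S - S')%R <=
   2%:E * hs_sq ip (scalars R) S + 2%:E * hs_sq ip (scalars R) S')%E.
Proof.
move=> S0 S'0; rewrite !hs_sq_scalars//; last first.
  by have -> : (S - S') 0 = S 0 - S' 0 by []; rewrite S0 S'0 subrr.
rewrite -!nneseriesZl; last 2 first.
- by move=> n _; rewrite lee_fin sqr_ge0.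
- by move=> n _; rewrite lee_fin sqr_ge0.
rewrite -nneseriesD; last 2 first.
- by move=> n _ _; rewrite mule_ge0// lee_fin sqr_ge0.
- by move=> n _ _; rewrite mule_ge0// lee_fin sqr_ge0.
apply: lee_nneseries => n _; first by rewrite lee_fin sqr_ge0.
have -> : (S - S') (hseq n) = S (hseq n) - S' (hseq n) by [].
move: (S _) (S' _) => a b; rewrite -!EFinM -EFinD lee_fin -subr_ge0.
have -> : 2 * a ^+ 2 + 2 * b ^+ 2 - (a - b) ^+ 2 = (a + b) ^+ 2 by ring.
exact: sqr_ge0.
Qed.

Lemma hs_sq_scalars_ge (S : H -> R^o) n : S 0 = 0 ->
  ((S (hseq n) ^+ 2)%:E <= hs_sq ip (scalars R) S)%E.
Proof.
move=> S0; rewrite hs_sq_scalars//.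
apply: (@le_trans _ _ (\sum_(0 <= k < n.+1) (S (hseq k) ^+ 2)%:E)%E).
  by rewrite big_nat_recr//= leeDr// sume_ge0// => k _; rewrite lee_fin sqr_ge0.
by apply: nneseries_lim_ge => k _ _; rewrite lee_fin sqr_ge0.
Qed.

(** Makes each coordinate of a Hilbert-Schmidt valued process measurable; by Parseval the
    coordinates determine the squared norm, which is then measurable too. *)
Lemma hs_scalars_nopen n (c : R) :
  nopen (hs_space ip (scalars R)) [set S | S (hseq n) < c].
Proof.
move=> S SF /= Sc; exists (c - S (hseq n)); first by rewrite subr_gt0.
move=> S' S'F; have S0 := hs_linear0 SF; have S'0 := hs_linear0 S'F.
have D0 : (S' - S) 0 = 0 by have -> : (S' - S) 0 = S' 0 - S 0 by []; rewrite S0 S'0 subrr.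
have Dfin : (hs_sq ip (scalars R) (S' - S)%R < +oo)%E.
  apply: le_lt_trans (hs_sq_scalarsB S'0 S0) _.
  case: SF => _ _ _ SF; case: S'F => _ _ _ S'F.
  by rewrite lte_add_pinfty// lte_mul_pinfty// lee_fin.
have Dfn : hs_sq ip (scalars R) (S' - S) \is a fin_num.
  by rewrite ge0_fin_numE// hs_sq_scalars_ge0.
move=> /= SS'; rewrite -(ltrD2r (- S (hseq n))); apply: le_lt_trans SS'.
rewrite (le_trans (ler_norm _))// -sqrtr_sqr ler_sqrt; last first.
  by rewrite fine_ge0// hs_sq_scalars_ge0.
by rewrite -lee_fin fineK//; exact: (hs_sq_scalars_ge n D0).
Qed.

Lemma hs_norm_sqr (S : H -> R^o) : (hs_sq ip (scalars R) S < +oo)%E ->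
  ((nnorm (hs_space ip (scalars R)) S ^+ 2)%:E = hs_sq ip (scalars R) S)%E.
Proof.
move=> Sfin; rewrite /= sqr_sqrtr ?fineK ?fine_ge0 ?hs_sq_scalars_ge0//.
by rewrite ge0_fin_numE// hs_sq_scalars_ge0.
Qed.

End HilbertBasis.

(** * Itô isometry *)

Section SecondMoment.
Variable R : realType.
Local Notation mu := (@lebesgue_measure R).
Import HBNNSimple.

Lemma ge0_le_integral_density (N : measure (measurableTypeR R) R)
    (g : R -> R) (f : R -> \bar R) :
  measurable_fun [set: measurableTypeR R] g -> (forall x, 0 <= g x) ->
  (forall A : set (measurableTypeR R), measurable A ->
     N A = \int[mu]_(x in A) (g x)%:E)%E ->
  (forall x, 0 <= f x)%E ->
  (\int[N]_x f x <= \int[mu]_x (f x * (g x)%:E))%E.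
Proof.
move=> mg g0 hN f0.
rewrite ge0_integralTE//; apply: ge_ereal_sup => _ [h /= hf <-].
rewrite sintegralE.
apply: (@le_trans _ _ (\int[mu]_x ((h x)%:E * (g x)%:E))%E); last first.
  apply: ge0_le_integral_ae.
  - by move=> x _; rewrite mule_ge0// lee_fin.
  - by move=> x _; rewrite mule_ge0// lee_fin.
  - by apply: aeW => x _; apply: lee_wpmul2r; rewrite ?lee_fin.
rewrite [leRHS](_ : _ = \int[mu]_x (\sum_(r \in range h)
    ((r * \1_(h @^-1` [set r]) x)%:E * (g x)%:E)))%E; last first.
  apply: eq_integral => x _.
  rewrite -ge0_mule_fsuml; last by move=> r; rewrite EFinM nnfun_muleindic_ge0.
  by rewrite fsumEFin// -fimfunE.
rewrite ge0_integral_fsum//; last 2 first.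
  - move=> r; apply: emeasurable_funM; last exact/measurable_EFinP.
    exact/measurable_EFinP/measurable_funM.
  - by move=> r x _; apply: mule_ge0; [rewrite EFinM nnfun_muleindic_ge0 | rewrite lee_fin].
apply: lee_fsum => // r [x _ <-].
under eq_integral do rewrite EFinM -muleA.
rewrite ge0_integralZl//; last 3 first.
  - apply: emeasurable_funM; last exact/measurable_EFinP.
    exact/measurable_EFinP.
  - by move=> y _; rewrite mule_ge0// lee_fin.
  - by rewrite lee_fin.
rewrite lee_wpmul2l ?lee_fin//.
rewrite hN// [leLHS]integral_mkcond/= le_eqVlt; apply/orP; left; apply/eqP.
apply: eq_integral => y _; rewrite patchE indicE.
by case: ifPn => _; rewrite ?mul1e ?mul0e.
Qed.

Lemma normal_second_moment_lty :
  (\int[normal_prob 0 1]_y (y ^+ 2)%:E < +oo :> \bar R)%E.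
Proof.
apply: (@le_lt_trans _ _
    (\int[mu]_y ((y ^+ 2)%:E * (normal_pdf 0 1 y)%:E))%E).
  apply: (@ge0_le_integral_density (normal_prob 0 1) (normal_pdf 0 1)
    (fun y => (y ^+ 2)%:E)).
  - exact: measurable_normal_pdf.
  - by move=> x; exact: normal_pdf_ge0.
  - by [].
  - by move=> y; rewrite lee_fin sqr_ge0.
(* Since y^2 / 4 <= exp(y^2 / 4), the function y^2 exp(-y^2 / 2) is at most 4 exp(-y^2 / 4), a
   multiple of the normal density of variance 2. *)
pose s : R := Num.sqrt 2.
have s0 : s != 0 by rewrite sqrtr_eq0 -ltNge.
pose C : R := 4 * normal_peak 1 / normal_peak s.
have sp : 0 < normal_peak s by exact: normal_peak_gt0.
apply: (@le_lt_trans _ _ (\int[mu]_y (C%:E * (normal_pdf 0 s y)%:E))%E).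
  apply: ge0_le_integral_ae.
  - by move=> y _; rewrite -EFinM lee_fin mulr_ge0 ?sqr_ge0 ?normal_pdf_ge0.
  - move=> y _; rewrite -EFinM lee_fin mulr_ge0 ?normal_pdf_ge0//.
    by rewrite /C !mulr_ge0 ?invr_ge0 ?normal_peak_ge0.
  - apply: aeW => y _; rewrite -!EFinM lee_fin !normal_pdfE// /normal_fun subr0.
    rewrite /s sqr_sqrtr// -/s.
    rewrite /C expr1n.
    have -> : 4 * normal_peak 1 / normal_peak s * (normal_peak s *
        expR (- y ^+ 2 / (2 *+ 2))) =
        normal_peak 1 * (4 * expR (- y ^+ 2 / (2 *+ 2))).
      by field; rewrite gt_eqF.
    rewrite mulrCA ler_wpM2l ?normal_peak_ge0//.
    have e4 : y ^+ 2 / 4 <= expR (y ^+ 2 / 4).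
      by rewrite (le_trans _ (expR_ge1Dx _))// lerDr.
    rewrite (_ : - y ^+ 2 / (1 *+ 2) = - y ^+ 2 / (2 *+ 2) - y ^+ 2 / 4);
      last by lra.
    rewrite expRD expRN.
    have e0 := expR_gt0 (- y ^+ 2 / (2 *+ 2)).
    have e1 := expR_gt0 (y ^+ 2 / 4).
    rewrite mulrCA mulrC ler_pM2r// ler_pdivrMr//.
    lra.
rewrite ge0_integralZl//; last 3 first.
- by apply/measurable_EFinP; exact: measurable_normal_pdf.
- by move=> y _; rewrite lee_fin normal_pdf_ge0.
- by rewrite lee_fin /C !mulr_ge0 ?invr_ge0 ?normal_peak_ge0.
by rewrite integral_normal_pdf mule1 ltry.
Qed.

(** Otherwise the normal law would be concentrated at 0, a Lebesgue null set. *)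
Lemma normal_second_moment_gt0 :
  (0 < \int[normal_prob 0 1]_y (y ^+ 2)%:E :> \bar R)%E.
Proof.
rewrite lt_neqAle integral_ge0 ?andbT; last first.
  by move=> y _; rewrite lee_fin sqr_ge0.
apply/eqP => /esym h0.
have my : measurable_fun [set: measurableTypeR R] (fun y : R => (y ^+ 2)%:E).
  exact/measurable_EFinP/measurable_funX.
have : ae_eq (normal_prob 0 1) setT (fun y : R => (y ^+ 2)%:E) (cst 0%E).
  apply/ae_eq_integral_abs => //; rewrite -h0; apply: eq_integral => y _.
  by rewrite gee0_abs// lee_fin sqr_ge0.
move=> [A [mA NA hA]].
have N0 : normal_prob (0 : R) 1 [set 0] = 0%E.
  have /measure0_null_setP := lebesgue_measure_set1 (0 : R).
  by move=> /(_ (measurable_set1 _)) /normal_prob_dominates; exact.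
have : (normal_prob (0 : R) 1 [set: measurableTypeR R] <=
        normal_prob (0 : R) 1 A + normal_prob (0 : R) 1 [set 0%R : measurableTypeR R])%E.
  apply: (le_trans _ (measureU2 _ mA _)) => //.
  apply: le_measure; rewrite ?inE//; first exact: measurableU.
  move=> y _; have [->|y0] := eqVneq y 0; first by right.
  left; apply: hA => /= /(_ Logic.I) [] /eqP.
  by rewrite sqrf_eq0 (negbTE y0).
by rewrite NA N0 adde0 probability_setT lee_fin ler10.
Qed.
End SecondMoment.

(** * Independence of increments from the augmented past *)

Section Filtration.
Variables (R : realType) (d : measure_display) (Om : measurableType d).
Variable Q : probability Om R.
Variables (H : completeNormedModType R).
Variable W : R -> H -> Om -> R.
Hypothesis hW : wiener_basis Q W.

Lemma wiener_measurable t h : 0 <= t -> measurable_fun setT (W t h).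
Proof. by case: hW => _ [+ _ _ _ _] _; exact. Qed.

Lemma filtration_measurable s A : filtration Q W s A -> measurable A.
Proof.
apply: smallest_sub; first exact: sigma_algebra_measurable.
case: hW => Qc _ _ B [[t [h [B' [/= ts mB' ->]]]]|/Qc//].
rewrite -[X in measurable X]setTI; apply: wiener_measurable => //.
by move: ts; rewrite in_itv/= => /andP[].
Qed.

Lemma filtration_sub s u : s <= u -> filtration Q W s `<=` filtration Q W u.
Proof.
move=> su; apply: sub_sigma_algebra2.
move=> B [[t [h [B' [ts mB' ->]]]]|nB]; [left|by right].
exists t, h, B'; split => //; move: ts; rewrite /= !in_itv/= => /andP[-> ts].
exact: le_trans ts su.
Qed.

(** Independence is assumed for [past] only. The sets equal to a past set off a null set form a
    sigma-algebra that contains the generators of the augmented filtration. *)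
Lemma filtration_past s A : filtration Q W s A ->
  exists2 A', past W s A' &
    exists2 N, measurable N /\ Q N = 0%E & forall om, ~ N om -> (A om <-> A' om).
Proof.
pose near_past := [set A | exists2 A', past W s A' & exists2 N,
  measurable N /\ Q N = 0%E & forall om, ~ N om -> (A om <-> A' om)].
suff : filtration Q W s `<=` near_past by exact.
apply: smallest_sub => [|B [evB|[N [mN QN BN]]]]; last 2 first.
- by exists B; [exact: sub_sigma_algebra|exists set0; rewrite ?measure0].
- exists set0; first exact: sigma_algebra0.
  by exists N => // om nN; split => // /BN.
have [past0 pastD pastU] := smallest_sigma_algebra setT (wiener_events W `[0, s]).
split.
- by exists set0 => //; exists set0; rewrite ?measure0.
- move=> B [B' pB' [N mN BN]]; exists (setT `\` B'); first exact: pastD.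
  exists N => // om /BN h; split => -[_ nB]; split => // ?; apply: nB; exact/h.
- move=> F hF; have /choice[F' hF'] : forall n, exists A', past W s A' /\
    exists2 N, measurable N /\ Q N = 0%E & forall om, ~ N om -> (F n om <-> A' om).
    by move=> n; have [A' ? ?] := hF n; exists A'.
  have /choice[N hN] : forall n, exists N, [/\ measurable N, Q N = 0%E &
      forall om, ~ N om -> (F n om <-> F' n om)].
    by move=> n; have [_ [N [? ?] ?]] := hF' n; exists N.
  exists (\bigcup_n F' n); first by apply: pastU => n; case: (hF' n).
  exists (\bigcup_n N n).
    split; first by apply: bigcup_measurable => n _; case: (hN n).
    apply: measure_negligible.
      by apply: bigcup_measurable => n _; case: (hN n).
    apply: negligible_bigcup => n; apply/negligibleP; by case: (hN n).
  move=> om nN; split => -[n _ Fn]; exists n => //.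
    by have [_ _ /(_ om) h] := hN n; apply/h => // ?; apply: nN; exists n.
  by have [_ _ /(_ om) h] := hN n; apply/h => // ?; apply: nN; exists n.
Qed.

Lemma measure_eq_off_null (A B N : set Om) : measurable A -> measurable B ->
  measurable N -> Q N = 0%E -> (forall om, ~ N om -> (A om <-> B om)) ->
  Q A = Q B.
Proof.
move=> mA mB mN QN AB.
have le C D : measurable C -> measurable D ->
    (forall om, ~ N om -> C om -> D om) -> (Q C <= Q D)%E.
  move=> mC mD CD; rewrite -[leRHS]adde0 -QN.
  apply: le_trans (measureU2 _ mD mN).
  apply: le_measure; rewrite ?inE//; first exact: measurableU.
  by move=> om Com; have [|nN] := pselect (N om); [right|left; exact: CD].
by apply/eqP; rewrite eq_le; apply/andP; split; apply: le => // om /AB [].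
Qed.

Lemma increment_independent s t h (B : set (measurableTypeR R)) A :
  0 <= s -> s < t -> h != 0 -> measurable B -> filtration Q W s A ->
  Q (A `&` [set om | B (W t h om - W s h om)]) =
  (Q A * normal_prob 0 (Num.sqrt (t - s) * `|h|) B)%E.
Proof.
move=> s0 st h0 mB FA.
case: hW => _ [_ _ _ _ hinc] _.
have [/= <- hpast] := hinc s t h B s0 st h0 mB.
have t0 : 0 <= t by rewrite (le_trans s0)// ltW.
set E := [set om | _].
have mE : measurable E.
  rewrite -[X in measurable X]setTI.
  by apply: (measurable_funB (wiener_measurable h t0) (wiener_measurable h s0)).
have mA := filtration_measurable FA.
have [A' pA' [N [mN QN AA']]] := filtration_past FA.
have mA' : measurable A'.
  by apply: (@filtration_measurable s); apply: sub_sigma_algebra2 pA' => C ?; left.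
rewrite (@measure_eq_off_null A A' N)// -hpast//.
apply: (@measure_eq_off_null _ _ N) => //; [exact: measurableI..|].
by move=> om /AA' h'; split => -[? ?]; split => //; exact/h'.
Qed.

End Filtration.

Section Mean.
Variables (R : realType) (d : measure_display) (Om : measurableType d).
Variable Q : {measure set Om -> \bar R}.

(** Integrability travels with the value, so that linear combinations of expectations need no side
    conditions. *)
Definition mean (f : Om -> R) (r : R) : Prop :=
  Q.-integrable setT (EFin \o f) /\ (\int[Q]_om (f om)%:E = r%:E)%E.

Lemma mean_measurable f r : mean f r -> measurable_fun setT f.
Proof. by move=> [/measurable_int/measurable_EFinP]. Qed.

Lemma mean0 : mean (fun=> 0) 0.
Proof.
by split; [exact: integrable0|rewrite integral0].
Qed.

Lemma meanD f g r s : mean f r -> mean g s ->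
  mean (fun om => f om + g om) (r + s).
Proof.
move=> [f1 f2] [g1 g2]; split.
  by apply: eq_integrable (integrableD _ f1 g1) => // x _; rewrite /= EFinD.
under eq_integral do rewrite EFinD.
by rewrite integralD// f2 g2 EFinD.
Qed.

Lemma meanZ a f r : mean f r -> mean (fun om => a * f om) (a * r).
Proof.
move=> [f1 f2]; split.
  by apply: eq_integrable (integrableZl _ a f1) => // x _; rewrite /= EFinM.
under eq_integral do rewrite EFinM.
by rewrite integralZl// f2 EFinM.
Qed.

Lemma mean_sum n (f : 'I_n -> Om -> R) (r : 'I_n -> R) :
  (forall i, mean (f i) (r i)) ->
  mean (fun om => \sum_(i < n) f i om) (\sum_(i < n) r i).
Proof.
elim: n f r => [|n IH] f r fr.
  rewrite big_ord0 (_ : (fun om => _) = fun=> 0); first exact: mean0.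
  by apply/funext => om; rewrite big_ord0.
rewrite big_ord_recr (_ : (fun om => _) = fun om =>
    \sum_(i < n) f (widen_ord (leqnSn n) i) om + f ord_max om).
  by apply: meanD; [exact: IH|exact: fr].
by apply/funext => om; rewrite big_ord_recr.
Qed.

Lemma mean_ae f g r : measurable_fun setT g -> {ae Q, forall om, f om = g om} ->
  mean f r -> mean g r.
Proof.
move=> mg fg fr; have mf := mean_measurable fr; case: fr => f1 f2.
have fg' : ae_eq Q setT (EFin \o f) (EFin \o g).
  by apply: aeS fg => om /= -> _.
have mg' : measurable_fun setT (EFin \o g) by exact/measurable_EFinP.
have mf' : measurable_fun setT (EFin \o f) by exact/measurable_EFinP.
split; last by rewrite -f2; apply: ae_eq_integral => //; exact: ae_eq_sym.
apply/integrableP; split => //.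
rewrite -(@ae_eq_integral _ _ _ Q setT (fun om => `|(g om)%:E|)%E
  (fun om => `|(f om)%:E|)%E)//; last by apply: aeS fg => om /= -> _.
- by have /integrableP[] := f1.
- exact: measurableT_comp mf'.
- exact: measurableT_comp mg'.
Qed.

Lemma mean_eq f g r s : f =1 g -> r = s -> mean f r -> mean g s.
Proof. by move=> /funext -> ->. Qed.

Lemma mean_ge0 (f : Om -> R) r : measurable_fun setT f -> (forall om, 0 <= f om) ->
  (\int[Q]_om (f om)%:E = r%:E)%E -> mean f r.
Proof.
move=> mf f0 fr; split => //; apply/integrableP; split.
  exact/measurable_EFinP.
under eq_integral do rewrite /= ger0_norm//.
by rewrite fr ltry.
Qed.

Lemma integrable_mul_sqr (f g : Om -> R) r s : measurable_fun setT f ->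
  measurable_fun setT g -> mean (fun om => f om ^+ 2) r ->
  mean (fun om => g om ^+ 2) s -> Q.-integrable setT (EFin \o (f \* g)).
Proof.
move=> mf mg [f1 _] [g1 _].
apply: (le_integrable _ _ _ (integrableD _ f1 g1)) => //.
  exact/measurable_EFinP/measurable_funM.
move=> om _; rewrite /= lee_fin.
rewrite [leRHS]ger0_norm ?addr_ge0 ?sqr_ge0// normrM.
rewrite -(real_normK (num_real (f om))) -(real_normK (num_real (g om))).
have := sqr_ge0 (`|f om| - `|g om|).
have := normr_ge0 (f om); have := normr_ge0 (g om); nra.
Qed.

End Mean.

Section IndependentLaw.
Variables (R : realType) (d d1 d2 : measure_display) (Om : measurableType d).
Variables (T1 : measurableType d1) (T2 : measurableType d2).
Variables (Q : probability Om R) (N : probability T2 R).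
Variables (X : Om -> T1) (Y : Om -> T2).
Hypothesis mX : measurable_fun setT X.
Hypothesis mY : measurable_fun setT Y.
Hypothesis XY : forall A B, measurable A -> measurable B ->
  Q (X @^-1` A `&` Y @^-1` B) = (Q (X @^-1` A) * N B)%E.

Let law := distribution Q (mfun_Sub (mem_set mX) : {mfun Om >-> T1}).

Let mpair : measurable_fun setT (fun om => (X om, Y om)).
Proof. exact: measurable_fun_pair. Qed.

(** A measure that agrees with the product on rectangles is the product measure. *)
Let lawE E : measurable E ->
  (law \x N)%E E = pushforward Q (fun om => (X om, Y om)) E.
Proof.
move=> mE.
pose m' : {mfun Om >-> (T1 * T2)%type} := mfun_Sub (mem_set mpair).
rewrite (@product_measure_unique _ _ _ _ _ law N (distribution Q m'))//.
Qed.

Lemma ge0_integral_independent (f : T1 * T2 -> \bar R) : measurable_fun setT f ->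
  (forall z, 0 <= f z)%E ->
  (\int[Q]_om f (X om, Y om) = \int[Q]_om \int[N]_y f (X om, y))%E.
Proof.
move=> mf f0.
rewrite -(@ge0_integral_pushforward _ _ _ _ _ _ mpair Q setT f)//.
rewrite (eq_measure_integral (law \x N)%E); last first.
  by move=> A mA _; exact/esym/lawE.
rewrite fubini_tonelli1//= /law ge0_integral_pushforward//.
  exact: measurable_fun_fubini_tonelli_F.
by move=> y _; apply: integral_ge0.
Qed.

Lemma integral_independent (f : T1 * T2 -> \bar R) : measurable_fun setT f ->
  Q.-integrable setT (fun om => f (X om, Y om)) ->
  (\int[Q]_om f (X om, Y om) =
   \int[(distribution Q (mfun_Sub (mem_set mX) : {mfun Om >-> T1}) \x N)%E]_z
     f z)%E.
Proof.
move=> mf intf.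
rewrite -(@integral_pushforward _ _ _ _ _ _ mpair Q setT f)//.
by apply: eq_measure_integral => A mA _; exact/esym/lawE.
Qed.

End IndependentLaw.

(** * Covariances of Wiener increments *)

Section Increments.
Variables (R : realType) (d : measure_display) (Om : measurableType d).
Variable Q : probability Om R.
Variables (H : completeNormedModType R) (ip : {dot H for (@idfun R)}).
Hypothesis ipxx : forall x : H, ip x x = `|x| ^+ 2.
Variable W : R -> H -> Om -> R.
Hypothesis hW : wiener_basis Q W.
Local Notation filt := (filtration Q W).
Local Notation mean := (mean Q).

Definition increment (s t : R) (h : H) (om : Om) : R := W t h om - W s h om.

(* kappa is the variance 1 of a standard normal variable; only 0 < kappa < +oo
   matters, since the isometry is only needed up to a constant. *)
Definition kappa : R := fine (\int[normal_prob 0 1]_y (y ^+ 2)%:E)%E.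

Lemma kappaE : (\int[normal_prob 0 1]_y (y ^+ 2)%:E = kappa%:E)%E.
Proof.
rewrite fineK// ge0_fin_numE ?normal_second_moment_lty//.
by apply: integral_ge0 => y _; rewrite lee_fin sqr_ge0.
Qed.

Lemma kappa_gt0 : 0 < kappa.
Proof. by rewrite -lte_fin -kappaE normal_second_moment_gt0. Qed.

Lemma wiener_zero t : 0 <= t -> {ae Q, forall om, W t 0 om = 0}.
Proof.
case: hW => _ [_ lin _ _ _] _ t0.
apply: aeS (lin t 1 0 0 t0) => om; rewrite scaler0 addr0 mul1r => /eqP.
by rewrite -subr_eq0 opprD addrA subrr sub0r oppr_eq0 => /eqP.
Qed.

Lemma increment_measurable s t h : 0 <= s -> 0 <= t ->
  measurable_fun setT (increment s t h).
Proof.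
by move=> s0 t0; apply: measurable_funB; exact: (wiener_measurable hW).
Qed.

Lemma incrementD s t h k : 0 <= s -> 0 <= t -> {ae Q, forall om,
  increment s t (h + k) om = increment s t h om + increment s t k om}.
Proof.
case: hW => _ [_ lin _ _ _] _ s0 t0.
apply: aeS2 (lin s 1 h k s0) (lin t 1 h k t0) => om.
rewrite /increment scale1r !mul1r => -> ->; ring.
Qed.

Lemma wienerZ t a h : 0 <= t -> {ae Q, forall om, W t (a *: h) om = a * W t h om}.
Proof.
case: hW => _ [_ lin _ _ _] _ t0.
by apply: aeS2 (lin t a h 0 t0) (wiener_zero t0) => om; rewrite addr0 => -> ->;
  rewrite addr0.
Qed.

Lemma incrementZ s t a h : 0 <= s -> 0 <= t -> {ae Q, forall om,
  increment s t (a *: h) om = a * increment s t h om}.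
Proof.
move=> s0 t0; apply: aeS2 (wienerZ a h s0) (wienerZ a h t0) => om.
by rewrite /increment => -> ->; rewrite mulrBr.
Qed.

Section PastSpace.
Variables (s t : R) (h : H).
Hypotheses (s0 : 0 <= s) (st : s < t) (h0 : h != 0).

(** [Om] with the augmented past at [s] as its sigma-algebra. The identity map into it is the random
    element X of the independence lemmas, so that X stands for the whole past. *)
Local Notation past_type :=
  (g_sigma_algebraType (wiener_events W `[0, s] `|` [set N | Q.-negligible N])).

Let t0 : 0 <= t. Proof. by rewrite (le_trans s0)// ltW. Qed.

Let mid : measurable_fun setT (fun om : Om => om : past_type).
Proof.
by move=> _ B mB; rewrite setTI; exact: (filtration_measurable hW mB).
Qed.

Let indep k (k0 : k != 0) (A : set past_type) (B : set (measurableTypeR R)) :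
  measurable A -> measurable B ->
  Q ((fun om => om : past_type) @^-1` A `&` increment s t k @^-1` B) =
  (Q ((fun om => om : past_type) @^-1` A) *
   normal_prob 0 (Num.sqrt (t - s) * `|k|) B)%E.
Proof. by move=> mA mB; exact: (increment_independent hW). Qed.

Lemma increment_sqr_unit C : Num.sqrt (t - s) * `|h| = 1 -> filt s C ->
  mean (fun om => \1_C om * increment s t h om ^+ 2) (kappa * fine (Q C)).
Proof.
move=> h1 FC; have mC := filtration_measurable hW FC.
have mi := increment_measurable h s0 t0.
apply: mean_ge0.
- by apply: measurable_funM => //; exact: measurable_funX.
- by move=> om; rewrite mulr_ge0// sqr_ge0.
have mC' : measurable_fun setT (\1_C : past_type -> R).
  exact: measurable_indic.
pose f (z : past_type * measurableTypeR R) : \bar R := (\1_C z.1 * z.2 ^+ 2)%:E.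
have mf : measurable_fun setT f.
  apply/measurable_EFinP/measurable_funM.
    exact: measurableT_comp mC' measurable_fst.
  by apply: measurable_funX; exact: measurable_snd.
have f0 z : (0 <= f z)%E by rewrite lee_fin mulr_ge0// sqr_ge0.
have -> := @ge0_integral_independent _ _ _ _ _ past_type (measurableTypeR R) Q
  (normal_prob 0 (Num.sqrt (t - s) * `|h|)) _ (increment s t h) mid mi (indep h0)
  f mf f0.
rewrite /f/= h1.
rewrite (eq_integral (fun om => kappa%:E * (\1_C om)%:E)%E); last first.
  move=> om _; under eq_integral do rewrite EFinM.
  rewrite ge0_integralZl//.
  - by rewrite kappaE muleC.
  - exact/measurable_EFinP/measurable_funX.
  - by move=> y _; rewrite lee_fin sqr_ge0.
rewrite ge0_integralZl//.
- by rewrite integral_indic// setIT EFinM (fineK (fin_num_measure Q _ mC)).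
- exact/measurable_EFinP.
- by rewrite lee_fin ltW// kappa_gt0.
Qed.

(* The joint law of the past and of an increment is unchanged when the increment
   is replaced by its opposite, so the mean equals its own opposite. *)
Lemma mean_past_increment (X : Om -> R) r q :
  (forall B : set (measurableTypeR R), measurable B -> filt s (X @^-1` B)) ->
  mean (fun om => X om ^+ 2) r -> mean (fun om => increment s t h om ^+ 2) q ->
  mean (fun om => X om * increment s t h om) 0.
Proof.
move=> FX X2 i2.
have mi k : measurable_fun setT (increment s t k) := increment_measurable k s0 t0.
have mX : measurable_fun setT X.
  by move=> _ B mB; rewrite setTI; exact: (filtration_measurable hW (FX _ mB)).
have mX' : measurable_fun setT (X : past_type -> R).
  by move=> _ B mB; rewrite setTI; exact: FX.
have int := integrable_mul_sqr mX (mi h) X2 i2.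
split => //.
pose f (z : past_type * measurableTypeR R) : \bar R := (X z.1 * z.2)%:E.
have mf : measurable_fun setT f.
  apply/measurable_EFinP/measurable_funM.
    exact: measurableT_comp mX' measurable_fst.
  exact: measurable_snd.
have hN : - h != 0 by rewrite oppr_eq0.
have aeN : {ae Q, forall om, increment s t (- h) om = - increment s t h om}.
  by apply: aeS (incrementZ (-1) h s0 t0) => om; rewrite scaleN1r mulN1r.
have intN : Q.-integrable setT (fun om => f (om, increment s t (- h) om)).
  have [] // : mean (fun om => X om * increment s t (- h) om)
    (-1 * fine (\int[Q]_om (X om * increment s t h om)%:E)%E).
  apply: (@mean_ae _ _ _ _ (fun om => -1 * (X om * increment s t h om))).
  - exact: measurable_funM.
  - by apply: aeS aeN => om ->; rewrite mulrN mulN1r.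
  apply: meanZ; split => //.
  by rewrite fineK//; exact: integrable_fin_num.
have e1 := @integral_independent _ _ _ _ _ past_type (measurableTypeR R) Q
  (normal_prob 0 (Num.sqrt (t - s) * `|h|)) _ (increment s t h) mid (mi h)
  (indep h0) f mf int.
have e2 := @integral_independent _ _ _ _ _ past_type (measurableTypeR R) Q
  (normal_prob 0 (Num.sqrt (t - s) * `|- h|)) _ (increment s t (- h)) mid (mi _)
  (indep hN) f mf intN.
have e12 : (\int[Q]_om (X om * increment s t h om)%:E =
    \int[Q]_om (X om * increment s t (- h) om)%:E)%E.
  by rewrite -[LHS]/(\int[Q]_om f (om, increment s t h om))%E e1 -normrN -e2.
have I1 : (\int[Q]_om (X om * increment s t h om)%:E)%E \is a fin_num.
  exact: integrable_fin_num.
have e3 : (\int[Q]_om (X om * increment s t (- h) om)%:E =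
    - \int[Q]_om (X om * increment s t h om)%:E)%E.
  rewrite -integralN//; last first.
    by apply: integrable_add_def.
  apply: ae_eq_integral => //.
  - by apply/measurable_EFinP/measurable_funM.
  - by apply: measurableT_comp => //; exact/measurable_EFinP/measurable_funM.
  - by apply: aeS aeN => om -> _; rewrite mulrN EFinN.
move: e12; rewrite e3 => /eqP; rewrite -(fineK I1) -EFinN => /eqP [].
by set y := fine _; move=> hy; congr EFin; lra.
Qed.

End PastSpace.

Lemma increment_sqr s t h C : 0 <= s -> s <= t -> filt s C ->
  mean (fun om => \1_C om * increment s t h om ^+ 2)
    (kappa * (t - s) * `|h| ^+ 2 * fine (Q C)).
Proof.
move=> s0 st FC; have mC := filtration_measurable hW FC.
have t0 : 0 <= t by exact: le_trans st.
have mi k := increment_measurable k s0 t0.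
have mg : measurable_fun setT (fun om => \1_C om * increment s t h om ^+ 2).
  by apply: measurable_funM => //; exact: measurable_funX.
have [h0|h0] := eqVneq h 0.
  apply: (@mean_ae _ _ _ _ (fun=> 0)) => //.
    apply: aeS2 (wiener_zero s0) (wiener_zero t0) => om.
    by rewrite h0 /increment => -> ->; rewrite subrr expr0n mulr0.
  by apply: mean_eq (mean0 Q) => //; rewrite h0 normr0 expr0n mulr0 mul0r.
have [{}st|st'] := ltP s t; last first.
  have -> : t = s by apply/eqP; rewrite eq_le st'.
  apply: mean_eq (mean0 Q) => [om|]; last by rewrite subrr mulr0 !mul0r.
  by rewrite /increment subrr expr0n mulr0.
have ts : 0 < t - s by rewrite subr_gt0.
(* Rescaling [h] by the standard deviation reduces to a standard normal increment, whose second
   moment is [kappa]. *)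
pose c := Num.sqrt (t - s) * `|h|.
have c0 : 0 < c by rewrite mulr_gt0 ?sqrtr_gt0 ?normr_gt0.
pose e := c^-1 *: h.
have ce : c *: e = h by rewrite scalerA divff ?gt_eqF// scale1r.
have e0 : e != 0 by apply: contra_neq h0 => e0; rewrite -ce e0 scaler0.
have e1 : Num.sqrt (t - s) * `|e| = 1.
  rewrite normrZ gtr0_norm ?invr_gt0// mulrCA mulrC -/c.
  by rewrite mulfV// gt_eqF.
have := meanZ (c ^+ 2) (increment_sqr_unit s0 st e0 e1 FC).
move=> /(mean_eq (s := kappa * (t - s) * `|h| ^+ 2 * fine (Q C)) (frefl _)) m.
apply: (@mean_ae _ _ _ _ _ _ _ mg _ (m _)).
  apply: aeS (incrementZ c e s0 t0) => om; rewrite ce => ->; ring.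
rewrite /c exprMn sqr_sqrtr ?ltW//; ring.
Qed.

(** Polarisation of [increment_sqr]. *)
Lemma increment_covariance s t h k C : 0 <= s -> s <= t -> filt s C ->
  mean (fun om => \1_C om * (increment s t h om * increment s t k om))
    (kappa * (t - s) * ip h k * fine (Q C)).
Proof.
move=> s0 st FC; have mC := filtration_measurable hW FC.
have t0 : 0 <= t by exact: le_trans st.
have mi l := increment_measurable l s0 t0.
have mh := increment_sqr h s0 st FC.
have mk := increment_sqr k s0 st FC.
have mhk := increment_sqr (h + k) s0 st FC.
have := meanZ 2^-1 (meanD (meanD mhk (meanZ (-1) mh)) (meanZ (-1) mk)).
move=> /(mean_eq (s := kappa * (t - s) * ip h k * fine (Q C)) (frefl _)) m.
apply: mean_ae (m _).
- by apply: measurable_funM => //; exact: measurable_funM.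
- by apply: aeS (incrementD h k s0 t0) => om ->; field.
- by rewrite -!ipxx ipDl !ipDr (ipC ip k h); field.
Qed.

Lemma mean_disjoint_increments a b s t h k C : 0 <= a -> a <= b -> b <= s ->
  s <= t -> filt s C ->
  mean (fun om => \1_C om * (increment a b h om * increment s t k om)) 0.
Proof.
move=> a0 ab bs st FC; have mC := filtration_measurable hW FC.
have b0 : 0 <= b by exact: le_trans ab.
have s0 : 0 <= s by exact: le_trans bs.
have t0 : 0 <= t by exact: le_trans st.
have mg : measurable_fun setT
    (fun om => \1_C om * (increment a b h om * increment s t k om)).
  by apply: measurable_funM => //; apply: measurable_funM;
    exact: increment_measurable.
have [k0|k0] := eqVneq k 0.
  apply: (@mean_ae _ _ _ _ (fun=> 0)) (mean0 Q) => //.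
  apply: aeS2 (wiener_zero s0) (wiener_zero t0) => om.
  by rewrite k0 /increment => -> ->; rewrite subrr !mulr0.
have [{}st|st'] := ltP s t; last first.
  have -> : t = s by apply/eqP; rewrite eq_le st'.
  apply: mean_eq (mean0 Q) => // om.
  by rewrite /increment subrr !mulr0.
have FT u : filt u setT.
  have [h0 hC _] := smallest_sigma_algebra setT
    (wiener_events W `[0, u] `|` [set N | Q.-negligible N]).
  by have := hC _ h0; rewrite setD0.
(* The earlier factors form one variable known at time [s], which is multiplied by a later
   increment. *)
pose X om := \1_C om * increment a b h om.
have mX : measurable_fun setT X.
  by apply: measurable_funM => //; exact: increment_measurable.
apply: (mean_eq (f := fun om => X om * increment s t k om) _ erefl).
  by move=> om; rewrite mulrA.
have FX B : measurable B -> filt s (X @^-1` B).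
  pose past_type := g_sigma_algebraType
    (wiener_events W `[0, s] `|` [set N | Q.-negligible N]).
  have mW u l : 0 <= u <= s -> measurable_fun setT (W u l : past_type -> R).
    move=> us _ B' mB'; rewrite setTI; apply: sub_sigma_algebra; left.
    by exists u, l, B'.
  have mX' : measurable_fun setT (X : past_type -> R).
    apply: measurable_funM; first exact: measurable_indic.
    by apply: measurable_funB; apply: mW; rewrite ?b0 ?a0//= (le_trans ab).
  by move=> mB; rewrite -[X in filt s X]setTI; exact: mX'.
have [ih _] := increment_sqr h a0 ab (FT a).
apply: (mean_past_increment s0 st k0 FX (r := fine (\int[Q]_om (X om ^+ 2)%:E)%E)
  (q := kappa * (t - s) * `|k| ^+ 2 * fine (Q setT))); last first.
  apply: mean_eq (increment_sqr k s0 (ltW st) (FT s)) => // om.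
  by rewrite indicT mul1r.
have iX : Q.-integrable setT (fun om => (X om ^+ 2)%:E).
  apply: le_integrable ih => //.
    exact/measurable_EFinP/measurable_funX.
  move=> om _; rewrite /= indicT mul1r lee_fin exprMn normrM.
  rewrite ler_piMl// ger0_norm ?sqr_ge0// indicE.
by split => //; rewrite fineK//; exact: integrable_fin_num.
Qed.

Let mean_same_start a b b' h k C : 0 <= a -> a <= b -> b <= b' -> filt a C ->
  mean (fun om => \1_C om * (increment a b h om * increment a b' k om))
    (kappa * (b - a) * ip h k * fine (Q C)).
Proof.
move=> a0 ab bb' FC.
have b0 : 0 <= b by exact: le_trans ab.
have := meanD (increment_covariance h k a0 ab FC)
  (mean_disjoint_increments h k a0 ab (lexx b) bb' (filtration_sub ab FC)).
apply: mean_eq; last by rewrite addr0.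
by move=> om; rewrite /increment; ring.
Qed.

Let overlap (a b a' b' : R) := Num.max 0 (Num.min b b' - Num.max a a').

(** The first increment is split at [a']: the part before is uncorrelated with the second increment,
    the rest starts at the same time as it. If [b <= a'] only the first part is present. *)
Let mean_pair_le a b a' b' h k A B : 0 <= a -> a <= b -> a <= a' -> a' <= b' ->
  filt a A -> filt a' B ->
  mean (fun om => \1_A om * increment a b h om * (\1_B om * increment a' b' k om))
    (kappa * ip h k * overlap a b a' b' * fine (Q (A `&` B))).
Proof.
move=> a0 ab aa' ab' FA FB.
have a'0 : 0 <= a' by exact: le_trans aa'.
have FC : filt a' (A `&` B).
  exact: (@measurableI _ (g_sigma_algebraType (wiener_events W `[0, a']
    `|` [set N | Q.-negligible N])) A B (filtration_sub aa' FA) FB).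
have E f g : (fun om => \1_(A `&` B) om * (f om * g om)) =1
    (fun om => \1_A om * f om * (\1_B om * g om) : R).
  by move=> om; rewrite indicI /=; ring.
rewrite /overlap (max_r aa').
have [ba'|a'b] := leP b a'.
  apply: mean_eq (mean_disjoint_increments h k a0 ab ba' ab' FC) => [om|].
    by rewrite E.
  rewrite max_l ?mulr0 ?mul0r// subr_le0 ge_min ba'//.
have l1 := mean_disjoint_increments h k a0 aa' (lexx a') ab' FC.
have l2 : mean (fun om => \1_(A `&` B) om *
      (increment a' b h om * increment a' b' k om))
    (kappa * (Num.min b b' - a') * ip h k * fine (Q (A `&` B))).
  have [bb'|/ltW b'b] := leP b b'.
    by have := mean_same_start h k a'0 (ltW a'b) bb' FC.
  have := mean_same_start k h a'0 ab' b'b FC.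
  apply: mean_eq => [om|]; first ring.
  by rewrite (ipC ip k h).
have := meanD l1 l2; apply: mean_eq => [om|].
  by rewrite -E /increment; ring.
rewrite max_r ?subr_ge0 ?le_min ?(ltW a'b)//; ring.
Qed.

Lemma mean_increment_pair a b a' b' h k A B :
  0 <= a -> a <= b -> 0 <= a' -> a' <= b' -> filt a A -> filt a' B ->
  mean (fun om => \1_A om * increment a b h om * (\1_B om * increment a' b' k om))
    (kappa * ip h k * Num.max 0 (Num.min b b' - Num.max a a') *
     fine (Q (A `&` B))).
Proof.
move=> a0 ab a'0 ab' FA FB; have /orP[aa'|a'a] := le_total a a'.
  exact: mean_pair_le.
have := mean_pair_le k h a'0 ab' a'a ab FB FA.
apply: mean_eq => [om|]; first by rewrite mulrC.
by rewrite (ipC ip k h) /overlap (minC b') (maxC a') setIC.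
Qed.

End Increments.

(** * Isometry for simple integrands *)

Section SimpleIsometry.
Variables (R : realType) (d : measure_display) (Om : measurableType d).
Variable Q : probability Om R.
Variables (H : completeNormedModType R) (ip : {dot H for (@idfun R)}).
Hypothesis hH : separable_hilbert ip.
Variable W : R -> H -> Om -> R.
Hypothesis hW : wiener_basis Q W.
Local Notation mu := (@lebesgue_measure R).
Local Notation muQ := (mu \x Q)%E.
Local Notation stp := (step Om H (R^o : lmodType R)).

Let ipxx : forall x : H, ip x x = `|x| ^+ 2 := proj1 hH.

(** The Riesz vector of the functional [step_fun p s om]; by Parseval its norm is the
    Hilbert-Schmidt norm of the functional. *)
Definition step_vec (p : stp) (s : R) (om : Om) : H :=
  (\1_`]step_a p, step_b p] s * \1_(step_A p) om * (step_g p : R)) *: step_h p.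

Definition simple_vec n (p : 'I_n -> stp) s om := \sum_(i < n) step_vec (p i) s om.

Lemma simple_funE n (p : 'I_n -> stp) s om h :
  simple_fun ip p s om h = ip (simple_vec p s om) h.
Proof.
rewrite /simple_fun fct_sumE /simple_vec ip_suml; apply: eq_bigr => i _.
by rewrite /step_fun /step_vec ipZl /GRing.scale/=; ring.
Qed.

(** The quantity through which the isometry passes: the scalar product of two step integrands over
    [[0, t] x Om] and, up to [kappa], that of their integrals. *)
Definition step_cov (p q : stp) (t : R) : R :=
  ((step_g p : R) * step_g q) * ip (step_h p) (step_h q) *
  Num.max 0 (Num.min (Num.min (step_b p) (step_b q)) t
             - Num.max (step_a p) (step_a q)) *
  fine (Q (step_A p `&` step_A q)).

Lemma mean_step_int_pair p q t : 0 <= t ->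
  step_valid Q W (scalars R) p -> step_valid Q W (scalars R) q ->
  mean Q (fun om => (step_int W p t om : R) * step_int W q t om)
    (kappa R * step_cov p q t).
Proof.
move=> t0 [ap abp FA _] [aq abq FB _].
(* If [t] precedes the start of a step, its integral and the overlap both vanish; otherwise [t] only
   truncates the right endpoints. *)
have [tp|pt] := ltP t (step_a p).
  apply: mean_eq (mean0 Q) => [om|].
    rewrite /step_int (min_r (ltW tp)) (min_r (le_trans (ltW tp) abp)).
    by rewrite subrr mulr0 scale0r mul0r.
  rewrite /step_cov (max_l (y := _ - _)) ?mulr0 ?mul0r ?mulr0// subr_le0.
  by rewrite (le_trans (y := t)) ?ge_min ?lexx ?orbT// le_max (ltW tp).
have [tq|qt] := ltP t (step_a q).
  apply: mean_eq (mean0 Q) => [om|].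
    rewrite /(step_int W q) (min_r (ltW tq)) (min_r (le_trans (ltW tq) abq)).
    by rewrite subrr mulr0 scale0r mulr0.
  rewrite /step_cov (max_l (y := _ - _)) ?mulr0 ?mul0r ?mulr0// subr_le0.
  by rewrite (le_trans (y := t)) ?ge_min ?lexx ?orbT// le_max (ltW tq) orbT.
have bp : step_a p <= Num.min (step_b p) t by rewrite le_min abp.
have bq : step_a q <= Num.min (step_b q) t by rewrite le_min abq.
have := meanZ ((step_g p : R) * step_g q) (mean_increment_pair ipxx hW (step_h p)
  (step_h q) ap bp aq bq FA FB).
apply: mean_eq => [om|].
  rewrite /step_int /increment (min_l pt) (min_l qt) /GRing.scale/=; ring.
rewrite /step_cov minACA minxx; ring.
Qed.

Lemma mean_step_fun_pair p q t : 0 <= t ->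
  step_valid Q W (scalars R) p -> step_valid Q W (scalars R) q ->
  mean muQ (fun z => \1_`[0, t] z.1 *
      ip (step_vec p z.1 z.2) (step_vec q z.1 z.2)) (step_cov p q t).
Proof.
move=> t0 [ap abp FA _] [aq abq FB _].
have mA := filtration_measurable hW FA; have mB := filtration_measurable hW FB.
set c : R := ((step_g p : R) * step_g q) * ip (step_h p) (step_h q).
set A := step_A p `&` step_A q.
have mAB : measurable A by exact: measurableI.
pose J : set (measurableTypeR R) :=
  `]Num.max (step_a p) (step_a q),
    Num.min (Num.min (step_b p) (step_b q)) t]%classic.
have mJ : measurable J by exact: measurable_itv.
have m1 : mean muQ (fun z => \1_(J `*` A) z) (fine (mu J) * fine (Q A)).
  apply: mean_ge0 => //.
  - by apply: measurable_indic; exact: measurableX.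
  rewrite integral_indic ?setIT//; last exact: measurableX.
  transitivity (mu J * Q A)%E; first exact: product_measure1E.
  rewrite EFinM (fineK (fin_num_measure Q _ mAB)) fineK//.
  by rewrite /J lebesgue_measure_itv/=; case: ifP.
apply: mean_eq (meanZ c m1) => [z|].
  rewrite /step_vec ipZl ipZr//.
  (* The window costs nothing on the left, since steps start at nonnegative times; on the right it
     truncates the overlap at [t]. *)
  have -> : \1_(J `*` A) z = \1_`[0, t] z.1 * (\1_`]step_a p, step_b p] z.1 *
      \1_`]step_a q, step_b q] z.1) * (\1_(step_A p) z.2 * \1_(step_A q) z.2) :> R.
    rewrite !indicE -!natrM !mulnb; congr (_%:R); congr nat_of_bool.
    rewrite in_setX in_setI; case: (_ \in step_A p); rewrite ?andbF//.
    case: (_ \in step_A q); rewrite ?andbF ?andbT//.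
    rewrite /J !mem_setE !in_itv/= gt_max !le_min.
    apply/idP/idP => [/and3P[/andP[hp hq] /andP[-> ->] ->]|].
      by rewrite hp hq (le_trans ap (ltW hp)).
    by move=> /and3P[/andP[_ ->] /andP[-> ->] /andP[-> ->]].
  rewrite /c; ring.
rewrite /step_cov -/c -/A mulrA; congr (_ * _ * _).
rewrite /J lebesgue_measure_itv/= lte_fin.
move: (Num.max (step_a p) _) (Num.min _ t) => x y.
by case: (ltP x y) => h; [rewrite max_r ?subr_ge0 ?ltW|rewrite max_l ?subr_le0].
Qed.

Lemma simple_int_sqr n (p : 'I_n -> stp) t om : ((simple_int W p t om : R) ^+ 2 =
  \sum_(i < n) \sum_(j < n) (step_int W (p i) t om : R) * step_int W (p j) t om)%R.
Proof.
rewrite /simple_int expr2 mulr_suml; apply: eq_bigr => i _.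
by rewrite mulr_sumr.
Qed.

Lemma simple_isometry n (p : 'I_n -> stp) t : 0 <= t ->
  (forall i, step_valid Q W (scalars R) (p i)) ->
  exists2 r, mean Q (fun om => (simple_int W p t om : R) ^+ 2) (kappa R * r) &
    mean muQ (fun z => \1_`[0, t] z.1 * `|simple_vec p z.1 z.2| ^+ 2) r.
Proof.
move=> t0 vp; exists (\sum_(i < n) \sum_(j < n) step_cov (p i) (p j) t).
  have := mean_sum (fun i => mean_sum (fun j =>
    mean_step_int_pair t0 (vp i) (vp j))).
  apply: mean_eq => [om|]; first by rewrite simple_int_sqr.
  by rewrite mulr_sumr; apply: eq_bigr => i _; rewrite mulr_sumr.
have := mean_sum (fun i => mean_sum (fun j =>
  mean_step_fun_pair t0 (vp i) (vp j))).
apply: mean_eq => // z.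
rewrite -ipxx {2}/simple_vec ip_suml mulr_sumr; apply: eq_bigr => i _.
by rewrite (ipC ip _ (simple_vec _ _ _)) ip_suml mulr_sumr; apply: eq_bigr => j _;
  rewrite (ipC ip (step_vec (p j) _ _)).
Qed.

End SimpleIsometry.

Lemma measurable_fun_rays d (T : measurableType d) (R : realType) (D : set T)
    (f : T -> R) : measurable D ->
  (forall c, measurable (D `&` [set x | f x < c])) -> measurable_fun D f.
Proof.
move=> mD h; apply: (measurability _ (RGenInftyO.measurableE R)).
by move=> _ [_ [c ->] <-]; have := h c; congr measurable.
Qed.

(** * Mean-square distance of scalar integrands *)

Section ItoScalar.
Variables (R : realType) (d : measure_display) (Om : measurableType d).
Variable Q : probability Om R.
Variables (H : completeNormedModType R) (ip : {dot H for (@idfun R)}).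
Hypothesis hH : separable_hilbert ip.
Variable W : R -> H -> Om -> R.
Hypothesis hW : wiener_basis Q W.
Local Notation mu := (@lebesgue_measure R).
Local Notation muQ := (mu \x Q)%E.
Local Notation mR := (measurableTypeR R).
Local Notation stp := (step Om H (R^o : lmodType R)).
Local Notation HS := (hs_space ip (scalars R)).
Local Notation hsq := (hs_sq ip (scalars R)).
Variable t : R.
Hypothesis t0 : 0 <= t.
Implicit Types Psi : R -> Om -> H -> R^o.

(** What processes and simple integrands have in common, and all that the distance between
    integrands requires. *)
Definition hs_slices Psi : Prop :=
  (forall n, measurable_fun setT
     (fun z : mR * Om => \1_`[0, t] z.1 * (Psi z.1 z.2 (hseq hH n) : R))) /\
  forall s om, 0 <= s <= t -> carrier HS (Psi s om).

Definition hs_difference Psi Psi' (z : mR * Om) : H -> R^o :=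
  fun h => \1_`[0, t] z.1 * (Psi z.1 z.2 h - Psi' z.1 z.2 h : R).

Definition hs_distance Psi Psi' : \bar R :=
  (\int[muQ]_z hsq (hs_difference Psi Psi' z))%E.

Lemma hs_difference0 Psi Psi' z : hs_slices Psi -> hs_slices Psi' ->
  hs_difference Psi Psi' z 0 = 0.
Proof.
move=> [_ h] [_ h']; rewrite /hs_difference indicE mem_setE in_itv/=.
have [zt|] := boolP (0 <= z.1 <= t); last by rewrite mul0r.
by rewrite (hs_linear0 (h _ z.2 zt)) (hs_linear0 (h' _ z.2 zt)) subrr mulr0.
Qed.

Lemma measurable_hs_difference Psi Psi' : hs_slices Psi -> hs_slices Psi' ->
  measurable_fun setT (fun z => hsq (hs_difference Psi Psi' z)).
Proof.
move=> h h'.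
under eq_fun do rewrite (hs_sq_scalars hH (hs_difference0 _ h h')).
apply: ge0_emeasurable_sum => [n z _ _|n _]; first by rewrite lee_fin sqr_ge0.
apply/measurable_EFinP/measurable_funX.
under eq_fun do rewrite /hs_difference mulrBr.
by apply: measurable_funB; [case: h|case: h'].
Qed.

Lemma hs_distanceC Psi Psi' : hs_distance Psi Psi' = hs_distance Psi' Psi.
Proof.
apply: eq_integral => z _; apply: eq_esum => b _; congr EFin.
by rewrite /= /hs_difference -opprB mulrN normrN.
Qed.

(** Distances are kept squared, so the triangle inequality takes the form (a + b)^2 <= 2 a^2 + 2
    b^2; the factors are harmless in limits to 0. *)
Lemma hs_distance_le Psi Psi' Psi'' :
  hs_slices Psi -> hs_slices Psi' -> hs_slices Psi'' ->
  (hs_distance Psi Psi'' <=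
   2%:E * hs_distance Psi Psi' + 2%:E * hs_distance Psi' Psi'')%E.
Proof.
move=> h h' h''; rewrite (hs_distanceC Psi').
have m1 := measurable_hs_difference h h'.
have m2 := measurable_hs_difference h'' h'.
rewrite /hs_distance -!ge0_integralZl//; last 2 first.
- by move=> z _; exact: hs_sq_scalars_ge0.
- by move=> z _; exact: hs_sq_scalars_ge0.
rewrite -ge0_integralD//; last 4 first.
- by move=> z _; apply: mule_ge0 => //; exact: hs_sq_scalars_ge0.
- exact: measurable_funeM.
- by move=> z _; apply: mule_ge0 => //; exact: hs_sq_scalars_ge0.
- exact: measurable_funeM.
apply: ge0_le_integral_ae => [z _|z _|].
- exact: hs_sq_scalars_ge0.
- by apply: adde_ge0; apply: mule_ge0 => //; exact: hs_sq_scalars_ge0.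
apply: aeW => z _.
apply: le_trans (hs_sq_scalarsB hH (hs_difference0 z h h')
  (hs_difference0 z h'' h')).
rewrite le_eqVlt; apply/orP; left; apply/eqP; congr (hs_sq ip _ _).
apply/funext => k; rewrite -[RHS]/((hs_difference Psi Psi' z k : R) -
  hs_difference Psi'' Psi' z k) /hs_difference -mulrBr; congr (_ * _).
by rewrite opprB addrA subrK.
Qed.

Lemma process_slices Psi : process Q W HS `[0, t] Psi -> hs_slices Psi.
Proof.
move=> [cP _ mP]; split=> [n|s om st]; last first.
  by apply: cP; rewrite /= in_itv.
pose D : set (mR * Om) := `[0, t]%classic `*` setT.
have mD : measurable D by apply: measurableX => //; exact: measurable_itv.
rewrite (_ : (fun z => _) =
    (fun z : mR * Om => Psi z.1 z.2 (hseq hH n) : R) \_ D).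
  apply/(measurable_restrictT _ mD); apply: measurable_fun_rays => // c.
  exact: mP (@hs_scalars_nopen _ _ _ hH n c).
apply/funext => z; rewrite patchE indicE /D in_setX in_setT andbT.
by case: (_ \in _); rewrite ?mul1r ?mul0r.
Qed.

Lemma simple_slices n (p : 'I_n -> stp) :
  (forall i, step_valid Q W (scalars R) (p i)) -> hs_slices (simple_fun ip p).
Proof.
move=> vp; split => [k|s om st].
  apply: measurable_funM.
    apply: measurableT_comp measurable_fst.
    exact: measurable_indic.
  rewrite (_ : (fun z => _) = fun z : mR * Om => \sum_(i < n)
      (\1_`]step_a (p i), step_b (p i)] z.1 * \1_(step_A (p i)) z.2 *
       (ip (step_h (p i)) (hseq hH k) * step_g (p i) : R))).
    apply: measurable_sum => i; apply: measurable_funM => //.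
    have [_ _ FA _] := vp i; have mA := filtration_measurable hW FA.
    apply: measurable_funM.
      exact: measurableT_comp measurable_fst.
    exact: measurableT_comp measurable_snd.
  apply/funext => z; rewrite /simple_fun fct_sumE; apply: eq_bigr => i _.
  by rewrite /step_fun /GRing.scale/=; ring.
split => // [a h k||].
- by rewrite !simple_funE (ipDr ip) ipZr.
- exists `|simple_vec p s om| => h; rewrite simple_funE/=.
  exact: ip_norm_le.
- rewrite (hs_sq_scalars hH) ?simple_funE ?ip0r//.
  by under eq_eseriesr do rewrite simple_funE; rewrite parseval ltry.
Qed.

Lemma L2_integrandE Psi Psi' : hs_slices Psi -> hs_slices Psi' ->
  L2_integrand Q ip (scalars R) (fun s om => Psi s om - Psi' s om) t =
  hs_distance Psi Psi'.
Proof.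
move=> h h'.
rewrite /hs_distance fubini_tonelli2; last 2 first.
- exact: measurable_hs_difference.
- by move=> z; exact: hs_sq_scalars_ge0.
apply: eq_integral => om _; rewrite /fubini_G [LHS]integral_mkcond.
apply: eq_integral => s _; rewrite patchE /hs_difference/= indicE.
case: ifPn => [st|_]; last first.
  rewrite (hs_sq_scalars hH) ?mul0r//.
  by rewrite eseries0// => n _ _; rewrite mul0r expr0n.
have st' : 0 <= s <= t by move: st; rewrite mem_setE in_itv.
rewrite hs_norm_sqr.
  by congr (hs_sq ip _ _); apply/funext => k; rewrite mul1r.
have [c1 c2] := (h.2 s om st', h'.2 s om st').
apply: le_lt_trans (hs_sq_scalarsB hH (hs_linear0 c1) (hs_linear0 c2)) _.
have [_ _ _ f1] := c1; have [_ _ _ f2] := c2.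
by apply: lte_add_pinfty; apply: lte_mul_pinfty.
Qed.

End ItoScalar.

Section ItoUniqueness.
Variables (R : realType) (d : measure_display) (Om : measurableType d).
Variable Q : probability Om R.
Variables (H : completeNormedModType R) (ip : {dot H for (@idfun R)}).
Hypothesis hH : separable_hilbert ip.
Variable W : R -> H -> Om -> R.
Hypothesis hW : wiener_basis Q W.
Local Notation mu := (@lebesgue_measure R).
Local Notation muQ := (mu \x Q)%E.
Local Notation mR := (measurableTypeR R).
Local Notation stp := (step Om H (R^o : lmodType R)).
Local Notation HS := (hs_space ip (scalars R)).
Variable t : R.
Hypothesis t0 : 0 <= t.
Local Notation dist := (hs_distance Q ip t).

Definition sqr_distance (X Y : Om -> R) : \bar R :=
  (\int[Q]_om ((X om - Y om) ^+ 2)%:E)%E.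

Lemma sqr_distanceC X Y : sqr_distance X Y = sqr_distance Y X.
Proof. by apply: eq_integral => om _; rewrite -sqrrN opprB. Qed.

Lemma sqr_distance_le X Y Z : measurable_fun setT X -> measurable_fun setT Y ->
  measurable_fun setT Z ->
  (sqr_distance X Z <= 2%:E * sqr_distance X Y + 2%:E * sqr_distance Y Z)%E.
Proof.
move=> mX mY mZ.
have mB (U V : Om -> R) : measurable_fun setT U -> measurable_fun setT V ->
    measurable_fun setT (fun om => ((U om - V om) ^+ 2)%:E).
  move=> mU mV; apply/measurable_EFinP/measurable_funX.
  exact: measurable_funB.
rewrite /sqr_distance -!ge0_integralZl//; last 4 first.
- exact: mB.
- by move=> om _; rewrite lee_fin sqr_ge0.
- exact: mB.
- by move=> om _; rewrite lee_fin sqr_ge0.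
rewrite -ge0_integralD//; last 4 first.
- by move=> om _; rewrite mule_ge0// lee_fin sqr_ge0.
- by apply: measurable_funeM; exact: mB.
- by move=> om _; rewrite mule_ge0// lee_fin sqr_ge0.
- by apply: measurable_funeM; exact: mB.
apply: ge0_le_integral_ae => [om _|om _|].
- by rewrite lee_fin sqr_ge0.
- by rewrite adde_ge0// mule_ge0// lee_fin sqr_ge0.
apply: aeW => om _; rewrite -!EFinM -EFinD lee_fin -subr_ge0.
have := sqr_ge0 (X om - Y om - (Y om - Z om)); lra.
Qed.

Lemma sqr_distance_eq0 X Y : measurable_fun setT X -> measurable_fun setT Y ->
  (sqr_distance X Y <= 0)%E -> {ae Q, forall om, X om = Y om}.
Proof.
move=> mX mY h0.
have m2 : measurable_fun setT (fun om => ((X om - Y om) ^+ 2)%:E).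
  by apply/measurable_EFinP/measurable_funX; exact: measurable_funB.
have : ae_eq Q setT (fun om => ((X om - Y om) ^+ 2)%:E) (cst 0%E).
  apply/ae_eq_integral_abs => //; apply/eqP.
  rewrite eq_le integral_ge0// andbT; apply: le_trans h0.
  by under eq_integral do rewrite gee0_abs ?lee_fin ?sqr_ge0//.
apply: aeS => om /(_ Logic.I) [] /eqP; rewrite sqrf_eq0 subr_eq0.
by move/eqP.
Qed.

Definition neg_step (p : stp) : stp :=
  Step (step_a p) (step_b p) (step_A p) (step_h p) (- step_g p).

(** A difference of simple integrands is simple, so the isometry for one integrand controls the
    distance of two. *)
Lemma simple_sub n m (p : 'I_n -> stp) (q : 'I_m -> stp) :
  (forall i, step_valid Q W (scalars R) (p i)) ->
  (forall i, step_valid Q W (scalars R) (q i)) ->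
  exists r : 'I_(n + m) -> stp, [/\ forall i, step_valid Q W (scalars R) (r i),
    forall om, simple_int W r t om = simple_int W p t om - simple_int W q t om
  & forall s om h, simple_fun ip r s om h =
      simple_fun ip p s om h - simple_fun ip q s om h].
Proof.
move=> vp vq.
pose r (i : 'I_(n + m)) := match fintype.split i with inl j => p j | inr j => neg_step (q j) end.
have rl j : r (lshift m j) = p j by rewrite /r (fintype.unsplitK (inl j)).
have rr j : r (rshift n j) = neg_step (q j) by rewrite /r (fintype.unsplitK (inr j)).
exists r; split.
- move=> i; rewrite -(fintype.splitK i); case: (fintype.split i) => j /=; rewrite ?rl ?rr//.
  by have [? ? ? ?] := vq j; split.
- move=> om; rewrite /simple_int big_split_ord/=; congr (_ + _).
    by apply: eq_bigr => i _; rewrite rl.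
  by rewrite -sumrN; apply: eq_bigr => i _; rewrite rr /step_int/= scalerN.
- move=> s om h; rewrite /simple_fun !fct_sumE big_split_ord/=; congr (_ + _).
    by apply: eq_bigr => i _; rewrite rl.
  by rewrite -sumrN; apply: eq_bigr => i _; rewrite rr /step_fun/= scalerN.
Qed.

Lemma simple_distance n m (p : 'I_n -> stp) (q : 'I_m -> stp) :
  (forall i, step_valid Q W (scalars R) (p i)) ->
  (forall i, step_valid Q W (scalars R) (q i)) ->
  sqr_distance (simple_int W p t) (simple_int W q t) =
  ((kappa R)%:E * dist (simple_fun ip p) (simple_fun ip q))%E.
Proof.
move=> vp vq; have [r [vr rI rF]] := simple_sub vp vq.
have [c [_ mI] [_ mF]] := simple_isometry hH hW t0 vr.
transitivity (kappa R * c)%:E.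
  by rewrite -mI; apply: eq_integral => om _; rewrite rI.
rewrite EFinM -mF; congr (_ * _)%E; apply: eq_integral => z _.
rewrite (hs_sq_scalars hH); last first.
  by rewrite /hs_difference !simple_funE !ip0r subrr mulr0.
have -> : \1_`[0, t] z.1 * `|simple_vec r z.1 z.2| ^+ 2 =
    `|\1_`[0, t] z.1 *: simple_vec r z.1 z.2| ^+ 2.
  rewrite normrZ exprMn indicE; case: (_ \in _); rewrite ?normr1 ?normr0;
  by rewrite ?expr1n ?expr0n ?mul0r ?mul1r.
rewrite -(parseval hH); apply: eq_eseriesr => k _.
by rewrite /hs_difference -rF simple_funE ipZl.
Qed.


Lemma ito_approximation Psi (X : Om -> R^o) :
  ito_integral Q ip W (scalars R) Psi t X ->
  [/\ hs_slices hH t Psi, measurable_fun setT (X : Om -> R) &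
  exists (n : nat -> nat) (p : forall k, 'I_(n k) -> stp),
    [/\ forall k i, step_valid Q W (scalars R) (p k i),
        (fun k => dist (simple_fun ip (p k)) Psi) @ \oo --> 0%E &
        (fun k => sqr_distance (simple_int W (p k) t) X) @ \oo --> 0%E]].
Proof.
move=> [proc _ [_ bX] [n [p [vp cF cI]]]].
have sP := process_slices hH proc.
split => //.
  apply: measurable_fun_rays => // c; rewrite setTI.
  have : filtration Q W t (setT `&` X @^-1` [set x | (x : R) < c]).
    apply: bX => x _ /= xc; exists (c - x); first by rewrite subr_gt0.
    by move=> y _ /=; rewrite ltr_norml => /andP[_]; rewrite ltrBlDr subrK.
  by rewrite setTI; exact: (filtration_measurable hW).
exists n, p; split => //.
  suff -> : (fun k => dist (simple_fun ip (p k)) Psi) = fun k =>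
      L2_integrand Q ip (scalars R)
        (fun s om => simple_fun ip (p k) s om - Psi s om) t by exact: cF.
  apply/funext => k.
  by rewrite (L2_integrandE Q (simple_slices hH hW t (vp k)) sP).
suff -> : (fun k => sqr_distance (simple_int W (p k) t) X) = fun k => (\int[Q]_om
    ((nnorm (scalars R) (simple_int W (p k) t om - X om)) ^+ 2)%:E)%E by exact: cI.
apply/funext => k.
by apply: eq_integral => om _; rewrite /= real_normK ?num_real.
Qed.

Let cvg_comb (a b : nat -> \bar R) : a @ \oo --> 0%E -> b @ \oo --> 0%E ->
  (fun k => 2%:E * a k + 2%:E * b k)%E @ \oo --> 0%E.
Proof.
move=> a0 b0; rewrite -[X in _ --> X](_ : 2%:E * 0 + 2%:E * 0 = 0 :> \bar R)%E.
  by apply: cvgeD => //; apply: cvgeZl.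
by rewrite !mule0 adde0.
Qed.

Section TwoIntegrals.
Variables (Psi Psi' : R -> Om -> H -> R^o) (X X' : Om -> R^o).
Hypothesis itoX : ito_integral Q ip W (scalars R) Psi t X.
Hypothesis itoX' : ito_integral Q ip W (scalars R) Psi' t X'.

Let simple_measurable n (p : 'I_n -> stp) :
  (forall i, step_valid Q W (scalars R) (p i)) ->
  measurable_fun setT (simple_int W p t : Om -> R).
Proof.
move=> vp; rewrite (_ : simple_int W p t = fun om => \sum_(i < n)
    (\1_(step_A (p i)) om * increment W (Num.min (step_a (p i)) t)
      (Num.min (step_b (p i)) t) (step_h (p i)) om * (step_g (p i) : R))).
  apply: measurable_sum => i; apply: measurable_funM => //.
  have [a0 ab FA _] := vp i; have mA := filtration_measurable hW FA.
  apply: measurable_funM => //.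
  by apply: (increment_measurable hW); rewrite le_min ?a0 ?(le_trans a0 ab).
by apply/funext => om.
Qed.

(** Passing from Psi to Psi' through approximating simple integrands, the middle distance is by the
    isometry a multiple of that between their integrals, which tend to X and X' and thus to the same
    limit. All coordinates of Psi - Psi' then vanish almost everywhere. *)
Lemma ito_integrand_unique : {ae Q, forall om, X om = X' om} ->
  {ae muQ, forall z, 0 <= z.1 <= t -> forall h, Psi z.1 z.2 h = Psi' z.1 z.2 h}.
Proof.
move=> XX'.
have [sP mX [n [p [vp cF cI]]]] := ito_approximation itoX.
have [sP' mX' [n' [p' [vp' cF' cI']]]] := ito_approximation itoX'.
have k0 := kappa_gt0 R.
have d0 : (dist Psi Psi' <= 0)%E.
  have c1 : (fun k => (kappa R)^-1%:E * (2%:E * sqr_distance (simple_int W (p k) t) X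
      + 2%:E * sqr_distance (simple_int W (p' k) t) X'))%E @ \oo --> 0%E.
    rewrite -[X in _ --> X](mule0 ((kappa R)^-1%:E)).
    by apply: cvgeZl => //; exact: cvg_comb.
  apply: (cvge_to_ge (cvg_comb cF (cvg_comb c1 cF'))); apply: nearW => k.
  have s1 := simple_slices hH hW t (vp k).
  have s2 := simple_slices hH hW t (vp' k).
  apply: le_trans (hs_distance_le Q sP s1 sP') _.
  rewrite (hs_distanceC _ _ _ Psi); apply: leeD2l; apply: lee_wpmul2l => //.
  apply: le_trans (hs_distance_le Q s1 s2 sP') _.
  apply: leeD2r; apply: lee_wpmul2l => //.
  have -> : (dist (simple_fun ip (p k)) (simple_fun ip (p' k)) = (kappa R)^-1%:E *
      ((kappa R)%:E * dist (simple_fun ip (p k)) (simple_fun ip (p' k))))%E.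
    by rewrite muleA -EFinM (mulVf (lt0r_neq0 k0)) mul1e.
  rewrite -simple_distance//; apply: lee_wpmul2l.
    by rewrite lee_fin invr_ge0 ltW.
  apply: le_trans (sqr_distance_le (simple_measurable (vp k)) mX
    (simple_measurable (vp' k))) _.
  apply: leeD2l; apply: lee_wpmul2l => //; rewrite sqr_distanceC.
  apply: ge0_le_integral_ae => [om _|om _|]; rewrite ?lee_fin ?sqr_ge0//.
  by apply: aeS XX' => om -> _.
have md := measurable_hs_difference sP sP'.
have : ae_eq muQ setT (fun z => hs_sq ip (scalars R) (hs_difference t Psi Psi' z))
    (cst 0%E).
  apply/ae_eq_integral_abs => //; apply/eqP.
  rewrite eq_le integral_ge0// andbT; apply: le_trans d0.
  by under eq_integral do rewrite gee0_abs ?hs_sq_scalars_ge0//.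
apply: aeS => z /(_ Logic.I) /= z0 zt h.
have [cP cP'] := (sP.2 z.1 z.2 zt, sP'.2 z.1 z.2 zt).
have [_ l1 [C1 b1] _] := cP; have [_ l2 [C2 b2] _] := cP'.
apply/eqP; rewrite -subr_eq0; apply/eqP.
apply: (@functional_eq0 _ _ _ hH (fun h => Psi z.1 z.2 h - Psi' z.1 z.2 h : R)
  (C1 + C2)) => [a x y|x|k].
- by rewrite l1 l2 /GRing.scale/=; ring.
- rewrite mulrDl; apply: le_trans (ler_normB _ _) _.
  by apply: lerD; [exact: b1|exact: b2].
have /(_ k) := hs_sq_scalars_ge hH (S := hs_difference t Psi Psi' z).
move=> /(_ (hs_difference0 z sP sP')).
rewrite z0 lee_fin /hs_difference indicE mem_setE in_itv/= zt mul1r => h0.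
by apply/eqP; rewrite -sqrf_eq0 eq_le h0 sqr_ge0.
Qed.

(** The same chain with integrals and integrands exchanged. *)
Lemma ito_integral_unique :
  {ae muQ, forall z, 0 <= z.1 <= t -> forall h, Psi z.1 z.2 h = Psi' z.1 z.2 h} ->
  {ae Q, forall om, X om = X' om}.
Proof.
move=> PP'.
have [sP mX [n [p [vp cF cI]]]] := ito_approximation itoX.
have [sP' mX' [n' [p' [vp' cF' cI']]]] := ito_approximation itoX'.
apply: sqr_distance_eq0 => //.
have c1 : (fun k => (kappa R)%:E * (2%:E * dist (simple_fun ip (p k)) Psi
    + 2%:E * dist (simple_fun ip (p' k)) Psi'))%E @ \oo --> 0%E.
  rewrite -[X in _ --> X](mule0 (kappa R)%:E).
  by apply: cvgeZl => //; exact: cvg_comb.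
apply: (cvge_to_ge (cvg_comb cI (cvg_comb c1 cI'))); apply: nearW => k.
have s1 := simple_slices hH hW t (vp k).
have s2 := simple_slices hH hW t (vp' k).
have m1 := simple_measurable (vp k); have m2 := simple_measurable (vp' k).
apply: le_trans (sqr_distance_le mX m1 mX') _.
rewrite (sqr_distanceC X); apply: leeD2l; apply: lee_wpmul2l => //.
apply: le_trans (sqr_distance_le m1 m2 mX') _.
apply: leeD2r; apply: lee_wpmul2l => //.
rewrite simple_distance//; apply: lee_wpmul2l.
  by rewrite lee_fin ltW// kappa_gt0.
apply: le_trans (hs_distance_le Q s1 sP s2) _.
apply: leeD2l; apply: lee_wpmul2l => //; rewrite hs_distanceC.
apply: ge0_le_integral_ae => [z _|z _|]; rewrite ?hs_sq_scalars_ge0//.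
apply: aeS PP' => z h _.
rewrite le_eqVlt; apply/orP; left; apply/eqP; congr (hs_sq ip _ _).
apply/funext => k'; rewrite /hs_difference indicE mem_setE in_itv/=.
by have [/h ->|] := boolP (0 <= z.1 <= t); rewrite ?mul0r.
Qed.

End TwoIntegrals.

End ItoUniqueness.

(** * Uniqueness of the hedging strategy *)

Section ProductAlmostEverywhere.
Variables (d1 d2 : measure_display) (T1 : measurableType d1).
Variables (T2 : measurableType d2) (R : realType).
Variable m1 : {sigma_finite_measure set T1 -> \bar R}.
Variable m2 : {sigma_finite_measure set T2 -> \bar R}.
Local Notation m12 := (m1 \x m2)%E.

Let null_fun d (T : measurableType d) (m : {measure set T -> \bar R})
    (f : T -> \bar R) : measurable_fun setT f -> (forall x, 0 <= f x)%E ->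
  (\int[m]_x f x = 0)%E -> {ae m, forall x, f x = 0%E}.
Proof.
move=> mf f0 f1; have /(ae_eq_integral_abs m measurableT mf) : (\int[m]_x `|f x| = 0)%E.
  by rewrite -[RHS]f1; apply: eq_integral => x _; rewrite gee0_abs.
by apply: aeS => x; exact.
Qed.

Lemma ae_product_fst (P : T1 * T2 -> Prop) : {ae m12, forall z, P z} ->
  {ae m1, forall x, {ae m2, forall y, P (x, y)}}.
Proof.
move=> [N [mN N0 PN]].
apply: aeS (null_fun (measurable_fun_xsection m2 mN) _ N0) => // x Nx.
exists (xsection N x); split => //; first exact: measurable_xsection.
by move=> y /= nP; rewrite /xsection/= inE; exact: PN.
Qed.

Lemma ae_product_snd (P : T1 * T2 -> Prop) : {ae m12, forall z, P z} ->
  {ae m2, forall y, {ae m1, forall x, P (x, y)}}.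
Proof.
move=> [N [mN N0 PN]].
have N0' : (\int[m2]_y (m1 \o ysection N) y = 0)%E.
  transitivity (\int[m12]_z (\1_N z)%:E)%E; last by rewrite integral_indic// setIT.
  rewrite fubini_tonelli2//; first last.
    exact/measurable_EFinP.
  apply: eq_integral => y _; rewrite /fubini_G/=.
  rewrite (_ : (fun x => _) = (fun x => (\1_(ysection N y) x)%:E)).
    by rewrite integral_indic ?setIT//; exact: measurable_ysection.
  by apply/funext => x; rewrite !indicE mem_ysection.
apply: aeS (null_fun (measurable_fun_ysection m1 mN) _ N0') => // y Ny.
exists (ysection N y); split => //; first exact: measurable_ysection.
by move=> x /= nP; rewrite /ysection/= inE; exact: PN.
Qed.

(** Null sections make a set null only if it is measurable; this is why the functions compared below
    must be jointly measurable. *)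
Lemma ae_product (P : T1 * T2 -> Prop) : measurable [set z | P z] ->
  {ae m1, forall x, {ae m2, forall y, P (x, y)}} -> {ae m12, forall z, P z}.
Proof.
move=> mP h; exists (~` [set z | P z]); split => //; first exact: measurableC.
rewrite /product_measure1.
transitivity (\int[m1]_x (cst 0%E x : \bar R))%E; last by rewrite integral0.
apply: ae_eq_integral => //.
- by apply: measurable_fun_xsection; exact: measurableC.
- apply: aeS h => x [N [mN N0 PN]] _ /=.
  apply/negligibleP; first by apply: measurable_xsection; exact: measurableC.
  by exists N; split => // y; rewrite /xsection/= inE; exact: PN.
Qed.

Lemma ae_product_of_snd (P : T1 * T2 -> Prop) : measurable [set z | P z] ->
  {ae m2, forall y, {ae m1, forall x, P (x, y)}} -> {ae m12, forall z, P z}.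
Proof.
move=> mP h; exists (~` [set z | P z]); set N := ~` _.
have mN : measurable N by exact: measurableC.
split => //.
transitivity (\int[m12]_z (\1_N z)%:E)%E; first by rewrite integral_indic// setIT.
rewrite fubini_tonelli2//; last exact/measurable_EFinP.
transitivity (\int[m2]_y (cst 0%E y : \bar R))%E; last by rewrite integral0.
apply: ae_eq_integral => //.
- by apply: measurable_fun_fubini_tonelli_G => //; exact/measurable_EFinP.
- apply: aeS h => y [M [mM M0 PM]] _; rewrite /fubini_G/=.
  rewrite (_ : (fun x => _) = (fun x => (\1_(ysection N y) x)%:E)); last first.
    by apply/funext => x; rewrite !indicE mem_ysection.
  have mNy : measurable (ysection N y) by exact: measurable_ysection.
  rewrite integral_indic ?setIT//; apply/negligibleP => //.
  by exists M; split => // x; rewrite /ysection/= inE; exact: PM.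
Qed.

End ProductAlmostEverywhere.

Lemma integrable_ae_eq d (X : measurableType d) (R : realType)
    (m : {measure set X -> \bar R}) (D : set X) (f g : X -> \bar R) :
  measurable D -> measurable_fun D g -> ae_eq m D f g -> m.-integrable D f ->
  m.-integrable D g.
Proof.
move=> mD mg fg /integrableP[mf fy]; apply/integrableP; split => //.
rewrite -(@ae_eq_integral _ _ _ m D (fun x => `|g x|)%E (fun x => `|f x|)%E)//.
- exact: measurableT_comp mf.
- exact: measurableT_comp mg.
- by apply: aeS fg => x h /h ->.
Qed.

Section ParametricMeasurability.
Variables (d : measure_display) (X : measurableType d) (R : realType).
Local Notation mu := (@lebesgue_measure R).
Local Notation mR := (measurableTypeR R).

(** Rounding [g] down to multiples of 1/(n+1) leaves countably many values, on each of which [f] is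
    evaluated at a fixed point; continuity in the second argument gives the limit. *)
Lemma measurable_caratheodory (f : X -> R -> R) (g : X -> R) :
  (forall u, measurable_fun setT (f ^~ u)) -> (forall x, continuous (f x)) ->
  measurable_fun setT g -> measurable_fun setT (fun x => f x (g x)).
Proof.
move=> mf cf mg.
pose q n x : R := (Num.floor (g x * n.+1%:R))%:~R / n.+1%:R.
apply: (@measurable_fun_cvg _ _ _ _ (fun n x => f x (q n x))) => [n|x _].
  apply: measurable_fun_rays => // c; rewrite setTI.
  rewrite (_ : [set x | _] = \bigcup_(k in [set: int])
      ([set x | k%:~R <= g x * n.+1%:R < (k + 1)%:~R] `&`
       [set x | f x (k%:~R / n.+1%:R) < c])).
    apply: countable_bigcupT_measurable => [|k]; first exact: countableP.
    apply: measurableI; last first.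
      have := mf (k%:~R / n.+1%:R) measurableT _ (measurable_itv `]-oo, c[).
      by rewrite setTI; congr measurable; apply/funext => y; rewrite /= in_itv.
    have mgn : measurable_fun setT (fun x => g x * n.+1%:R) by exact: measurable_funM.
    have := mgn measurableT _ (measurable_itv `[k%:~R, (k + 1)%:~R[).
    by rewrite setTI; congr measurable; apply/funext => y; rewrite /= in_itv.
  apply/seteqP; split => [y /= fy|y [k _ [/= /floor_def kE fy]]].
    by exists (Num.floor (g y * n.+1%:R)) => //; split => //; exact: floor_itv.
  by rewrite /q kE.
apply: continuous_cvg; first exact: cf.
apply: (@squeeze_cvgr _ _ _ _ (fun n => g x - n.+1%:R^-1) (fun=> g x)).
- apply: nearW => n; have /andP[h1 h2] := floor_itv (g x * n.+1%:R).
  have n0 : 0 < n.+1%:R :> R by rewrite ltr0n.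
  rewrite /q ler_pdivrMr// h1 andbT ler_pdivlMr// mulrBl mulVf ?gt_eqF//.
  by rewrite lerBlDr -[1]/(1%:~R) -intrD ltW.
- rewrite -[X in _ --> X]subr0; apply: cvgB; first exact: cvg_cst.
  exact: cvg_harmonic.
- exact: cvg_cst.
Qed.

Lemma measurable_Rintegral_param (f : X * mR -> R) : measurable_fun setT f ->
  measurable_fun setT (fun x => \int[mu]_y f (x, y)).
Proof.
move=> mf; apply: measurableT_comp => //.
have mf' : measurable_fun setT (EFin \o f) by exact/measurable_EFinP.
under eq_fun do rewrite integralE.
apply: emeasurable_funB.
- rewrite (_ : (fun x => _) = fubini_F mu ((EFin \o f)^\+)%E).
    by apply: measurable_fun_fubini_tonelli_F => //; exact: measurable_funepos.
  by apply/funext => x; rewrite /fubini_F; apply: eq_integral => y _; rewrite funeposE funeposE.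
- rewrite (_ : (fun x => _) = fubini_F mu ((EFin \o f)^\-)%E).
    by apply: measurable_fun_fubini_tonelli_F => //; exact: measurable_funeneg.
  by apply/funext => x; rewrite /fubini_F; apply: eq_integral => y _; rewrite funenegE funenegE.
Qed.

End ParametricMeasurability.

Section BackwardGronwall.
Variables (R : realType) (T : R) (r c : R -> R).
Local Notation mu := (@lebesgue_measure R).
Hypothesis T0 : 0 <= T.
Let k s := r s * c s.
Hypothesis ri : mu.-integrable setT (EFin \o r).
Hypothesis ki : mu.-integrable setT (EFin \o k).

Let E (a : R) : \bar R := (\int[mu]_(s in `]a, T]) (`|k s|)%:E)%E.

Let mk : measurable_fun [set: measurableTypeR R] (fun s => (`|k s|)%:E).
Proof.
have /integrableP[/measurable_EFinP mk _] := ki.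
by apply/measurable_EFinP; exact: measurableT_comp mk.
Qed.

Let E0 a : (0 <= E a)%E.
Proof. by apply: integral_ge0 => s _; rewrite lee_fin. Qed.

Let Efin a : (E a < +oo)%E.
Proof.
have /integrableP[_] := ki; apply: le_lt_trans.
by apply: ge0_subset_integral => //; exact: measurable_itv.
Qed.

Let Emono a b : a <= b -> (E b <= E a)%E.
Proof.
move=> ab; apply: ge0_subset_integral => //; [exact: measurable_itv..| | ].
  exact: measurable_funTS.
by move=> s /=; rewrite !in_itv/= => /andP[bs ->]; rewrite (le_lt_trans ab).
Qed.

(* Cut [0, T] into intervals on which |r| has integral less than 1/2: the tail
   integral E a of |k| then satisfies E a <= E a / 2 when E b = 0. *)
Lemma backward_gronwall :
  {ae mu, forall t, 0 <= t <= T -> c t = \int[mu]_(s in `[0, t]) k s -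
     \int[mu]_(s in `[0, T]) k s} ->
  {ae mu, forall t, 0 <= t <= T -> c t = 0}.
Proof.
move=> hc.
have hE : {ae mu, forall t, 0 <= t <= T -> (`|c t|%:E <= E t)%E}.
  apply: aeS hc => t h tT; have /andP[t0 tT'] := tT; rewrite h// distrC.
  have kT : mu.-integrable `[0, T] (EFin \o k).
    by apply: integrableS ki => //; exact: measurable_itv.
  have kt : mu.-integrable `]t, T] (EFin \o k).
    by apply: integrableS ki => //; exact: measurable_itv.
  rewrite Rintegral_itvB ?bnd_simp//.
  apply: le_trans (_ : (\int[mu]_(x in `]t, T]) `|k x|)%:E <= _)%E.
    by rewrite lee_fin; apply: le_normr_Rintegral => //; exact: measurable_itv.
  rewrite /Rintegral fineK//.
  by rewrite ge0_fin_numE; [exact: Efin|exact: E0].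
have half0 : (0 : R) < 2^-1 by rewrite invr_gt0.
have [dl [dl0 hdl]] := integral_normr_continuous ri half0.
have step a b : 0 <= a -> a <= b -> b <= T -> b - a < dl -> E b = 0%E -> E a = 0%E.
  move=> a0 ab bT bad Eb.
  have mab : measurable (`]a, b]%classic : set (measurableTypeR R)).
    exact: measurable_itv.
  have split_E : E a = (\int[mu]_(s in `]a, b]) (`|k s|)%:E)%E.
    rewrite -[RHS]adde0 -Eb /E -ge0_integral_setU//.
    - by rewrite -itv_bndbnd_setU// bnd_simp.
    - exact: measurable_funTS.
    - apply/disj_setPS => s /= []; rewrite !in_itv/= => /andP[_ sb] /andP[bs _].
      by move: (lt_le_trans bs sb); rewrite ltxx.
  have ri' : (\int[mu]_(s in `]a, b]) (`|r s|)%:E < 2^-1%:E)%E.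
    have /integrableP[_ h] : mu.-integrable `]a, b] (EFin \o r).
      exact: integrableS ri.
    have hI : (mu `]a, b]%classic < dl%:E)%E.
      by rewrite lebesgue_measure_itv/= lte_fin; case: ifP => // _;
        rewrite -EFinB lte_fin.
    have := hdl _ mab hI.
    rewrite /Rintegral -lte_fin fineK// ge0_fin_numE//.
    by apply: integral_ge0 => s _; rewrite lee_fin.
  have Ef : E a \is a fin_num by rewrite ge0_fin_numE; [exact: Efin|exact: E0].
  have le1 : (E a <= E a * \int[mu]_(s in `]a, b]) (`|r s|)%:E)%E.
    rewrite {1}split_E -ge0_integralZl//; last first.
      have /integrableP[/measurable_EFinP mr _] := ri.
      apply: measurable_funTS; apply/measurable_EFinP; exact: measurableT_comp mr.
    apply: ge0_le_integral_ae => [s _|s _|].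
    - by rewrite lee_fin.
    - by rewrite mule_ge0 ?lee_fin.
    apply: aeS hE => s hs /=; rewrite in_itv/= => /andP[as_ sb].
    rewrite /k normrM EFinM muleC; apply: lee_wpmul2r; first by rewrite lee_fin.
    apply: le_trans (hs _) _; last exact/Emono/ltW.
    by rewrite (le_trans a0 (ltW as_)) (le_trans sb).
  have : (E a <= E a * 2^-1%:E)%E.
    by apply: le_trans le1 _; apply: lee_wpmul2l => //; exact: ltW.
  rewrite -(fineK Ef) -EFinM lee_fin => h.
  have := E0 a; rewrite -(fineK Ef) lee_fin => h0.
  by congr EFin; lra.
pose N := (Num.truncn (T / dl)).+1.
have N0 : 0 < N%:R :> R by rewrite ltr0n.
have TN : T / N%:R < dl.
  by rewrite ltr_pdivrMr// mulrC -ltr_pdivrMr// truncnS_gt.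
have all_E n : (n <= N)%N -> E (T - n%:R * (T / N%:R)) = 0%E.
  elim: n => [_|n IH nN].
    by rewrite mul0r subr0 /E set_itvoc0 integral_set0.
  have TN0 : 0 <= T / N%:R by rewrite divr_ge0// ltW.
  have e : T - n.+1%:R * (T / N%:R) + T / N%:R = T - n%:R * (T / N%:R).
    by rewrite -natr1; ring.
  apply: (step _ (T - n%:R * (T / N%:R))) (IH (ltnW nN)).
  - rewrite subr_ge0 mulrCA ler_piMr// ler_pdivrMr// mul1r ler_nat//.
  - by rewrite -e lerDl.
  - by rewrite gerBl mulr_ge0.
  - by rewrite -e addrAC subrr add0r.
have E00 : E 0 = 0%E.
  by rewrite -(all_E N (leqnn N)); congr E; rewrite mulrC divfK ?subrr// gt_eqF.
apply: aeS hE => t h tT; have /andP[t0 _] := tT.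
have := le_trans (h tT) (Emono t0); rewrite E00 lee_fin => c0.
by apply/eqP; rewrite -normr_le0.
Qed.

End BackwardGronwall.

(** * The gap between two hedging strategies *)

Section Uniqueness.
Variables (R : realType) (d : measure_display) (Om : measurableType d).
Variable Q : probability Om R.
Variables (H : completeNormedModType R) (ip : {dot H for (@idfun R)}).
Hypothesis hH : separable_hilbert ip.
Variable W : R -> H -> Om -> R.
Hypothesis hW : wiener_basis Q W.
Variables v w : R -> R.
Hypothesis hvw : weight_conditions v w.
Variables (Pd : R -> Om -> R -> R^o) (sigma : R -> Om -> H -> R -> R^o).
Hypothesis hmodel : bond_model Q ip W w Pd sigma.
Variable T : R.
Hypothesis T0 : 0 <= T.
Local Notation mu := (@lebesgue_measure R).
Local Notation muQ := (mu \x Q)%E.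
Local Notation mR := (measurableTypeR R).
Local Notation F := (Fspace 1 v).
Local Notation F2 := (Fspace 2 w).

(** The strategies are measurable over [[0, T]] only; multiplied by [window], functions built from
    them are measurable on the whole product. *)
Definition window (z : mR * Om) : R := \1_`[0, T] z.1.

Lemma windowE z : window z = if 0 <= z.1 <= T then 1 else 0.
Proof. by rewrite /window indicE mem_setE in_itv/=; case: ifP. Qed.

Lemma measurable_window : measurable_fun setT window.
Proof. by apply: measurableT_comp measurable_fst; exact: measurable_indic. Qed.

Let curve t om : 0 <= t -> carrier F2 (Pd t om).
Proof. by case: hmodel => [[[+ _ _] _] _ _ _ _] t0; apply; rewrite /= in_itv/= t0. Qed.

Let curveF t om : 0 <= t -> carrier F (Pd t om).
Proof. by move=> t0; apply: (F2_sub_F1 hvw); exact: curve. Qed.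

Let curve_gt0 t s om : 0 <= t -> 0 <= s -> 0 < Pd t om s.
Proof. by case: hmodel => [_ _ + _ _]; exact. Qed.

Let curve_cvg t u om : 0 <= t -> 0 <= u ->
  Rplus_quotient (Pd t om) u x @[x --> Rplus_nbhs u] --> Rplus_D (Pd t om) u.
Proof. by move=> t0 u0; apply: F2_D_cvg u0; exact: curve. Qed.

Let curve_continuous t om : 0 <= t -> continuous (fun u : R => Pd t om (Num.max 0 u)).
Proof.
move=> t0; apply: Rplus_derivable_continuous => u u0.
by have [] := Rplus_D_cvg u0 (@curve_cvg t u om t0 u0).
Qed.

Let window_domain : measurable (`[0, T]%classic `*` setT : set (mR * Om)).
Proof. by apply: measurableX => //; exact: measurable_itv. Qed.

Lemma measurable_window_restrict (f : mR * Om -> R) :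
  (forall c, measurable ((`[0, T]%classic `*` setT) `&` [set z | f z < c])) ->
  measurable_fun setT (fun z => window z * f z).
Proof.
move=> mf; rewrite (_ : (fun z => _) = f \_ (`[0, T]%classic `*` setT)).
  by apply/(measurable_restrictT _ window_domain); exact: measurable_fun_rays.
apply/funext => z; rewrite patchE /window indicE in_setX in_setT andbT.
by case: (_ \in _); rewrite ?mul1r ?mul0r.
Qed.

Let measurable_curve_at u : 0 <= u ->
  measurable_fun setT (fun z => window z * Pd z.1 z.2 u).
Proof.
move=> u0; apply: measurable_window_restrict => c.
have [[[_ _ bP] _] _ _ _ _] := hmodel.
have := bP _ (F2_eval_nopen hvw (c := c) u0).
move=> /(measurableI _ _ window_domain); congr measurable.
apply/seteqP; split => [z [[zT _] [_ h]]//|z [[zT _] h]].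
by split => //; split => //; split => //; move: zT; rewrite /= !in_itv/= => /andP[->].
Qed.

(** Each fixed maturity gives a measurable function and the curve is continuous in the maturity, so
    the maturity may itself be a measurable function. *)
Lemma measurable_curve_along (g : mR * Om -> R) : measurable_fun setT g ->
  measurable_fun setT (fun z => window z * Pd z.1 z.2 (Num.max 0 (g z))).
Proof.
move=> mg.
apply: (measurable_caratheodory
  (f := fun z u => window z * Pd z.1 z.2 (Num.max 0 u)) _ _ mg) => [u|z].
  by apply: measurable_curve_at; rewrite le_max lexx.
rewrite windowE; have [/andP[z0 _]|_] := boolP (0 <= z.1 <= T).
  by move=> u; apply: cvgM; [exact: cvg_cst|exact: curve_continuous].
by move=> u; rewrite (_ : (fun _ => _) = fun=> 0);
  [exact: cvg_cst|apply/funext => x; rewrite mul0r].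
Qed.

Definition short_rate (z : mR * Om) : R :=
  - Rplus_D (Pd z.1 z.2) z.1 / Pd z.1 z.2 z.1.

Lemma measurable_short_rate :
  measurable_fun setT (fun z => window z * short_rate z).
Proof.
have mz : measurable_fun setT (fun z : mR * Om => z.1 : R) by exact: measurable_fst.
pose p (z : mR * Om) := window z * Pd z.1 z.2 (Num.max 0 z.1).
have mp : measurable_fun setT p by exact: measurable_curve_along.
have mD : measurable_fun setT (fun z => window z * Rplus_D (Pd z.1 z.2) z.1).
  (* The slope of the curve at its short end is a limit of difference quotients, each measurable by
     [measurable_curve_along]. *)
  apply: (@measurable_fun_cvg _ _ _ _ (fun n z =>
    (window z * Pd z.1 z.2 (Num.max 0 (z.1 + n.+1%:R^-1)) - p z) * n.+1%:R)).
    move=> n; apply: measurable_funM => //; apply: measurable_funB => //.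
    by apply: measurable_curve_along; exact: measurable_funD.
  move=> z _; rewrite /p windowE; have [/andP[z0 _]|_] := boolP (0 <= z.1 <= T).
    have := lim_right_quotient z0 (@curve_cvg _ _ z.2 z0 z0).
    rewrite [X in _ -> X @ _ --> _](_ : _ = fun n =>
      (Pd z.1 z.2 (z.1 + n.+1%:R^-1) - Pd z.1 z.2 z.1 : R) * n.+1%:R).
      by rewrite mul1r.
    by apply/funext => n; rewrite !mul1r (max_r z0) max_r// addr_ge0.
  rewrite [X in X @ _ --> _](_ : _ = fun=> 0 : R).
    by rewrite [X in _ --> X]mul0r; exact: cvg_cst.
  by apply/funext => n; rewrite !mul0r subrr mul0r.
rewrite (_ : (fun z => _) = fun z =>
    - (window z * Rplus_D (Pd z.1 z.2) z.1) * (p z)^-1).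
  apply: measurable_funM; first exact: measurable_funN.
  apply: measurable_fun_inv => // z _; rewrite /p windowE.
  case: ifPn => [/andP[z0 _]|_]; last by rewrite mul0r.
  by rewrite mul1r (max_r z0) ltW// curve_gt0.
apply/funext => z; rewrite /p /short_rate windowE.
have [/andP[z0 _]|_] := boolP (0 <= z.1 <= T).
  by rewrite !mul1r max_r.
by rewrite !mul0r oppr0 mul0r.
Qed.

(** Evaluation is bounded: P <= C N for P = Ptilde_t(t) and N the norm of Ptilde_t. Hence
    |Ptilde_t'(t)| / P is at most (C + 1) |Ptilde_t'(t)| N / P^2, a term of the moment condition. *)
Lemma short_rate_integrable : {ae Q, forall om,
  mu.-integrable setT (fun s : mR => (window (s, om) * short_rate (s, om))%:E)}.
Proof.
have mr := measurable_short_rate.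
pose f (z : mR * Om) : \bar R := (`|window z * short_rate z|)%:E.
have mf : measurable_fun setT f.
  by apply/measurable_EFinP; exact: measurableT_comp mr.
have f0 z : (0 <= f z)%E by rewrite lee_fin.
have [C C0 hC] := F2_eval_bound hvw.
pose e (s : R) om : R := `|Rplus_D (Pd s om) s| * nnorm F2 (Pd s om) / (Pd s om s) ^+ 2
  + (1 + ((Pd s om s) ^+ 2)^-1) * (nnorm (hs_space ip F2) (sigma s om)) ^+ 2.
have e0 s om : 0 <= e s om.
  by rewrite addr_ge0// ?mulr_ge0// ?addr_ge0// ?invr_ge0 ?sqr_ge0// sqrtr_ge0.
have energy : (\int[Q]_om \int[mu]_(s in `[0%R, T]) (e s om)%:E < +oo)%E.
  by have [_ _ _ /(_ T T0)] := hmodel.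
have C1 : 0 < C + 1 by rewrite ltr_wpDl.
have aux (D N P : R) : 0 <= D -> 0 <= N -> 0 < P -> P <= C * N ->
    D / P <= (C + 1) * (D * N / P ^+ 2).
  move=> D0 N0 P0 PN.
  have -> : (C + 1) * (D * N / P ^+ 2) = D / P * ((C + 1) * N / P).
    by field; rewrite gt_eqF.
  apply: ler_peMr; first by rewrite divr_ge0// ltW.
  rewrite ler_pdivlMr// mul1r (le_trans PN)//.
  by rewrite ler_wpM2r// lerDl.
have pointwise s om : 0 <= s <= T -> `|short_rate (s, om)| <= (C + 1) * e s om.
  move=> /andP[s0 sT]; rewrite /short_rate/= normrM normrN normfV.
  have P0 := curve_gt0 om s0 s0; rewrite (gtr0_norm P0).
  have := hC _ _ (curve om s0) s0; rewrite (gtr0_norm P0) => PC.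
  rewrite /e mulrDr -[leLHS]addr0; apply: lerD; last first.
    apply: mulr_ge0; first exact: ltW.
    by apply: mulr_ge0; [rewrite addr_ge0 ?invr_ge0 ?sqr_ge0|exact: sqr_ge0].
  by apply: aux; rewrite ?sqrtr_ge0.
have fy : (\int[Q]_om \int[mu]_s f (s, om) < +oo)%E.
  apply: le_lt_trans (_ : (_ <= (C + 1)%:E *
    \int[Q]_om \int[mu]_(s in `[0%R, T]) (e s om)%:E)%E) _; last first.
    by rewrite lte_mul_pinfty// lee_fin ltW.
  apply: le_trans (ge0_integralZl_lower _ C1 _); last first.
    by move=> om _; apply: integral_ge0 => s _; rewrite lee_fin.
  apply: ge0_le_integral_lower => om _; first by apply: integral_ge0.
  apply: le_trans (ge0_integralZl_lower _ C1 _); last first.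
    by move=> s _; rewrite lee_fin.
  rewrite [leRHS]integral_mkcond; apply: ge0_le_integral_lower => s _ //.
  rewrite patchE mem_setE in_itv/= /f windowE/=.
  case: ifPn => sT; last by rewrite mul0r normr0.
  by rewrite mul1r -EFinM lee_fin pointwise.
have mI : measurable_fun setT (fun om => \int[mu]_s f (s, om))%E.
  rewrite (_ : (fun om => _) = fubini_G mu f); last exact/funext.
  exact: measurable_fun_fubini_tonelli_G.
have : {ae Q, forall om, (\int[mu]_s f (s, om) \is a fin_num)%E}.
  have : Q.-integrable setT (fun om => \int[mu]_s f (s, om))%E.
    apply/integrableP; split => //.
    rewrite (_ : (\int[Q]_om _)%E = (\int[Q]_om \int[mu]_s f (s, om))%E)//.
    by apply: eq_integral => om _; rewrite gee0_abs// integral_ge0.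
  by move=> /(integrable_ae measurableT); apply: aeS => om; exact.
apply: aeS => om h; apply/integrableP; split.
  by apply/measurable_EFinP; exact: measurable_fun_pair1 mr.
by move: h; rewrite ge0_fin_numE ?integral_ge0.
Qed.

Variable xi : Om -> R.
Variables phi1 phi2 : R -> Om -> (R -> R^o) -> R^o.
Hypothesis hker : {ae muQ, forall z, 0 <= z.1 <= T ->
  sigma_adj_ker v sigma z.1 z.2 = Tspace v `[0, z.1]}.
Hypothesis h1 : hedges Q ip W v Pd sigma T phi1 xi.
Hypothesis h2 : hedges Q ip W v Pd sigma T phi2 xi.

Lemma hedges_adjoint_eq : {ae muQ, forall z, 0 <= z.1 <= T -> forall h,
  adjoint (sigma z.1 z.2) (phi1 z.1 z.2) h = adjoint (sigma z.1 z.2) (phi2 z.1 z.2) h}.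
Proof.
have [_ _ [_ [X1 ito1 e1]] _] := h1; have [_ _ [_ [X2 ito2 e2]] _] := h2.
apply: (ito_integrand_unique hH hW T0 ito1 ito2).
by apply: aeS2 e1 e2 => om -> /addrI.
Qed.

Let dual1 t om : 0 <= t <= T -> carrier (dual F) (phi1 t om).
Proof. by have [[[+ _ _] _] _ _ _] := h1 => + tT; apply; rewrite /= in_itv. Qed.

Let dual2 t om : 0 <= t <= T -> carrier (dual F) (phi2 t om).
Proof. by have [[[+ _ _] _] _ _ _] := h2 => + tT; apply; rewrite /= in_itv. Qed.

(** The coefficient c_t of delta_t in the difference of the strategies. It is also the difference of
    their values, since the bond price curve at time t is 1 at t. *)
Definition bank_gap (z : mR * Om) : R :=
  (phi1 z.1 z.2 (Pd 0 z.2) - phi2 z.1 z.2 (Pd 0 z.2)) / Pd 0 z.2 z.1.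

(* sigma* kills the difference, which therefore lies in T_[0,t]; as both
   strategies live in T_[t,oo), it is a multiple of the evaluation at t. *)
Lemma difference_eval : {ae muQ, forall z, 0 <= z.1 <= T -> forall x, carrier F x ->
  (phi1 z.1 z.2 x - phi2 z.1 z.2 x : R) = bank_gap z * x z.1}.
Proof.
have [[_ s1] _ _ _] := h1; have [[_ s2] _ _ _] := h2.
apply: aeS2 (aeS2 _ s1 s2) (aeS2 _ hker hedges_adjoint_eq); last 2 first.
- by move=> z a b; exact: (conj a b).
- by move=> z a b; exact: (conj a b).
move=> z [S1 S2] [K A] zT x Fx; have /andP[z0 _] := zT.
have D1 := dual1 z.2 zT; have D2 := dual2 z.2 zT.
have T12 : Tspace v `[0, z.1] (phi1 z.1 z.2 - phi2 z.1 z.2).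
  rewrite -(K zT); split; first exact: dualB.
  by apply/funext => h; have := A zT h; rewrite /adjoint/= => e;
    rewrite -[LHS]/((phi1 z.1 z.2 _ : R) - phi2 z.1 z.2 _) e subrr.
have P0 : 0 < Pd 0 z.2 z.1 by exact: curve_gt0.
pose a : R := - (x z.1 / Pd 0 z.2 z.1).
have Fp : carrier F (Pd 0 z.2) by exact: curveF.
have Fap : carrier F (a *: Pd 0 z.2) by have [] := F1_scale hvw a Fp.
pose y : R -> R^o := a *: Pd 0 z.2 + x.
have Fy : carrier F y by exact: (F1_lin hvw a Fp Fx).
have y0 : y z.1 = 0.
  rewrite -[LHS]/(a * (Pd 0 z.2 z.1 : R) + (x z.1 : R)) /a.
  by rewrite mulNr divfK ?gt_eqF// addNr.
have := Tspace_difference_zero hvw z0 (S1 zT) (S2 zT) T12 Fy y0.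
have lin l : carrier (dual F) l -> l y = a * (l (Pd 0 z.2) : R) + (l x : R).
  by move=> [l1 _]; rewrite /y l1.
rewrite !lin// /bank_gap /a.
move: (phi1 _ _ x : R) (phi2 _ _ x : R) (phi1 _ _ _ : R) (phi2 _ _ _ : R) (x z.1 : R)
  ((Pd 0 z.2 z.1 : R)^-1) => u1 u2 b1 b2 c i e.
have -> : u1 = c * i * b1 - c * i * b2 + u2 by lra.
ring.
Qed.

Lemma measurable_bank_gap : measurable_fun setT (fun z => window z * bank_gap z).
Proof.
have [_ [p0 F2p P0]] : process Q W F2 `[0%R, +oo[ Pd /\
    (exists2 p0, carrier F2 p0 & forall om, Pd 0 om = p0) by case: hmodel.
have Fp : carrier F p0 by exact: (F2_sub_F1 hvw).
have m1 : measurable_fun setT (fun z => window z * phi1 z.1 z.2 p0).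
  apply: measurable_window_restrict => c.
  have [[[_ _ b] _] _ _ _] := h1; exact: (b _ (dual_eval_nopen hvw (c := c) Fp)).
have m2 : measurable_fun setT (fun z => window z * phi2 z.1 z.2 p0).
  apply: measurable_window_restrict => c.
  have [[[_ _ b] _] _ _ _] := h2; exact: (b _ (dual_eval_nopen hvw (c := c) Fp)).
have mp : measurable_fun setT (fun z : mR * Om => p0 (Num.max 0 z.1) : R).
  have cp : continuous (fun u : R => p0 (Num.max 0 u) : R).
    apply: Rplus_derivable_continuous => u u0.
    by have [] := Rplus_D_cvg u0 (F2_D_cvg F2p u0).
  exact: measurableT_comp (continuous_measurable_fun cp) measurable_fst.
rewrite (_ : (fun z => _) = fun z => (window z * phi1 z.1 z.2 p0 -
    window z * phi2 z.1 z.2 p0) * (p0 (Num.max 0 z.1) : R)^-1).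
  apply: measurable_funM; first exact: measurable_funB.
  apply: measurable_fun_inv => // z _; rewrite -(P0 z.2) ltW// curve_gt0//.
  by rewrite le_max lexx.
apply/funext => z; rewrite /bank_gap P0 windowE -mulrBr -mulrA.
by case: ifPn => [/andP[z0 _]|_]; rewrite ?mul0r// (max_r z0).
Qed.

Lemma difference_value : {ae muQ, forall z, 0 <= z.1 <= T ->
  value Pd phi1 z.1 z.2 - value Pd phi2 z.1 z.2 = bank_gap z :> R}.
Proof.
apply: aeS difference_eval => z e zT; have /andP[z0 _] := zT.
have Fp : carrier F (bond_price Pd z.1 z.2).
  by have [] := F1_scale hvw ((Pd z.1 z.2 z.1)^-1) (curveF z.2 z0).
rewrite /value e// /bond_price -[X in _ * X]/((Pd z.1 z.2 z.1 : R)^-1 * (Pd z.1 z.2 z.1 : R)).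
by rewrite mulVf ?mulr1// gt_eqF// curve_gt0.
Qed.

Lemma difference_drift : {ae muQ, forall z, 0 <= z.1 <= T ->
  phi1 z.1 z.2 (bond_drift Pd z.1 z.2) - phi2 z.1 z.2 (bond_drift Pd z.1 z.2) =
  short_rate z * bank_gap z :> R}.
Proof.
apply: aeS difference_eval => z e zT; have /andP[z0 _] := zT.
have Fp : carrier F (bond_drift Pd z.1 z.2).
  by have [] := F1_scale hvw (- (Rplus_D (Pd z.1 z.2) z.1 / Pd z.1 z.2 z.1 ^+ 2))
    (curveF z.2 z0).
rewrite e// /bond_drift /short_rate.
rewrite -[X in _ * X = _]/(- ((Rplus_D (Pd z.1 z.2) z.1 : R) / (Pd z.1 z.2 z.1 : R) ^+ 2)
  * (Pd z.1 z.2 z.1 : R)).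
have P0 : 0 < (Pd z.1 z.2 z.1 : R) by exact: curve_gt0.
by move: (Pd z.1 z.2 z.1 : R) (Rplus_D _ _ : R) (bank_gap z) P0 => p D c p0;
  field; rewrite gt_eqF.
Qed.

(** The right-hand side r_t c_t of the equation for c, cut off outside [[0, T]]. *)
Definition drift_gap (z : mR * Om) : R := window z * short_rate z * bank_gap z.

Lemma measurable_drift_gap : measurable_fun setT drift_gap.
Proof.
rewrite (_ : drift_gap = fun z => (window z * short_rate z) * (window z * bank_gap z)).
  apply: measurable_funM; [exact: measurable_short_rate|exact: measurable_bank_gap].
apply/funext => z; rewrite /drift_gap windowE.
by case: ifP => _; rewrite ?mul1r ?mul0r.
Qed.

Let drift (phi : R -> Om -> (R -> R^o) -> R^o) om t : R :=
  Rintegral mu `[0, t] (fun s => phi s om (bond_drift Pd s om)).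

(* The volatility of the bonds is proportional to that of the discounted
   curve, so the two portfolios have the same martingale part. *)
Lemma difference_value_dynamics t : 0 <= t <= T -> {ae Q, forall om,
  (value Pd phi1 t om - value Pd phi1 0 om) - (value Pd phi2 t om - value Pd phi2 0 om) =
  drift phi1 om t - drift phi2 om t :> R}.
Proof.
move=> tT; have /andP[t0 tT'] := tT.
have [_ [_ /(_ t tT)[X1 i1 e1]] _ _] := h1; have [_ [_ /(_ t tT)[X2 i2 e2]] _ _] := h2.
have X12 : {ae Q, forall om, X1 om = X2 om}.
  apply: (ito_integral_unique hH hW t0 i1 i2).
  apply: aeS hedges_adjoint_eq => z A /andP[z0 zt] h.
  have zT : 0 <= z.1 <= T by rewrite z0 (le_trans zt).
  have Fs : carrier F (sigma z.1 z.2 h).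
    apply: (F2_sub_F1 hvw).
    have [_ [[cS _ _] _] _ _ _] := hmodel.
    have [+ _ _ _] : carrier (hs_space ip F2) (sigma z.1 z.2).
      by apply: cS; rewrite /= in_itv/= z0.
    exact.
  have := A zT h; rewrite /adjoint /bond_vol.
  by rewrite (dual_scale _ (dual1 z.2 zT) Fs) (dual_scale _ (dual2 z.2 zT) Fs) => ->.
apply: aeS2 X12 (aeS2 _ e1 e2); last first.
  by move=> om a b; exact: (conj a b).
move=> om x12 [-> ->]; rewrite x12 /drift.
by rewrite opprD addrACA subrr addr0.
Qed.

Lemma drift_gap_integral : {ae Q, forall om,
  mu.-integrable setT (fun s : mR => (drift_gap (s, om))%:E) /\
  forall t, 0 <= t <= T ->
    drift phi1 om t - drift phi2 om t = Rintegral mu `[0, t] (fun s => drift_gap (s, om))}.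
Proof.
have [_ [I1 _] _ _] := h1; have [_ [I2 _] _ _] := h2.
apply: aeS2 (aeS2 _ I1 I2) (ae_product_snd difference_drift); last first.
  by move=> om a b; exact: (conj a b).
move=> om [i1 i2] e.
have mT : measurable (`[0, T]%classic : set mR) by exact: measurable_itv.
have md : measurable_fun setT (fun s : mR => drift_gap (s, om)).
  exact: measurable_fun_pair1 measurable_drift_gap.
have eD : ae_eq mu `[0, T]%classic (fun s => (phi1 s om (bond_drift Pd s om) -
    phi2 s om (bond_drift Pd s om) : R)%:E) (fun s => (drift_gap (s, om))%:E).
  apply: aeS e => s /= e; rewrite in_itv/= => sT.
  by rewrite (e sT) /drift_gap windowE/= sT mul1r.
have i12 : mu.-integrable `[0, T] (fun s => (phi1 s om (bond_drift Pd s om) -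
    phi2 s om (bond_drift Pd s om) : R)%:E).
  exact: eq_integrable (integrableB mT i1 i2).
have mdT : measurable_fun (`[0, T]%classic : set mR) (fun s => (drift_gap (s, om))%:E).
  by apply/measurable_EFinP; exact: measurable_funTS.
have gT : mu.-integrable `[0, T] (fun s => (drift_gap (s, om))%:E).
  exact: integrable_ae_eq eD i12.
split.
  move: gT; rewrite (integrable_mkcond _ mT).
  apply: eq_integrable => // s _; rewrite patchE mem_setE in_itv/=.
  by case: ifPn => // sT; rewrite /drift_gap windowE/= (negbTE sT) !mul0r.
move=> t /andP[t0 tT].
have sub : (`[0, t]%classic : set mR) `<=` `[0, T]%classic.
  by move=> s /=; rewrite !in_itv/= => /andP[-> st]; exact: le_trans tT.
have mt : measurable (`[0, t]%classic : set mR) by exact: measurable_itv.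
have j1 := integrableS mT mt sub i1; have j2 := integrableS mT mt sub i2.
rewrite /drift -RintegralB// /Rintegral; congr fine.
have j12 := integrableS mT mt sub i12.
apply: ae_eq_integral => //; first exact: (measurable_int _ j12).
  by apply/measurable_EFinP; exact: measurable_funTS.
by apply: aeS eD => s h st; apply: h; exact: sub.
Qed.

(** Minus the integral of the drift from t to T, in the form that [backward_gronwall] expects. *)
Definition drift_tail (z : mR * Om) : R :=
  Rintegral mu `[0, z.1] (fun s => drift_gap (s, z.2)) -
  Rintegral mu `[0, T] (fun s => drift_gap (s, z.2)).

Lemma measurable_drift_tail : measurable_fun setT drift_tail.
Proof.
have mg (g : mR * Om -> R) : measurable_fun setT g -> measurable_fun setT
    (fun z : mR * Om => Rintegral mu `[0, g z] (fun s => drift_gap (s, z.2))).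
  move=> mg.
  (* The lower limit disappears because [drift_gap] is zero at negative times; the moving upper
     limit becomes a measurable condition in the integrand. *)
  rewrite (_ : (fun z => _) = fun z => \int[mu]_s
      ((if (s <= g z)%R then drift_gap (s, z.2) else 0) : R)).
    apply: (measurable_Rintegral_param (f := fun y : (mR * Om) * mR =>
      if (y.2 <= g y.1)%R then drift_gap (y.2, y.1.2) else 0 : R)).
    apply: measurable_fun_ifT => //.
      apply: measurable_fun_ler; first exact: measurable_snd.
      exact: measurableT_comp measurable_fst.
    apply: measurableT_comp measurable_drift_gap _ => //.
    apply: measurable_fun_pair; first exact: measurable_snd.
    exact: measurableT_comp measurable_snd measurable_fst.
  apply/funext => z; rewrite /Rintegral integral_mkcond; congr fine.
  apply: eq_integral => s _; rewrite patchE mem_setE in_itv/=.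
  case: (leP s (g z)) => _; last by rewrite andbF.
  rewrite andbT; case: ifPn => // s0.
  by rewrite /drift_gap windowE/= (negbTE s0) !mul0r.
apply: measurable_funB; first by apply: mg; exact: measurable_fst.
exact: (mg (fun=> T)).
Qed.

(** The value equation at [t] minus that at [T] eliminates the unknown initial values, and the
    values at [T] are both xi. This holds for each [t] almost surely, and [ae_product] makes it hold
    almost everywhere. *)
Lemma bank_gap_tail : {ae muQ, forall z, 0 <= z.1 <= T -> bank_gap z = drift_tail z}.
Proof.
have dynamics t : 0 <= t <= T -> {ae Q, forall om,
    value Pd phi1 t om - value Pd phi2 t om = drift_tail (t, om) :> R}.
  move=> tT; have TT : 0 <= T <= T by rewrite T0 lexx.
  have [_ _ _ v1] := h1; have [_ _ _ v2] := h2.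
  have vT : {ae Q, forall om, value Pd phi1 T om = value Pd phi2 T om}.
    by apply: aeS2 v1 v2 => om -> ->.
  apply: aeS2 (aeS2 _ (difference_value_dynamics tT) (difference_value_dynamics TT))
    (aeS2 _ vT drift_gap_integral); last 2 first.
  - by move=> om a b; exact: (conj a b).
  - by move=> om a b; exact: (conj a b).
  move=> om [et eT] [vTom [_ g]].
  rewrite /drift_tail -(g t tT) -(g T TT) -et -eT vTom; ring.
apply: ae_product.
  rewrite (_ : [set z | _] = (fun z => window z * bank_gap z - window z * drift_tail z)
      @^-1` [set 0]).
    rewrite -[X in measurable X]setTI.
    have mf : measurable_fun setT
        (fun z => window z * bank_gap z - window z * drift_tail z).
      apply: measurable_funB; first exact: measurable_bank_gap.
      by apply: measurable_funM; [exact: measurable_window|exact: measurable_drift_tail].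
    exact: mf measurableT _ (measurable_set1 _).
  apply/seteqP; split => z; rewrite /= windowE; case: ifP => zT.
  - by move=> ->//; rewrite subrr.
  - by rewrite !mul0r subrr.
  - by rewrite !mul1r => /eqP; rewrite subr_eq0 => /eqP.
  - by [].
apply: aeS (ae_product_fst difference_value) => t e.
have [tT|tT] := boolP (0 <= t <= T); last by apply: aeW => om h; case/negP: tT.
by apply: aeS2 e (dynamics t tT) => om e1 e2 _; rewrite -(e1 tT) -e2.
Qed.

(** Sections are now taken the other way: for almost every path the equation holds at almost every
    time, which is all that Gronwall's inequality asks. *)
Lemma bank_gap_eq0 : {ae muQ, forall z, 0 <= z.1 <= T -> bank_gap z = 0}.
Proof.
apply: ae_product_of_snd.
  rewrite (_ : [set z | _] = (fun z => window z * bank_gap z) @^-1` [set 0]).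
    rewrite -[X in measurable X]setTI.
    exact: measurable_bank_gap measurableT _ (measurable_set1 _).
  apply/seteqP; split => z; rewrite /= windowE; case: ifP => zT.
  - by move=> ->//; rewrite mulr0.
  - by rewrite mul0r.
  - by rewrite mul1r.
  - by [].
apply: aeS2 (aeS2 _ short_rate_integrable drift_gap_integral)
  (ae_product_snd bank_gap_tail); last first.
  by move=> om a b; exact: (conj a b).
move=> om [ri [ki _]] e.
exact: (backward_gronwall (r := fun s => window (s, om) * short_rate (s, om))
  (c := fun s => bank_gap (s, om)) T0 ri ki).
Qed.

Lemma hedges_unique : {ae muQ, forall z, 0 <= z.1 <= T ->
  forall x, carrier F x -> phi1 z.1 z.2 x = phi2 z.1 z.2 x}.
Proof.
apply: aeS2 difference_eval bank_gap_eq0 => z e c0 zT x Fx.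
by have := e zT x Fx; rewrite (c0 zT) mul0r => /eqP; rewrite subr_eq0 => /eqP.
Qed.

End Uniqueness.

Theorem proposition3p7
  (R : realType) (d : measure_display) (Om : measurableType d)
  (Q : probability Om R)
  (H : completeNormedModType R) (ip : {dot H for (@idfun R)})
  (hH : separable_hilbert ip)
  (W : R -> H -> Om -> R) (hW : wiener_basis Q W)
  (v w : R -> R) (hvw : weight_conditions v w)
  (Pd : R -> Om -> R -> R^o) (sigma : R -> Om -> H -> R -> R^o)
  (hmodel : bond_model Q ip W w Pd sigma)
  (T : R) (hT : 0 <= T)
  (hker : {ae (@lebesgue_measure R \x Q)%E, forall z, 0 <= z.1 <= T ->
             sigma_adj_ker v sigma z.1 z.2 = Tspace v `[0, z.1]})
  (xi : Om -> R) (hxi : claim Q W T xi)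
  (phi1 phi2 : R -> Om -> (R -> R^o) -> R^o)
  (h1 : hedges Q ip W v Pd sigma T phi1 xi)
  (h2 : hedges Q ip W v Pd sigma T phi2 xi) :
  {ae (@lebesgue_measure R \x Q)%E, forall z, 0 <= z.1 <= T ->
     forall x, carrier (Fspace 1 v) x -> phi1 z.1 z.2 x = phi2 z.1 z.2 x}.
Proof. exact (hedges_unique hH hW hvw hmodel hT hker h1 h2). Qed.
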